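(* Let $K\subseteq\mathbb{R}^d$ be compact and $\alpha\in[0,1]$. If $\mu,\nu$ are Borel probability measures on $K$, there exists a minimizer $\eta$ of the problem $$\min_{\eta\in\mathrm{IP}(\mu,\nu)}\ \mathbf{I}_\alpha(\eta),\qquad \mathbf{I}_\alpha(\eta)=\int_\Gamma\int_0^\infty|\gamma(t)|_\eta^{\alpha-1}|\dot\gamma(t)|\,dt\,\eta(d\gamma)\in[0,\infty].$$
   Context: $\Gamma=\Gamma(K)$ is the space of $1$-Lipschitz curves $\gamma:\mathbb{R}_+\to K$ with the topology of uniform convergence on compact sets. $L(\gamma)=\int_0^\infty|\dot\gamma(t)|\,dt$. An irrigation plan is a Borel probability measure $\eta$ on $\Gamma$ with $\int_\Gamma L(\gamma)\,\eta(d\gamma)<\infty$; $\mathrm{IP}(K)$ is the set of irrigation plans. $\mathrm{IP}(\mu,\nu)$ is the set of $\eta\in\mathrm{IP}(K)$ with $(\pi_0)_\#\eta=\mu$ and $(\pi_\infty)_\#\eta=\nu$, where $\pi_0(\gamma)=\gamma(0)$ and $\pi_\infty(\gamma)=\lim_{t\to\infty}\gamma(t)$ (defined when $L(\gamma)<\infty$, hence $\eta$-a.e.). The multiplicity is $|x|_\eta=\eta(\{\gamma\in\Gamma: x\in\gamma\})$, where $x\in\gamma$ means $x\in\gamma(\mathbb{R}_+)$. Conventions: $0^{\alpha-1}=\infty$ if $\alpha<1$, $0^{\alpha-1}=1$ if $\alpha=1$, and $\infty\times0=0$.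
   Formalization: The formal theorem additionally assumes that IP(μ,ν) is nonempty; without this the claim fails, e.g. K = {0,1}, μ = δ_0, ν = δ_1, where no curve in K joins 0 to 1 and so no minimizer exists. *)

(* Defs.v *)
From HB Require Import structures.
From mathcomp Require Import all_boot all_order all_algebra.
From mathcomp Require Import all_classical all_reals all_analysis.

Set Implicit Arguments.
Unset Strict Implicit.
Unset Printing Implicit Defensive.

Import Order.TTheory GRing.Theory Num.Theory numFieldNormedType.Exports.

Local Open Scope classical_set_scope.
Local Open Scope ring_scope.

(* The library norm on 'rV[R]_d is the sup norm: it induces the same topology
   as the Euclidean one but not the same Lipschitz curves, lengths or speeds. *)
Definition enorm (R : realType) (d : nat) (v : 'rV[R]_d) : R :=
  Num.sqrt (\sum_(i < d) v ord0 i ^+ 2).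

Notation borelType T := (g_sigma_algebraType (@open T)).

(* A curve on R_+ is encoded by its extension to R which is constant on
   ]-oo, 0]. Uniform convergence on a compact A of R is then uniform
   convergence on the compact subset {max(t, 0) | t in A} of R_+, so the
   topology is that of uniform convergence on the compact subsets of R_+. *)
Definition lip1_curve (R : realType) (d : nat) :
    set {family compact, R -> 'rV[R]_d} :=
  [set g | (forall s t : R, 0 <= s -> 0 <= t ->
              enorm (g s - g t) <= `|s - t|) /\
           (forall t : R, t <= 0 -> g t = g 0)].

Definition curve (R : realType) (d : nat) : Type :=
  set_type (@lip1_curve R d).

HB.instance Definition _ (R : realType) (d : nat) :=
  Topological.on (curve R d).

Definition curve_fun (R : realType) (d : nat) (g : curve R d) :
  R -> 'rV[R]_d := set_val g.
Coercion curve_fun : curve >-> Funclass.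

Lemma lip1_curve_cst0 (R : realType) (d : nat) :
  lip1_curve ((fun=> 0) : {family compact, R -> 'rV[R]_d}).
Proof.
split=> // s t _ _.
rewrite subrr /enorm big1 ?sqrtr0 // => i _.
by rewrite mxE expr0n.
Qed.

(* The library requires measurable types to be inhabited, and Gamma(K) is empty
   when K is. Borel probability measures on K and on Gamma(K) are therefore
   represented by the Borel probability measures on the ambient spaces
   'rV[R]_d and curve R d that give mass 1 to K and to Gamma K. *)
HB.instance Definition _ (R : realType) (d : nat) :=
  isPointed.Build (curve R d)
    (SigSub (mem_set (lip1_curve_cst0 R d)) : set_type _).

HB.instance Definition _ (R : realType) (d : nat) :=
  Measurable.copy (curve R d) (borelType (curve R d)).

Section irrigation.
Context {R : realType} {d : nat}.
Local Notation E := 'rV[R]_d.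
Local Notation mu_L := (@lebesgue_measure R).
Implicit Types (K : set E) (g : curve R d) (alpha : R).
Implicit Types eta : probability (curve R d) R.
Local Open Scope ereal_scope.

Definition Gamma K : set (curve R d) :=
  [set g | forall t : R, (0 <= t)%R -> K (g t)].

(* 1-Lipschitz curves are differentiable almost everywhere; where the derivative
   does not exist, derive1 has a default value, which no integral sees. *)
Definition speed g (t : R) : R := enorm (derive1 (g : R -> E) t).

Definition curve_length g : \bar R :=
  \int[mu_L]_(t in `[0%R, +oo[) (speed g t)%:E.

Definition pi0 : curve R d -> borelType E :=
  fun g => g 0%R.

(* Meaningful only when the limit exists, e.g. if g has finite length, hence
   eta-almost everywhere for eta in IP K. *)
Definition pioo : curve R d -> borelType E :=
  fun g => lim (g t @[t --> +oo%R]).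

Definition IP K : set (probability (curve R d) R) :=
  [set eta | eta (Gamma K) = 1 /\
             \int[eta]_(g in Gamma K) curve_length g < +oo].

Definition IP_between K (mu nu : probability (borelType E) R) :
    set (probability (curve R d) R) :=
  [set eta | IP K eta /\
    (forall A : set (borelType E), measurable A ->
       pushforward eta pi0 A = mu A) /\
    (forall A : set (borelType E), measurable A ->
       pushforward eta pioo A = nu A)].

Definition multiplicity K eta (x : E) : \bar R :=
  eta [set g | Gamma K g /\ exists2 t : R, (0 <= t)%R & g t = x].

(* m ^ (alpha - 1) with 0 ^ (alpha - 1) = +oo for alpha < 1 and = 1 for
   alpha = 1; the library power function maps 0 to 0 for every nonzero
   exponent. The convention +oo * 0 = 0 is the library's. *)
Definition mpow alpha (m : \bar R) : \bar R :=
  if (m == 0) && (alpha < 1)%R then +oo else m `^ (alpha - 1).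

Definition irrigation_cost K alpha eta : \bar R :=
  \int[eta]_(g in Gamma K)
    \int[mu_L]_(t in `[0%R, +oo[)
      (mpow alpha (multiplicity K eta ((g : curve R d) t)) * (speed g t)%:E).

End irrigation.

(* Main.v *)
(* Let w_eta x = |x|_eta^(alpha - 1) >= 1. When w_eta is lower semicontinuous, the
   inner integral of the cost is the weighted length
   sup sum_i (inf_[t_i, t_(i+1)] w_eta o gamma) |gamma(t_(i+1)) - gamma(t_i)|,
   which is jointly lower semicontinuous in the weight and the curve.
   Parametrizing curves by arc length preserves marginals, does not increase the
   cost (the multiplicity can only grow) and makes every curve stop at a time
   equal to its length. By Markov's inequality a plan eta of cost at most M then
   satisfies eta(gamma moves after time k) <= M / k. Apply this to a minimizing
   sequence (eta_n) and take its limit eta along an ultrafilter, Gamma(K) being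
   compact. The uniform tail bound gives the marginals of eta at infinity and the
   joint upper semicontinuity limsup |x_n|_(eta_n) <= |x|_eta as x_n -> x, hence the
   joint lower semicontinuity of the weights. Fatou's lemma for varying measures
   and integrands then bounds the cost of eta by the infimum. *)
Require Import Defs.
From HB Require Import structures.
From mathcomp Require Import all_boot all_order all_algebra.
From mathcomp Require Import all_classical all_reals all_analysis.
From mathcomp Require Import measurable_realfun.
From mathcomp Require Import ring lra.
Set Implicit Arguments.
Unset Strict Implicit.
Unset Printing Implicit Defensive.
Import Order.TTheory GRing.Theory Num.Theory numFieldNormedType.Exports.
Local Open Scope classical_set_scope.
Local Open Scope ring_scope.

(** * Limits of probabilities along an ultrafilter *)

(** The obstacle is that the multiplicity of a general plan need not be upper semicontinuous. For a
    Dirac mass at a curve that approaches its limit without reaching it, the multiplicity is 1 along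
    the curve and 0 at the limit, so for [alpha < 1] the weight is not lower semicontinuous there.
    The tail bound repairs this: up to a mass [M / k] only visits before time [k] count, and those
    are governed by closed sets of curves. A general plan is therefore used only through
    inequalities between integrals that survive without measurability, and semicontinuity is proved
    for plans with a tail bound. The ultrafilter replaces the extraction of a subsequence: the
    masses of all measurable sets converge at once. The price is a limit that is only finitely
    additive, so the limit measure is rebuilt from its values on compact sets. The mass that it
    gives to an open set is then a supremum of limiting masses of compact subsets, and this lets the
    measure and the integrand vary together in Fatou's lemma: a compact set inside a limiting
    superlevel set lies in the superlevel sets of [U]-almost all indices. *)

(** The sets satisfying [P] form an ideal. The families containing all supersets of some member of
    this ideal form a filter, and near-covering compactness along it yields a member of the ideal
    that contains [H]. *)
Lemma compact_induction (X : topologicalType) (P : set X -> Prop) (H : set X) :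
  compact H -> P set0 ->
  (forall A B, P A -> P B -> P (A `|` B)) ->
  (forall A B, A `<=` B -> P B -> P A) ->
  (forall x, H x -> exists2 N, nbhs x N & P N) -> P H.
Proof.
move=> /compact_near_coveringP cH P0 PU PS loc.
pose F := filter_from P (fun A0 => [set A | A0 `<=` A]).
have FF : Filter F.
  apply: filter_from_filter; first by exists set0.
  move=> A B PA PB; exists (A `|` B); first exact: PU.
  by move=> D ABD; split => x Dx; apply: ABD; [left|right].
have [x Hx|A PA /(_ A (fun _ => id))] := cH _ F (fun A x => A x) FF.
  have [N Nx PN] := loc _ Hx.
  exists (N, [set A | N `<=` A]); first by split => //; exists N.
  by move=> [y A] [/= Ny]; exact.
by move=> /PS; exact.
Qed.

(** * From a content on compact sets to a Borel probability *)

Section compact_content.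
Context {R : realType} {X : ptopologicalType}.
Hypotheses (hX : hausdorff_space X) (rX : regular_space X).
Local Open Scope ereal_scope.

(** By regularity each point of [H] has a closed neighbourhood inside [G1] or inside [G2];
    [compact_induction] glues finitely many of them. This is what makes the inner content
    subadditive on open sets. *)
Lemma compact_setU_split (H G1 G2 : set X) :
  compact H -> open G1 -> open G2 -> H `<=` G1 `|` G2 ->
  exists H1 H2, [/\ compact H1, compact H2, H1 `<=` G1, H2 `<=` G2 &
                    H = H1 `|` H2].
Proof.
move=> cH oG1 oG2 HG.
suff [F1 [F2 [cF1 cF2 FG1 FG2 HF]]] : exists F1 F2 : set X,
    [/\ closed F1, closed F2, F1 `<=` G1, F2 `<=` G2 & H `<=` F1 `|` F2].
  exists (H `&` F1), (H `&` F2); split.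
  - apply: (subclosed_compact _ cH (@subIsetl _ _ _)).
    by apply: closedI => //; exact: (compact_closed hX cH).
  - apply: (subclosed_compact _ cH (@subIsetl _ _ _)).
    by apply: closedI => //; exact: (compact_closed hX cH).
  - by move=> x [_ /FG1].
  - by move=> x [_ /FG2].
  - by rewrite -setIUr; apply/esym/setIidPl.
apply: (@compact_induction _ (fun S => exists F1 F2 : set X,
    [/\ closed F1, closed F2, F1 `<=` G1, F2 `<=` G2 & S `<=` F1 `|` F2]) _ cH).
- by exists set0, set0; split => //; exact: closed0.
- move=> A B [F1 [F2 [? ? FG1 FG2 AF]]] [E1 [E2 [? ? EG1 EG2 BE]]].
  exists (F1 `|` E1), (F2 `|` E2); split; try exact: closedU.
  + by move=> x [/FG1|/EG1].
  + by move=> x [/FG2|/EG2].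
  + by move=> x [/AF[]|/BE[]] ?; [left;left|right;left|left;right|right;right].
- move=> A B AB [F1 [F2 [? ? ? ? BF]]]; exists F1, F2; split => //.
  exact: subset_trans BF.
- move=> x /HG[Gx|Gx].
    have [N Nx NG] := rX (open_nbhs_nbhs (conj oG1 Gx)).
    exists N => //; exists (closure N), set0; split => //.
    + exact: closed_closure.
    + exact: closed0.
    + by move=> y Ny; left; exact: subset_closure.
  have [N Nx NG] := rX (open_nbhs_nbhs (conj oG2 Gx)).
  exists N => //; exists set0, (closure N); split => //.
  + exact: closed0.
  + exact: closed_closure.
  + by move=> y Ny; right; exact: subset_closure.
Qed.

Variable m : set X -> R.
Hypothesis m_le1 : forall A, compact A -> (m A <= 1)%R.
Hypothesis m_disj : forall A B, compact A -> compact B -> A `&` B = set0 ->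
  m (A `|` B) = (m A + m B)%R.
Hypothesis m_sub : forall A B, compact A -> compact B ->
  (m (A `|` B) <= m A + m B)%R.

(** The classical extension of a content: inner approximation of open sets by compact ones, then
    outer approximation of all sets by open ones. The content [m] will be the limit of masses along
    the ultrafilter. *)
Definition inner_content (G : set X) : \bar R :=
  ereal_sup [set (m H)%:E | H in [set H | compact H /\ H `<=` G]].

Definition outer_content (A : set X) : \bar R :=
  ereal_inf [set inner_content G | G in [set G | open G /\ A `<=` G]].

Local Notation lam := inner_content.
Local Notation mus := outer_content.

Lemma compact0_content : m set0 = 0%R.
Proof.
have := m_disj (@compact0 X) (@compact0 X) (setI0 _); rewrite setU0.
by lra.
Qed.

Lemma inner_content_ub (G H : set X) : compact H -> H `<=` G ->
  (m H)%:E <= lam G.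
Proof. by move=> cH HG; apply: ereal_sup_ubound; exists H. Qed.

Lemma inner_content_ge0 (G : set X) : 0 <= lam G.
Proof.
by have := inner_content_ub (@compact0 X) (@sub0set _ G); rewrite compact0_content.
Qed.

Lemma inner_content_le1 (G : set X) : lam G <= 1.
Proof. by apply: ge_ereal_sup => _ [H [cH _] <-]; rewrite lee_fin m_le1. Qed.

Lemma le_inner_content (G1 G2 : set X) : G1 `<=` G2 -> lam G1 <= lam G2.
Proof.
move=> G12; apply: ge_ereal_sup => _ [H [cH HG] <-].
by apply: inner_content_ub => //; exact: subset_trans G12.
Qed.

Lemma outer_content_lb (A G : set X) : open G -> A `<=` G -> mus A <= lam G.
Proof. by move=> oG AG; apply: ereal_inf_lbound; exists G. Qed.

Lemma outer_content_ge0 (A : set X) : 0 <= mus A.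
Proof.
by apply: le_ereal_inf_tmp => _ [G _ <-]; exact: inner_content_ge0.
Qed.

Lemma outer_content_open (G : set X) : open G -> mus G = lam G.
Proof.
move=> oG; apply/eqP; rewrite eq_le outer_content_lb//=.
by apply: le_ereal_inf_tmp => _ [G' [_ GG'] <-]; exact: le_inner_content.
Qed.

Lemma outer_content_le1 (A : set X) : mus A <= 1.
Proof.
apply: le_trans (inner_content_le1 setT).
by apply: outer_content_lb; [exact: openT|].
Qed.

Lemma outer_content_fin (A : set X) : mus A \is a fin_num.
Proof.
rewrite ge0_fin_numE ?outer_content_ge0//.
exact: le_lt_trans (outer_content_le1 A) (ltry _).
Qed.

Lemma inner_content_bigsetU (G : (set X)^nat) (n : nat) (H : set X) :
  (forall k, open (G k)) -> compact H ->
  H `<=` \big[setU/set0]_(k < n) G k -> (m H)%:E <= \sum_(k < n) lam (G k).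
Proof.
move=> oG; elim: n H => [|n IH] H cH.
  rewrite !big_ord0 subset0 => ->; rewrite lee_fin.
  by rewrite compact0_content.
rewrite !big_ord_recr/= => HG.
have oB : open (\big[setU/set0]_(k < n) G k).
  by rewrite -bigcup_mkord; apply: bigcup_open => k _; exact: oG.
have [H1 [H2 [cH1 cH2 HG1 HG2 HE]]] := compact_setU_split cH oB (oG n) HG.
rewrite HE; apply: (@le_trans _ _ (m H1 + m H2)%:E).
  by rewrite lee_fin m_sub.
by rewrite EFinD leeD// ?IH// inner_content_ub.
Qed.

Lemma inner_content_sigma (G : (set X)^nat) : (forall k, open (G k)) ->
  lam (\bigcup_k G k) <= \sum_(k <oo) lam (G k).
Proof.
move=> oG; apply: ge_ereal_sup => _ [H [cH HG] <-].
have [x Hx|N _ /(_ N (leqnn _)) HN] :=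
  (compact_near_coveringP H).1 cH _ \oo
    (fun n x => (\big[setU/set0]_(k < n) G k) x) _.
  have [k _ Gkx] := HG _ Hx.
  exists (G k, [set n | (k < n)%N]).
    split; last by exists k.+1.
    by apply: open_nbhs_nbhs; split => //; exact: oG.
  move=> [y n] [/= Gky kn]; rewrite -bigcup_mkord.
  by exists k.
apply: le_trans (inner_content_bigsetU oG cH HN) _.
rewrite -(big_mkord xpredT (fun k => lam (G k))).
by apply: nneseries_lim_ge => k _ _; exact: inner_content_ge0.
Qed.

Lemma outer_content0 : mus set0 = 0.
Proof.
rewrite outer_content_open; last exact: open0.
apply/eqP; rewrite eq_le inner_content_ge0 andbT.
apply: ge_ereal_sup => _ [H [_ H0] <-]; move: H0; rewrite subset0 => ->.
by rewrite compact0_content.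
Qed.

Lemma outer_content_sigma (A : set X) (F : (set X)^nat) :
  subset_sigma_subadditive mus A F.
Proof.
move=> AF; apply/lee_addgt0Pr => e e0.
apply: le_trans (epsilon_trick _ _ (ltW e0)); last first.
  by move=> n; exact: outer_content_ge0.
have en_gt0 n : (0 < e / (2 ^ n.+1)%:R)%R.
  by rewrite divr_gt0// ltr0n expn_gt0.
have /choice[G HG] : forall n, exists G, [/\ open G, F n `<=` G &
    lam G <= mus (F n) + (e / (2 ^ n.+1)%:R)%:E].
  move=> n.
  have [_ [G [oG FG] <-] Glt] := lb_ereal_inf_adherent (en_gt0 n)
    (outer_content_fin (F n)).
  by exists G; split => //; exact: ltW.
apply: (@le_trans _ _ (lam (\bigcup_k G k))).
  apply: outer_content_lb; first by apply: bigcup_open => k _; have [] := HG k.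
  by move=> x /AF[k _ Fkx]; exists k => //; have [_ + _] := HG k; exact.
apply: le_trans (inner_content_sigma _) _; first by move=> k; have [] := HG k.
apply: lee_nneseries => [n _ _|n _]; first exact: inner_content_ge0.
by have [] := HG n.
Qed.

Definition content_outer : {outer_measure set X -> \bar R} :=
  HB.pack_for {outer_measure set X -> \bar R} outer_content
    (isSubsetOuterMeasure.Build R X outer_content outer_content0
      outer_content_ge0 outer_content_sigma).

(** For an open [G] containing [A], take a compact [H0] inside [G] minus [F], then a compact [H1]
    inside [G] minus [H0]. They are disjoint and their union lies in [G], so their contents add up
    to at most that of [G]; and [A] meets [F] inside the open set [G] minus [H0]. *)
Lemma closed_caratheodory (F : set X) : closed F -> content_outer.-caratheodory F.
Proof.
move=> cF; apply: le_caratheodory_measurable => A /=.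
change (mus (A `&` F) + mus (A `&` ~` F) <= mus A).
apply: le_ereal_inf_tmp => _ [G [oG AG] <-].
have oGF : open (G `&` ~` F) by apply: openI => //; exact: closed_openC.
apply: (@le_trans _ _ (mus (G `&` F) + lam (G `&` ~` F))).
  apply: leeD.
    apply: le_ereal_inf_tmp => _ [U [oU GU] <-]; apply: outer_content_lb => //.
    by move=> x [/AG Gx Fx]; exact: GU.
  by apply: outer_content_lb => // x [/AG].
rewrite -leeBrDl ?outer_content_fin//.
apply: ge_ereal_sup => _ [H0 [cH0 HG0] <-].
rewrite leeBrDl ?outer_content_fin// -leeBrDr//.
have cH0' := compact_closed hX cH0.
apply: (@le_trans _ _ (lam (G `&` ~` H0))).
  apply: outer_content_lb; first by apply: openI => //; exact: closed_openC.
  by move=> x [Gx Fx]; split => // /HG0[_].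
apply: ge_ereal_sup => _ [H1 [cH1 HG1] <-].
rewrite leeBrDr// -EFinD -m_disj//; last first.
  by rewrite -subset0 => x [/HG1[_]].
by apply: inner_content_ub; [exact: compactU|move=> x [/HG1[]|/HG0[]]].
Qed.

Lemma borel_caratheodory :
  (@measurable _ (borelType X)) `<=` content_outer.-caratheodory.
Proof.
apply: smallest_sub.
  split.
  - exact: caratheodory_measurable_set0.
  - by move=> A mA; rewrite setTD; exact: caratheodory_measurable_setC.
  - by move=> F mF; exact: caratheodory_measurable_bigcup.
move=> G oG; rewrite -(setCK G); apply: caratheodory_measurable_setC.
by apply: closed_caratheodory; exact: open_closedC.
Qed.

Lemma content_semi_sigma_additive :
  semi_sigma_additive (content_outer : set (borelType X) -> \bar R).
Proof.
move=> F mF tF mbF; apply: caratheodory_measure_sigma_additive => //.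
- by move=> i; exact: borel_caratheodory.
- exact: borel_caratheodory.
Qed.

Definition content_measure : {measure set (borelType X) -> \bar R} :=
  HB.pack_for {measure set (borelType X) -> \bar R}
    (content_outer : set (borelType X) -> \bar R)
    (isMeasure.Build _ (borelType X) R
      (content_outer : set (borelType X) -> \bar R)
      outer_content0 outer_content_ge0 content_semi_sigma_additive).

Lemma content_probability (C : set X) : compact C -> m C = 1%R ->
  exists P : probability (borelType X) R,
    forall G, open G -> P G = inner_content G.
Proof.
move=> cC mC.
have P1 : content_measure setT = 1.
  change (mus setT = 1); rewrite outer_content_open; last exact: openT.
  apply/eqP; rewrite eq_le inner_content_le1/= -mC.
  exact: inner_content_ub.
exists (HB.pack_for (probability (borelType X) R) (Measure.sort content_measure)
  (Measure_isProbability.Build _ _ _ content_measure P1)).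
by move=> G oG; exact: outer_content_open.
Qed.

End compact_content.

(* The integrand of the irrigation cost of an arbitrary plan is not known to be
   measurable, so comparisons of costs have to do without measurability. *)
Section nonmeasurable_integral.
Context d (T : measurableType d) (R : realType).
Variable mu : {measure set T -> \bar R}.
Local Open Scope ereal_scope.
Import HBNNSimple.

Lemma ge0_le_integral_nonmeasurable (D : set T) (f g : T -> \bar R) :
  (forall x, D x -> 0 <= f x) -> (forall x, D x -> f x <= g x) ->
  \int[mu]_(x in D) f x <= \int[mu]_(x in D) g x.
Proof.
move=> f0 fg; rewrite 2!(integral_mkcond D).
have g0 x : D x -> 0 <= g x by move=> Dx; apply: le_trans (fg x Dx); exact: f0.
rewrite (ge0_integralTE _ (erestrict_ge0 f0)) (ge0_integralTE _ (erestrict_ge0 g0)).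
apply: ereal_sup_le => _ [h hf <-]; exists h => // x.
by apply: le_trans (hf x) _; exact: lee_restrict.
Qed.

Lemma ge0_negligible_integral_nonmeasurable (D N : set T) (f : T -> \bar R) :
  measurable D -> measurable N -> mu N = 0 -> (forall x, D x -> 0 <= f x) ->
  \int[mu]_(x in D) f x = \int[mu]_(x in D `\` N) f x.
Proof.
move=> mD mN N0 f0; apply/eqP; rewrite eq_le; apply/andP; split; last first.
  rewrite (integral_mkcond D) (integral_mkcond (D `\` N)); apply: ge0_le_integral_nonmeasurable => x _.
    by apply: erestrict_ge0 => y [Dy _]; exact: f0.
  rewrite !patchE; case: ifPn; rewrite ?inE//=.
    by move=> [Dx _]; rewrite mem_set.
  by move=> _; case: ifPn; rewrite ?inE// => /f0.
rewrite integral_mkcond (ge0_integralTE _ (erestrict_ge0 f0)).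
apply: ge_ereal_sup => _ [h hf <-].
have -> : sintegral mu h = \int[mu]_(x in setT `\` N) (h x)%:E.
  rewrite -ge0_negligible_integral//.
  - by rewrite integral_nnsfun//= patch_setT.
  - apply/measurable_EFinP; exact: measurable_funTS.
  - by move=> x _; rewrite lee_fin.
rewrite (integral_mkcond (setT `\` N)) (integral_mkcond (D `\` N)).
apply: ge0_le_integral_nonmeasurable => x _.
  by apply: erestrict_ge0 => y _; rewrite lee_fin.
have := hf x; rewrite !patchE setTD !in_setD !in_setC.
by case: (x \in D) => //=; case: (x \in N).
Qed.

End nonmeasurable_integral.

Section ultralimit.
Context {R : realType} {X : ptopologicalType}.
Hypotheses (hX : hausdorff_space X) (rX : regular_space X).
Variables (U : set_system nat) (UU : UltraFilter U).
Variable eta_ : nat -> probability (borelType X) R.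
Variables (C : set X) (cC : compact C).
Hypothesis eta_C : forall n, eta_ n C = 1%E.
Local Open Scope ereal_scope.

Lemma ultra_cvg01 (a : nat -> R) : (forall n, (0 <= a n <= 1)%R) ->
  exists2 l : R, (0 <= l <= 1)%R & a @ U --> l.
Proof.
move=> a01; have Ua01 : (a @ U) [set` `[0%R, 1%R]].
  by apply: (@filterE _ U) => n /=; rewrite in_itv/=; exact: a01.
have [l [l01 al]] := @segment_compact R 0 1 (a @ U) _ Ua01.
exists l; first by rewrite /= in_itv/= in l01.
move=> N Nl; have [//|aNC] := in_ultra_setVsetC (a @^-1` N) UU.
by have [x []] := al (~` N) N aNC Nl.
Qed.

Lemma fine_probability01 (P : probability (borelType X) R)
  (A : set (borelType X)) : measurable A -> (0 <= fine (P A) <= 1)%R.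
Proof.
move=> mA; rewrite fine_ge0//= -lee_fin fineK ?fin_num_measure//.
exact: probability_le1.
Qed.

(* [ultra_mass] is only finitely additive: the limit probability is the one
   induced by its restriction to compact sets. *)
Definition ultra_mass (A : set X) : R := lim (fine (eta_ n A) @[n --> U]).

Lemma ultra_mass_cvg (A : set (borelType X)) : measurable A ->
  fine (eta_ n A) @[n --> U] --> ultra_mass A.
Proof.
move=> mA; have [l _ al] := ultra_cvg01 (fun n => fine_probability01 (eta_ n) mA).
by rewrite /ultra_mass (cvg_lim _ al).
Qed.

Lemma open_borel (G : set X) : open G -> measurable (G : set (borelType X)).
Proof. exact: sub_sigma_algebra. Qed.

Lemma closed_borel (F : set X) : closed F -> measurable (F : set (borelType X)).
Proof.
by move=> cF; rewrite -(setCK F); apply: measurableC; apply: open_borel; exact: closed_openC.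
Qed.

Lemma compact_borel (H : set X) : compact H -> measurable (H : set (borelType X)).
Proof. by move=> /(compact_closed hX); exact: closed_borel. Qed.

(** Portmanteau statements for the limit. In the last one the open set varies with [n]: a compact
    subset of [O] of limiting mass above [c] lies in [O_ n] for [U]-almost all [n], by near-covering
    compactness. *)
Lemma ultralimit_probability : exists P : probability (borelType X) R,
  [/\ P C = 1,
   forall F (c : R), closed F -> P F < c%:E -> U [set n | eta_ n F < c%:E] &
   forall (O : set X) (O_ : nat -> set X) (c : R), open O ->
     (forall n, measurable (O_ n : set (borelType X))) ->
     (forall x, O x -> \forall y \near x & n \near U, O_ n y) ->
     c%:E < P O -> U [set n | c%:E < eta_ n (O_ n)] ].
Proof.
have PU : ProperFilter U by exact: ultra_proper.
have FU : Filter U by exact: filter_filter.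
have le1 (A : set X) : compact A -> (ultra_mass A <= 1)%R.
  move=> /compact_borel mA.
  apply: cvgr_to_le (ultra_mass_cvg mA) _; apply: filterE => n.
  by have /andP[] := fine_probability01 (eta_ n) mA.
have disj (A B : set X) : compact A -> compact B -> A `&` B = set0 ->
    ultra_mass (A `|` B) = (ultra_mass A + ultra_mass B)%R.
  move=> /compact_borel mA /compact_borel mB AB.
  apply: (cvg_unique (@Rhausdorff R) (ultra_mass_cvg (measurableU _ _ mA mB))).
  have -> : (fun n => fine (eta_ n (A `|` B))) =
            (fun n => fine (eta_ n A) + fine (eta_ n B))%R.
    by apply/funext => n; rewrite measureU// fineD// fin_num_measure.
  by apply: cvgD; exact: ultra_mass_cvg.
have sub (A B : set X) : compact A -> compact B ->
    (ultra_mass (A `|` B) <= ultra_mass A + ultra_mass B)%R.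
  move=> /compact_borel mA /compact_borel mB.
  apply: ler_cvg_to (ultra_mass_cvg (measurableU _ _ mA mB))
    (cvgD (ultra_mass_cvg mA) (ultra_mass_cvg mB)) _.
  apply: filterE => n; rewrite -lee_fin EFinD !fineK ?fin_num_measure//.
    exact: measureU2.
  exact: measurableU.
have mC := compact_borel cC.
have mass_C : ultra_mass C = 1%R.
  apply: (cvg_unique (@Rhausdorff R) (ultra_mass_cvg mC)).
  have -> : (fun n => fine (eta_ n C)) = cst 1%R.
    by apply/funext => n; rewrite eta_C.
  exact: cvg_cst.
have [P PE] := content_probability hX rX le1 disj sub cC mass_C.
have closedP F (c : R) : closed F -> P F < c%:E ->
    U [set n | eta_ n F < c%:E].
  move=> cF PFc; have mF := closed_borel cF.
  have cFC : compact (F `&` C).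
    apply: (subclosed_compact _ cC (@subIsetr _ _ _)).
    by apply: closedI => //; exact: (compact_closed hX cC).
  have etaFC n : eta_ n F = eta_ n (F `&` C).
    have C0 : eta_ n (~` C) = 0 by rewrite probability_setC// eta_C subee.
    rewrite -[in LHS](setUIDK F C) measureU//; last 3 first.
    - exact: measurableI.
    - exact: measurableD.
    - by rewrite setDE setIACA setICr setI0.
    rewrite [X in _ + X](_ : _ = 0) ?adde0//.
    apply/eqP; rewrite eq_le measure_ge0 andbT -C0.
    apply: le_measure; rewrite ?inE; last by move=> x [].
      exact: measurableD.
    exact: measurableC.
  have mFC := compact_borel cFC.
  suff : (ultra_mass (F `&` C) < c)%R.
    move=> /(cvgr_lt _ (ultra_mass_cvg mFC)); apply: filterS => n.
    by rewrite /= etaFC -lte_fin fineK ?fin_num_measure.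
  (* [P F] is 1 minus a supremum over compact sets [H] disjoint from [F]; each such [H] is disjoint
     from the compact set [F] inside [C], so the two limiting masses add up to at most 1. *)
  rewrite -lte_fin; apply: le_lt_trans PFc.
  have -> : P F = 1 - P (~` F).
    by have := probability_setC P (measurableC mF); rewrite setCK.
  rewrite leeBrDr ?fin_num_measure//; last exact: measurableC.
  rewrite -leeBrDl// PE; last exact: closed_openC.
  apply: ge_ereal_sup => _ [H [cH HF] <-].
  rewrite -EFinB lee_fin lerBrDl -disj//.
    by apply: le1; exact: compactU.
  by rewrite -subset0 => x [[Fx _] /HF].
exists P; split => //.
- apply/eqP; rewrite eq_le probability_le1//= leNgt; apply/negP => PC.
  have [n] := filter_ex (closedP C 1%R (compact_closed hX cC) PC).
  by rewrite /= eta_C ltxx.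
- move=> O O_ c oO mO OO_; rewrite PE// => /ereal_sup_gt[_ [H [cH HO] <-]] cmH.
  have mH := compact_borel cH.
  rewrite lte_fin in cmH.
  have near1 : U [set n | (c < fine (eta_ n H))%R] :=
    @cvgr_gt _ _ U FU _ _ (ultra_mass_cvg mH) _ cmH.
  have near2 : U [set n | H `<=` O_ n] :=
    (compact_near_coveringP H).1 cH _ U (fun n x => O_ n x) FU
    (fun x Hx => OO_ x (HO x Hx)).
  apply: (@filterS2 nat U FU [set n | (c < fine (eta_ n H))%R]
    [set n | H `<=` O_ n] _ _ near1 near2) => n /= mn HOn.
  apply: (@lt_le_trans _ _ (eta_ n H)).
    by rewrite -(fineK (fin_num_measure (eta_ n) _ mH)) lte_fin.
  by apply: le_measure; rewrite ?inE//; exact: mO.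
Qed.

End ultralimit.

Lemma measurable_gt_sets d (T : measurableType d) (R : realType)
  (f : T -> \bar R) :
  (forall c : R, measurable [set x | (c%:E < f x)%E]) -> measurable_fun setT f.
Proof.
move=> mf; apply: (measurability _ (ErealGenOInfty.measurableE R)) => //.
move=> _ [_ [a ->]] <-; rewrite setTI.
rewrite (_ : _ @^-1` _ = [set x | (a%:E < f x)%E]); first exact: mf.
by apply/seteqP; split => x /=; rewrite in_itv/= andbT.
Qed.

(** * Layer-cake sums and Fatou's lemma along the ultrafilter *)

Section layer_sums.
Context {R : realType}.
Variables (e : R) (e0 : 0 < e).
Local Open Scope ereal_scope.

(** Discretized layer cake: [e] times the number of multiples [e, ..., K e] strictly below [t]. It
    approximates [t] from below within [e] as long as [t <= K e], and reduces integrals to masses of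
    superlevel sets. *)
Definition layer_sum (K : nat) (t : \bar R) : \bar R :=
  \sum_(i < K) (if (i.+1%:R * e)%:E < t then e%:E else 0).

Lemma layer_sum_ge0 K t : 0 <= layer_sum K t.
Proof. by apply: sume_ge0 => i _; case: ifP => // _; rewrite lee_fin ltW. Qed.

Lemma layer_sum_max K t : (K%:R * e)%:E < t -> layer_sum K t = (K%:R * e)%:E.
Proof.
move=> Kt; rewrite /layer_sum (eq_bigr (fun=> e%:E)).
  by rewrite sumEFin sumr_const card_ord mulr_natl.
move=> i _; rewrite ifT//; apply: le_lt_trans Kt.
by rewrite lee_fin ler_pM2r// ler_nat.
Qed.

Lemma layer_sum_le K t : 0 <= t -> layer_sum K t <= t.
Proof.
elim: K => [|K IH] t0; first by rewrite /layer_sum big_ord0.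
have [Kt|Kt] := ltP (K.+1%:R * e)%:E t; first by rewrite layer_sum_max// ltW.
by rewrite /layer_sum big_ord_recr/= ltNge Kt adde0 IH.
Qed.

Lemma layer_sum_ge K t : 0 <= t -> t <= (K%:R * e)%:E -> t <= layer_sum K t + e%:E.
Proof.
elim: K => [|K IH] t0.
  rewrite mul0r => /(conj t0)/andP/le_anti <-.
  by rewrite adde_ge0 ?layer_sum_ge0// lee_fin ltW.
move=> tK; have [Kt|tK'] := ltP (K%:R * e)%:E t; last first.
  by rewrite /layer_sum big_ord_recr/= ltNge tK adde0 IH.
rewrite /layer_sum big_ord_recr/= -/(layer_sum K t) layer_sum_max//.
rewrite ltNge tK adde0 -EFinD; apply: le_trans tK _.
by rewrite lee_fin -natr1 mulrDl mul1r.
Qed.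

Lemma layer_series_ge t : 0 <= t ->
  t <= \sum_(i <oo) (if (i.+1%:R * e)%:E < t then e%:E else 0) + e%:E.
Proof.
move=> t0.
have layer_le K : layer_sum K t <=
    \sum_(i <oo) (if (i.+1%:R * e)%:E < t then e%:E else 0).
  rewrite /layer_sum -(big_mkord xpredT (fun i => if (i.+1%:R * e)%:E < t then e%:E else 0)).
  by apply: nneseries_lim_ge => i _ _; case: ifP => // _; rewrite lee_fin ltW.
case: t t0 layer_le => [t| |//] t0 layer_le.
  have [K tK] : exists K : nat, (t <= K%:R * e)%R.
    exists (Num.bound (t / e)); rewrite -ler_pdivrMr//.
    by apply/ltW/archi_boundP; rewrite divr_ge0// ltW.
  apply: le_trans (layer_sum_ge t0 _) _; first by rewrite lee_fin; exact: tK.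
  by rewrite leeD2r.
rewrite [X in X + _](_ : _ = +oo)//; apply/eqyP => A A0.
have [K AK] : exists K : nat, (A <= K%:R * e)%R.
  exists (Num.bound (A / e)); rewrite -ler_pdivrMr//.
  by apply/ltW/archi_boundP; rewrite divr_ge0// ltW.
apply: le_trans (layer_le K); rewrite layer_sum_max ?ltry//.
Qed.

End layer_sums.

Section layer_integral.
Context d (T : measurableType d) (R : realType) (P : probability T R).
Variables (G : T -> \bar R) (e : R) (e0 : 0 < e).
Hypothesis G0 : forall x, (0 <= G x)%E.
Hypothesis mG : forall c : R, measurable [set x | (c%:E < G x)%E].
Local Open Scope ereal_scope.

Let term (i : nat) (x : T) : \bar R :=
  if (i.+1%:R * e)%:E < G x then e%:E else 0.

Let termE i : term i =
  fun x => e%:E * (\1_[set x | ((i.+1%:R * e)%:E < G x)%E] x)%:E.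
Proof.
apply/funext => x; rewrite /term indicE; case: ifPn => Gx.
  by rewrite mem_set// mule1.
by rewrite memNset ?mule0//=; exact/negP.
Qed.

Let term_ge0 i x : 0 <= term i x.
Proof. by rewrite /term; case: ifP => // _; rewrite lee_fin ltW. Qed.

Let mterm i : measurable_fun setT (term i).
Proof.
rewrite termE; apply: emeasurable_funM; first exact: measurable_cst.
by apply/measurable_EFinP; exact: measurable_indic.
Qed.

Let integral_term i :
  \int[P]_x term i x = e%:E * P [set x | (i.+1%:R * e)%:E < G x].
Proof.
rewrite termE ge0_integralZl_EFin//; last exact: ltW.
- by rewrite integral_indic// setIT.
- by apply/measurable_EFinP; exact: measurable_indic.
Qed.

Lemma layer_integral_le K :
  \sum_(i < K) e%:E * P [set x | (i.+1%:R * e)%:E < G x] <= \int[P]_x G x.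
Proof.
rewrite (eq_bigr (fun i : 'I_K => \int[P]_x term i x)); last first.
  by move=> i _; rewrite integral_term.
rewrite -ge0_integral_sum//.
apply: ge0_le_integral_nonmeasurable => x _; first exact: sume_ge0.
exact: layer_sum_le.
Qed.

Lemma integral_le_layer :
  \int[P]_x G x <= \sum_(i <oo) e%:E * P [set x | (i.+1%:R * e)%:E < G x] + e%:E.
Proof.
rewrite (eq_eseriesr (g := fun i => \int[P]_x term i x)); last first.
  by move=> i _; rewrite integral_term.
rewrite -integral_nneseries//.
have -> : e%:E = \int[P]_x (cst e%:E x).
  by rewrite integral_cst // [X in _ * X](@probability_setT _ _ _ P) mule1.
rewrite -ge0_integralD//; last 3 first.
- by move=> x _; apply: nneseries_ge0.
- by apply: ge0_emeasurable_sum.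
- by move=> x _; rewrite lee_fin ltW.
apply: ge0_le_integral_nonmeasurable => x _ //.
exact: layer_series_ge.
Qed.

End layer_integral.

Section ultralimit_integral.
Context {R : realType} {X : ptopologicalType}.
Variables (U : set_system nat) (UU : UltraFilter U).
Variables (eta_ : nat -> probability (borelType X) R).
Variable P : probability (borelType X) R.
Local Open Scope ereal_scope.
Hypothesis liminf_open : forall (O : set X) (O_ : nat -> set X) (c : R), open O ->
     (forall n, measurable (O_ n : set (borelType X))) ->
     (forall x, O x -> \forall y \near x & n \near U, O_ n y) ->
     c%:E < P O -> U [set n | c%:E < eta_ n (O_ n)].

(** The joint condition on [G] and [G_] lets [liminf_open] compare each superlevel set of [G] with
    those of [G_ n]. Finitely many layers pass to the limit along [U]; then the number of layers
    tends to infinity and the mesh [e] to 0. *)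
Lemma ultralimit_integral_le (G : borelType X -> \bar R)
  (G_ : nat -> borelType X -> \bar R) (M : R) :
  (forall x, 0 <= G x) -> (forall n x, 0 <= G_ n x) ->
  (forall c : R, open ([set x | c%:E < G x] : set X)) ->
  (forall n (c : R), measurable [set x | c%:E < G_ n x]) ->
  (forall (x : X) (c : R), c%:E < G x ->
     \forall y \near x & n \near U, c%:E < G_ n y) ->
  U [set n | \int[eta_ n]_x G_ n x <= M%:E] ->
  \int[P]_x G x <= M%:E.
Proof.
have PU : ProperFilter U by exact: ultra_proper.
have FU : Filter U by exact: filter_filter.
move=> G0 G_0 oG mG_ jG leM.
have mG (c : R) : measurable ([set x | c%:E < G x] : set (borelType X)).
  exact: open_borel.
apply/lee_addgt0Pr => e e0.
apply: (le_trans (integral_le_layer P e0 G0 mG)).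
rewrite leeD2r//.
have term0 i : 0 <= e%:E * P [set x | (i.+1%:R * e)%:E < G x].
  by rewrite mule_ge0// lee_fin ltW.
apply: lime_le; first by apply: is_cvg_nneseries => i _ _; exact: term0.
apply: nearW => K /=; rewrite big_mkord.
pose On (i n : nat) : set (borelType X) := [set x | (i.+1%:R * e)%:E < G_ n x].
(* [q i] is the ultralimit of the masses of the [i]-th superlevel sets of [G_ n]; it dominates the
   mass that [P] gives to that of [G]. *)
have /choice[q qcvg] : forall i, exists q : R,
    fine (eta_ n (On i n)) @[n --> U] --> q.
  move=> i; have [q _ qcvg] := ultra_cvg01 UU
    (fun n => fine_probability01 (eta_ n) (mG_ n (i.+1%:R * e)%R)).
  by exists q.
have Pq (i : nat) : P [set x | (i.+1%:R * e)%:E < G x] <= (q i)%:E.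
  rewrite leNgt; apply/negP => qP.
  have [r qr rP] : exists2 r : R, (q i < r)%R & r%:E < P [set x | (i.+1%:R * e)%:E < G x].
    have := qP; rewrite -(fineK (fin_num_measure P _ (mG (i.+1%:R * e)%R))) lte_fin.
    move=> /midf_lt[lo hi]; eexists; [exact: lo|by rewrite lte_fin].
  have near1 := liminf_open (oG _) (fun n => mG_ n _) (fun x => jG x _) rP.
  have near2 : U [set n | fine (eta_ n (On i n)) < r]%R.
    exact: (@cvgr_lt _ _ U FU _ _ (qcvg i) _ qr).
  have [n [/= lo hi]] := filter_ex (@filterI nat U FU _ _ near1 near2).
  rewrite -lte_fin fineK ?fin_num_measure// in hi; last exact: mG_.
  by have := lt_trans lo hi; rewrite ltxx.
apply: (@le_trans _ _ (\sum_(i < K) e * q i)%:E).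
  rewrite -sumEFin; apply: lee_sum => i _; rewrite [(e * q i)%:E]EFinM.
  by apply: lee_wpmul2l; [rewrite lee_fin ltW|exact: Pq].
rewrite lee_fin.
have cvgs : (\sum_(i < K) e * fine (eta_ n (On i n)))%R @[n --> U] -->
    (\sum_(i < K) e * q i)%R.
  by apply: cvg_big => [|i _]; [exact: add_continuous|apply: cvgMl_tmp; exact: qcvg].
apply: (cvgr_to_le cvgs).
apply: filterS leM => n /= le; rewrite -lee_fin -sumEFin; apply: le_trans le.
apply: le_trans (layer_integral_le (eta_ n) e0 (G_0 n) (mG_ n) K).
by apply: lee_sum => i _; rewrite EFinM fineK// fin_num_measure//; exact: mG_.
Qed.

End ultralimit_integral.

(** * The space of 1-Lipschitz curves *)

Section euclidean_norm.
Context {R : realType} {d : nat}.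
Implicit Types u v w : 'rV[R]_d.

Definition edot u v : R := \sum_(i < d) u ord0 i * v ord0 i.

Lemma enorm_ge0 u : 0 <= enorm u. Proof. exact: sqrtr_ge0. Qed.

Lemma enorm_sqr u : enorm u ^+ 2 = \sum_(i < d) u ord0 i ^+ 2.
Proof. by rewrite sqr_sqrtr// sumr_ge0// => i _; rewrite sqr_ge0. Qed.

Lemma enorm_coord u i : `|u ord0 i| <= enorm u.
Proof.
rewrite -ler_sqr ?nnegrE ?enorm_ge0// enorm_sqr real_normK ?num_real//.
by rewrite (bigD1 i)//= lerDl sumr_ge0// => j _; rewrite sqr_ge0.
Qed.

Lemma enorm_eq0 u : enorm u = 0 -> u = 0.
Proof.
move=> u0; apply/rowP => i; rewrite mxE; apply/normr0_eq0/le_anti.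
by rewrite normr_ge0 andbT -u0 enorm_coord.
Qed.

Lemma enorm0 : enorm (0 : 'rV[R]_d) = 0.
Proof. by rewrite /enorm big1 ?sqrtr0// => i _; rewrite mxE expr0n. Qed.

Lemma edot_le u v : edot u v <= enorm u * enorm v.
Proof.
have [v0|v0] := eqVneq (enorm v) 0.
  rewrite (enorm_eq0 v0) /edot big1 ?enorm0 ?mulr0// => i _.
  by rewrite mxE mulr0.
have [u0|u0] := eqVneq (enorm u) 0.
  rewrite (enorm_eq0 u0) /edot big1 ?enorm0 ?mul0r// => i _.
  by rewrite mxE mul0r.
have a0 : 0 < enorm u by rewrite lt_neqAle eq_sym u0 enorm_ge0.
have b0 : 0 < enorm v by rewrite lt_neqAle eq_sym v0 enorm_ge0.
(* Cauchy-Schwarz: this sum expands to [2 |u| |v| (|u| |v| - u . v)]. *)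
have : 0 <= \sum_(i < d) (enorm v * u ord0 i - enorm u * v ord0 i) ^+ 2.
  by apply: sumr_ge0 => i _; rewrite sqr_ge0.
have -> : \sum_(i < d) (enorm v * u ord0 i - enorm u * v ord0 i) ^+ 2 =
    enorm v ^+ 2 * (\sum_(i < d) u ord0 i ^+ 2)
    + enorm u ^+ 2 * (\sum_(i < d) v ord0 i ^+ 2)
    - 2 * (enorm u * enorm v) * edot u v.
  rewrite /edot !mulr_sumr -sumrN -!big_split/=; apply: eq_bigr => i _; ring.
rewrite -!enorm_sqr => H.
have ab0 : 0 < enorm u * enorm v by rewrite mulr_gt0.
rewrite -(ler_pM2l ab0); lra.
Qed.

Lemma enormD u v : enorm (u + v) <= enorm u + enorm v.
Proof.
rewrite -ler_sqr ?nnegrE ?addr_ge0 ?enorm_ge0//.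
have -> : enorm (u + v) ^+ 2 = enorm u ^+ 2 + enorm v ^+ 2 + 2 * edot u v.
  rewrite !enorm_sqr /edot mulr_sumr -!big_split/=; apply: eq_bigr => i _.
  by rewrite !mxE; ring.
have := edot_le u v; rewrite sqrrD; lra.
Qed.

Lemma enormN u : enorm (- u) = enorm u.
Proof. by congr Num.sqrt; apply: eq_bigr => i _; rewrite mxE sqrrN. Qed.

Lemma enormB u v : enorm (u - v) = enorm (v - u).
Proof. by rewrite -opprB enormN. Qed.

Lemma enorm_triangle w u v : enorm (u - v) <= enorm (u - w) + enorm (w - v).
Proof. by have := enormD (u - w) (w - v); rewrite addrA subrK. Qed.

Lemma enormZ (a : R) u : enorm (a *: u) = `|a| * enorm u.
Proof.
rewrite /enorm -sqrtr_sqr -sqrtrM ?sqr_ge0// mulr_sumr; congr Num.sqrt.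
by apply: eq_bigr => i _; rewrite mxE exprMn.
Qed.

Lemma edot_self u : edot u u = enorm u ^+ 2.
Proof. by rewrite enorm_sqr. Qed.

Lemma norm_le_enorm u : `|u| <= enorm u.
Proof.
rewrite /Num.norm/= mx_normrE; apply: bigmax_le; first exact: enorm_ge0.
by move=> [i j] _ /=; rewrite ord1 enorm_coord.
Qed.

Lemma enorm_le_norm u : enorm u <= d%:R * `|u|.
Proof.
rewrite -ler_sqr ?nnegrE ?enorm_ge0 ?mulr_ge0// enorm_sqr.
apply: (@le_trans _ _ (\sum_(i < d) `|u| ^+ 2)).
  apply: ler_sum => i _; rewrite -[leLHS]real_normK ?num_real//.
  rewrite ler_sqr ?nnegrE// /Num.norm/= mx_normrE.
  exact: (@le_bigmax _ _ _ 0 (fun p => `|u p.1 p.2|) (ord0, i)).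
rewrite sumr_const card_ord -[X in X <= _]mulr_natl exprMn.
rewrite ler_wpM2r ?sqr_ge0// -natrX ler_nat.
by case: d => // n; rewrite -[leqLHS]expn1 leq_pexp2l.
Qed.

Lemma enorm_dist u v : `|enorm u - enorm v| <= enorm (u - v).
Proof.
rewrite ler_norml; apply/andP; split.
  by have := enormD (v - u) u; rewrite subrK enormB; lra.
by have := enormD (u - v) v; rewrite subrK; lra.
Qed.

Lemma nbhs_enormP (u : 'rV[R]_d) (A : set 'rV[R]_d) :
  nbhs u A <-> exists2 e : R, 0 < e & forall v, enorm (u - v) < e -> A v.
Proof.
split.
  move=> /nbhs_ballP[e e0 eA]; exists e => // v uv; apply: eA.
  rewrite -ball_normE; exact: le_lt_trans (norm_le_enorm _) uv.
(* Dividing by [d.+1] instead of [d] keeps the radius positive in dimension 0. *)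
move=> [e e0 eA]; apply/nbhs_ballP; exists (e / d.+1%:R) => /=.
  by rewrite divr_gt0// ltr0n.
move=> v; rewrite -ball_normE /= => uv; apply: eA.
apply: le_lt_trans (enorm_le_norm _) _.
apply: (@le_lt_trans _ _ (d.+1%:R * `|u - v|)).
  by rewrite ler_wpM2r// ler_nat.
by rewrite mulrC -ltr_pdivlMr ?ltr0n.
Qed.

Lemma enorm_continuous : continuous (@enorm R d).
Proof.
move=> u A /nbhs_ballP[e e0 eA]; apply/nbhs_enormP; exists e => // v uv.
by apply: eA; exact: le_lt_trans (enorm_dist u v) uv.
Qed.

End euclidean_norm.

Section curve_topology.
Context {R : realType} {d : nat}.
Local Notation E := 'rV[R]_d.
Implicit Types (g : curve R d) (s t : R).

Lemma curve_lip1 g s t : enorm (g s - g t) <= `|s - t|.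
Proof.
have [gl gc] := set_valP g.
have gmax r : g r = g (Num.max r 0).
  by have [r0|] := leP r 0; [exact: gc|].
rewrite gmax [in X in _ - X]gmax; apply: le_trans (gl _ _ _ _) _.
- by rewrite le_max lexx orbT.
- by rewrite le_max lexx orbT.
- have h1 := ler_norm (s - t); have := ler_norm (t - s); rewrite distrC => h2.
  by case: (leP s 0) => ?; case: (leP t 0) => ?; rewrite ler_norml; lra.
Qed.

Lemma curve_neg g t : t <= 0 -> g t = g 0.
Proof. by have [_ +] := set_valP g; exact. Qed.

Lemma curve_continuous g : continuous (g : R -> E).
Proof.
move=> t A /nbhs_enormP[e e0 eA]; apply/nbhs_ballP; exists e => // s ts.
by apply: eA; exact: le_lt_trans (curve_lip1 g t s) ts.
Qed.

Lemma curve_eqP g1 g2 : (forall t, 0 <= t -> g1 t = g2 t) -> g1 = g2.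
Proof.
move=> H; apply: val_inj; apply/funext => t.
change (g1 t = g2 t); have [t0|/ltW t0] := leP 0 t; first exact: H.
by rewrite !(curve_neg _ t0) H.
Qed.

Definition mk_curve_fun (f : R -> E) : R -> E := fun t => f (Num.max t 0).

Lemma mk_curve_subproof (f : R -> E) :
  (forall s t, 0 <= s -> 0 <= t -> enorm (f s - f t) <= `|s - t|) ->
  lip1_curve (mk_curve_fun f : {family compact, R -> E}).
Proof.
move=> fl; split=> [s t s0 t0|t t0]; first by rewrite /mk_curve_fun !max_l ?fl.
by rewrite /mk_curve_fun !max_r.
Qed.

Lemma curve_of_lip (f : R -> E) :
  (forall s t, 0 <= s -> 0 <= t -> enorm (f s - f t) <= `|s - t|) ->
  exists g : curve R d, forall t, 0 <= t -> g t = f t.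
Proof.
move=> /mk_curve_subproof fl.
exists (SigSub (mem_set fl) : set_type _) => t t0.
by change (mk_curve_fun f t = f t); rewrite /mk_curve_fun max_l.
Qed.

Lemma set_val_curve_continuous :
  continuous (set_val : curve R d -> {family compact, R -> E}).
Proof. exact: initial_continuous. Qed.

Lemma family_eval_continuous t :
  continuous (fun f : {family compact, R -> E} => f t).
Proof.
move=> f A nA; have := @proj_continuous _ _ t f A nA.
exact: (@pointwise_cvg_compact_family _ _ (nbhs f)).
Qed.

Lemma curve_eval_continuous t : continuous (fun g : curve R d => g t).
Proof.
move=> g; apply: (@continuous_comp _ _ _ (set_val : curve R d -> {family compact, R -> E}) (fun f => f t)).
  exact: set_val_curve_continuous.
exact: family_eval_continuous.
Qed.

(** The common Lipschitz constant makes closeness at the single time [t0] control the curves at all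
    nearby times. *)
Lemma near_eval (g0 : curve R d) (t0 : R) (A : set E) : nbhs (g0 t0) A ->
  \forall t \near t0 & g \near (g0 : curve R d), A ((g : curve R d) t).
Proof.
move=> /nbhs_enormP[e e0 eA].
have e20 : 0 < e / 2 by rewrite divr_gt0.
exists (ball t0 (e / 2), [set g : curve R d | enorm (g0 t0 - g t0) < e / 2]).
  split; first exact: nbhsx_ballx.
  apply: (@curve_eval_continuous t0 g0 [set v | enorm (g0 t0 - v) < e / 2]).
  by apply/nbhs_enormP; exists (e / 2).
move=> [t g] [/= tt0 gg0]; apply: eA.
apply: le_lt_trans (enorm_triangle (g t0) _ _) _.
have := le_lt_trans (curve_lip1 g t0 t) tt0; lra.
Qed.

End curve_topology.

Section Gamma_topology.
Context {R : realType} {d : nat}.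
Local Notation E := 'rV[R]_d.

Lemma rV_hausdorff : hausdorff_space E.
Proof. exact: norm_hausdorff. Qed.

Lemma curve_hausdorff : hausdorff_space (curve R d).
Proof.
move=> g1 g2 g12; apply: curve_eqP => t _.
apply: rV_hausdorff => A B nA nB.
have nA' := curve_eval_continuous nA.
have nB' := curve_eval_continuous nB.
by have [g [gA gB]] := g12 _ _ nA' nB'; exists (curve_fun g t).
Qed.

Lemma curve_regular : regular_space (curve R d).
Proof. exact: (@uniform_regular (set_type (@lip1_curve R d))). Qed.

Lemma curve_eval_closed (t : R) (F : set E) : closed F ->
  closed [set g : curve R d | F (curve_fun g t)].
Proof.
exact: ((continuous_closedP _).1 (@curve_eval_continuous R d t)).
Qed.

Lemma curve_eval_open (t : R) (O : set E) : open O ->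
  open [set g : curve R d | O (curve_fun g t)].
Proof. exact: ((continuousP _).1 (@curve_eval_continuous R d t)). Qed.

Lemma Gamma_closed (K : set E) : closed K -> closed (Gamma K : set (curve R d)).
Proof.
move=> cK; rewrite (_ : Gamma K = \bigcap_(t in [set t : R | 0 <= t])
    [set g : curve R d | K (curve_fun g t)]).
  by apply: closed_bigI => t _; exact: curve_eval_closed.
by apply/seteqP; split => g /=; move=> Kg t; apply: Kg.
Qed.

Lemma lip1_curve_closed : closed (@lip1_curve R d).
Proof.
have ev := @family_eval_continuous R d.
pose dist (s t : R) (f : {family compact, R -> E}) : R := enorm (f s - f t).
have cdist s t : continuous (dist s t).
  move=> f; apply: (@cvg_comp _ _ _ (fun f : {family compact, R -> E} => f s - f t)
      (@enorm R d) _ (nbhs (f s - f t))); last exact: enorm_continuous.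
  exact: (cvgB (ev s f) (ev t f)).
rewrite (_ : @lip1_curve R d =
   (\bigcap_(st in [set st : R * R | 0 <= st.1 /\ 0 <= st.2])
     (dist st.1 st.2 @^-1` [set x | x <= `|st.1 - st.2|])) `&`
   (\bigcap_(t in [set t : R | t <= 0]) (dist t 0 @^-1` [set x | x <= 0]))).
  apply: closedI; apply: closed_bigI => t _.
    by apply: ((continuous_closedP _).1 (cdist t.1 t.2)); exact: closed_le.
  by apply: ((continuous_closedP _).1 (cdist t 0)); exact: closed_le.
apply/seteqP; split => f [fl f0]; split.
- by move=> [s t] [/= s0 t0]; exact: fl.
- by move=> t /= t0; rewrite /dist f0// subrr enorm0.
- by move=> s t s0 t0; exact: (fl (s, t)).
- move=> t t0; apply/eqP; rewrite -subr_eq0; apply/eqP/enorm_eq0/le_anti.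
  by rewrite enorm_ge0 andbT; exact: (f0 t).
Qed.

(** Arzela-Ascoli in the ambient function space, where the curves with values in [K] are closed,
    equicontinuous and pointwise in a compact set. *)
Lemma Gamma_compact (K : set E) : compact K -> compact (Gamma K : set (curve R d)).
Proof.
move=> cK; have clK := compact_closed rV_hausdorff cK.
pose W : set {family compact, R -> E} :=
  @lip1_curve R d `&` [set f | forall t, 0 <= t -> K (f t)].
have clW : closed W.
  apply: closedI; first exact: lip1_curve_closed.
  rewrite (_ : mkset _ = \bigcap_(t in [set t : R | 0 <= t])
      ((fun f : {family compact, R -> E} => f t) @^-1` K)).
    apply: closed_bigI => t _; exact: ((continuous_closedP _).1
      (@family_eval_continuous R d t) K clK).
  by apply/seteqP; split => f /=; move=> Kf t; apply: Kf.
have WK f t : W f -> K (f t).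
  move=> [[_ f0] Kf]; have [t0|/ltW t0] := leP 0 t; first exact: Kf.
  by rewrite f0//; exact: Kf.
have preW : precompact W.
  apply: (@pointwise_precompact_equicontinuous _ _ rV_hausdorff W).
    move=> t; apply: (@precompact_subset _ _ K).
      by move=> _ [f Wf <-]; exact: WK.
    by rewrite precompactE -(closure_id K).1.
  move=> t A; rewrite -entourage_ballE => -[e /= e0 eA].
  exists e => // s ts f Wf; apply: eA.
  have [g gf] : exists g : curve R d, set_val g = f.
    by exists (SigSub (mem_set (proj1 Wf)) : set_type _).
  rewrite -gf /= -ball_normE /=.
  apply: le_lt_trans (norm_le_enorm _) _.
  exact: le_lt_trans (curve_lip1 g t s) ts.
have cW : compact W by move: preW; rewrite precompactE -(closure_id W).1.
(* Back to the subtype: a cluster point of the image filter lies in [W], hence is a curve, and open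
   sets of curves are preimages of open sets of functions. *)
move=> F FF FG.
have [f [Wf clf]] := cW ((set_val : curve R d -> {family compact, R -> E}) @ F)
  _ (filterS (fun g Gg => conj (set_valP g) Gg) FG).
exists (SigSub (mem_set (proj1 Wf)) : set_type _); split; first exact: (proj2 Wf).
move=> A B FA [_ [[C oC <-] Cf CB]].
have FA' : (set_val @ F) (set_val @` A).
  by apply: (@filterS _ F _ A _ _ FA) => g Ag; exists g.
have [_ [[g Ag <-] Cg]] := clf _ _ FA' (open_nbhs_nbhs (conj oC Cf)).
by exists g; split => //; exact: CB.
Qed.

End Gamma_topology.

(** * Weighted length *)

Section liminf_ge.
Context {R : realType} {T : Type} (F : set_system T) {FF : Filter F}.
Local Open Scope ereal_scope.

(** The inequality [liminf f >= v] by real thresholds, for an arbitrary filter: below, products of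
    neighbourhoods of a point or a curve with a filter on indices. *)
Definition liminf_ge (f : T -> \bar R) (v : \bar R) :=
  forall c : R, c%:E < v -> F [set p | c%:E < f p].

Lemma lte_addP (v1 v2 : \bar R) (c : R) : 0 <= v1 -> 0 <= v2 -> c%:E < v1 + v2 ->
  exists c1 c2 : R, [/\ c1%:E < v1, c2%:E < v2 & (c <= c1 + c2)%R].
Proof.
case: v1 => [v1| |//] _; case: v2 => [v2| |//] _; rewrite -?EFinD ?lte_fin => cv.
- exists (v1 - (v1 + v2 - c) / 2)%R, (v2 - (v1 + v2 - c) / 2)%R.
  by rewrite !lte_fin; split; lra.
- by clear cv; exists (v1 - 1)%R, (c - v1 + 1)%R; rewrite !lte_fin ltry; split => //; lra.
- by clear cv; exists (c - v2 + 1)%R, (v2 - 1)%R; rewrite !lte_fin ltry; split => //; lra.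
- by clear cv; exists c, 0%R; rewrite !ltry; split => //; lra.
Qed.

Lemma liminf_geD (f1 f2 : T -> \bar R) (v1 v2 : \bar R) : 0 <= v1 -> 0 <= v2 ->
  liminf_ge f1 v1 -> liminf_ge f2 v2 -> liminf_ge (fun p => f1 p + f2 p) (v1 + v2).
Proof.
move=> v10 v20 h1 h2 c /(lte_addP v10 v20)[c1 [c2 [/h1 F1 /h2 F2 cc]]].
apply: filterS (filterI F1 F2) => p [/= c1f c2f].
apply: (@le_lt_trans _ _ (c1%:E + c2%:E)); first by rewrite -EFinD lee_fin.
exact: lteD.
Qed.

Lemma lte_mulP (v : \bar R) (r c : R) : 0 <= v -> (0 <= r)%R -> (0 <= c)%R ->
  c%:E < v * r%:E ->
  exists p q : R, [/\ (0 < p)%R, (0 < q)%R, p%:E < v, (q < r)%R & (c <= p * q)%R].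
Proof.
move=> v0 r0 c0 cvr.
have rp : (0 < r)%R.
  rewrite lt_neqAle r0 andbT; apply: contraTneq cvr => <-.
  by rewrite mule0 lte_fin -leNgt.
have vp : 0 < v.
  rewrite lt_neqAle v0 andbT; apply: contraTneq cvr => <-.
  by rewrite mul0e lte_fin -leNgt.
have [p [p0 pv cpr]] : exists p : R, [/\ (0 < p)%R, p%:E < v & (c < p * r)%R].
  case: v v0 cvr vp => [v| |//] _; rewrite ?lte_fin => cvr vp.
    have [lo hi] := midf_lt cvr.
    exists ((c + v * r) / 2 / r)%R; split.
    - by rewrite divr_gt0// (le_lt_trans c0).
    - by rewrite lte_fin ltr_pdivrMr.
    - by rewrite divfK// gt_eqF.
  exists (c / r + 1)%R; split; rewrite ?ltry//.
  - by rewrite ltr_wpDl// divr_ge0.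
  - by rewrite mulrDl divfK ?gt_eqF// mul1r ltrDl.
exists p, ((c / p + r) / 2)%R; have cpr' : (c / p < r)%R.
  by rewrite ltr_pdivrMr// mulrC.
have [lo hi] := midf_lt cpr'.
split => //.
  by apply: le_lt_trans lo; rewrite divr_ge0// ltW.
by rewrite -ler_pdivrMl// mulrC ltW.
Qed.

Lemma liminf_geM (f : T -> \bar R) (v : \bar R) (r : T -> R) (r0 : R) :
  0 <= v -> (forall p, 0 <= f p) -> (forall p, 0 <= r p)%R -> (0 <= r0)%R ->
  liminf_ge f v -> (forall q, (q < r0)%R -> F [set p | (q < r p)%R]) ->
  liminf_ge (fun p => f p * (r p)%:E) (v * r0%:E).
Proof.
move=> v0 f0 r_0 r00 h hr c cv; have [c0|c0] := ltP c 0%R.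
  apply: filterE => p /=; apply: (@lt_le_trans _ _ 0); first by rewrite lte_fin.
  by rewrite mule_ge0// lee_fin.
have [p [q [p0 q0 /h Fp /hr Fq cpq]]] := lte_mulP v0 r00 c0 cv.
apply: filterS (filterI Fp Fq) => x [/= pf qr].
apply: (@le_lt_trans _ _ (p%:E * q%:E)); first by rewrite -EFinM lee_fin.
by apply: lte_pmul => //; rewrite lee_fin ltW.
Qed.

End liminf_ge.

Section weighted_length.
Context {R : realType} {d : nat}.
Local Notation E := 'rV[R]_d.
Local Open Scope ereal_scope.
Implicit Types (w : E -> \bar R) (g : R -> E).

(* Unlike the integral of [w (g t) * |g' t|], with which it agrees when [w] is
   lower semicontinuous (see [wlenE]), [wlen w g] is a supremum of expressions
   which are visibly lower semicontinuous in [w] and [g] jointly. *)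
Definition inf_along w g (a b : R) : \bar R :=
  ereal_inf [set w (g t) | t in `[a, b]].

Fixpoint wsum w g (a : R) (s : seq R) : \bar R :=
  if s is b :: s' then
    inf_along w g a b * (enorm (g b - g a))%:E + wsum w g b s'
  else 0.

Definition wlen w g : \bar R :=
  ereal_sup [set wsum w g p.1 p.2 |
    p in [set p : R * seq R | (0 <= p.1)%R /\ path <=%R p.1 p.2]].

Lemma inf_along_ge0 w g a b : (forall x, 0 <= w x) -> 0 <= inf_along w g a b.
Proof. by move=> w0; apply: le_ereal_inf_tmp => _ [t _ <-]. Qed.

Lemma wsum_ge0 w g a s : (forall x, 0 <= w x) -> 0 <= wsum w g a s.
Proof.
move=> w0; elim: s a => //= b s IH a.
by rewrite adde_ge0// mule_ge0// ?lee_fin ?enorm_ge0 ?inf_along_ge0.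
Qed.

Lemma wsum_le_wlen w g a s : (0 <= a)%R -> path <=%R a s ->
  wsum w g a s <= wlen w g.
Proof. by move=> a0 ps; apply: ereal_sup_ubound; exists (a, s). Qed.

Lemma wlen_ge0 w g : 0 <= wlen w g.
Proof. by apply: le_trans (@wsum_le_wlen w g 0%R [::] _ _). Qed.

Section lsc.
Variables (F : set_system nat) (FF : Filter F).
Variables (w0 : E -> \bar R) (w_ : nat -> E -> \bar R).
Hypotheses (w0_ge0 : forall x, 0 <= w0 x) (w_ge0 : forall n x, 0 <= w_ n x).
Hypothesis w_lsc : forall x : E,
  liminf_ge (filter_prod (nbhs x) F) (fun p => w_ p.2 p.1) (w0 x).

Let Fg (g : curve R d) := filter_prod (nbhs g) F.

Let FgF (g : curve R d) : Filter (Fg g). Proof. exact: filter_prod_filter. Qed.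

(** Near each time of [[a, b]] the joint semicontinuity of the weights bounds them from below;
    compactness of the segment makes the bound uniform. *)
Lemma inf_along_lsc (g : curve R d) (a b : R) :
  liminf_ge (Fg g) (fun p => inf_along (w_ p.2) (p.1 : curve R d) a b)
    (inf_along w0 g a b).
Proof.
move=> c cinf.
(* An infimum of values above [c'] is only known to be at least [c'], hence the room between [c] and
   [c']. *)
have [c' cc' c'inf] : exists2 c' : R, (c < c')%R & c'%:E < inf_along w0 g a b.
  move: cinf; case: (inf_along w0 g a b) => [r| |//].
    by rewrite lte_fin => /midf_lt[lo hi]; exists ((c + r) / 2)%R; rewrite ?lte_fin.
  by move=> _; exists (c + 1)%R; rewrite ?ltry// ltrDl.
have near_t (t : R) : `[a, b]%classic t ->
    \forall t' \near t & p \near Fg g, c'%:E < w_ p.2 ((p.1 : curve R d) t').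
  move=> tab.
  have c'w : c'%:E < w0 (g t).
    by apply: lt_le_trans c'inf _; apply: ereal_inf_lbound; exists t.
  have [[A B] [/= nA FB] AB] := w_lsc c'w.
  have [[T S] [/= nT nS] TS] := near_eval nA.
  exists (T, (S `*` B)); first by split => //; exists (S, B).
  move=> [t' [h n]] [/= Tt' [Sh Bn]].
  by apply: (AB (h t', n)); split => //; exact: (TS (t', h)).
have := (compact_near_coveringP _).1 (@segment_compact R a b) _ (Fg g)
  (fun p t => c'%:E < w_ p.2 ((p.1 : curve R d) t)) (FgF g) near_t.
apply: filterS => p /= H; apply: (@lt_le_trans _ _ c'%:E); first by rewrite lte_fin.
by apply: le_ereal_inf_tmp => _ [t tab <-]; exact/ltW/H.
Qed.

Lemma wsum_lsc (g : curve R d) (a : R) (s : seq R) :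
  liminf_ge (Fg g) (fun p => wsum (w_ p.2) (p.1 : curve R d) a s)
    (wsum w0 g a s).
Proof.
elim: s a => [|b s IH] a /=.
  by move=> c c0; exact: filterE.
apply: liminf_geD; [|exact: wsum_ge0| |exact: IH].
  by rewrite mule_ge0 ?lee_fin ?enorm_ge0 ?inf_along_ge0.
apply: liminf_geM; last 2 first.
- exact: inf_along_lsc.
- move=> q qr.
  pose D (h : curve R d) := enorm (h b - h a).
  have cD : D h @[h --> g] --> D g.
    apply: (@cvg_comp _ _ _ (fun h : curve R d => h b - h a)%R (@enorm R d) _
      (nbhs (g b - g a)%R)); last exact: enorm_continuous.
    exact: (cvgB (@curve_eval_continuous R d b g) (@curve_eval_continuous R d a g)).
  have nD : nbhs g [set h | (q < D h)%R] by exact: (cvgr_gt _ cD).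
  exists ([set h | (q < D h)%R], setT); first by split => //; exact: filterT.
  by move=> [h n] [].
- exact: inf_along_ge0.
- by move=> p; exact: inf_along_ge0.
- by move=> p; exact: enorm_ge0.
- exact: enorm_ge0.
Qed.

Lemma wlen_lsc (g : curve R d) :
  liminf_ge (Fg g) (fun p => wlen (w_ p.2) (p.1 : curve R d)) (wlen w0 g).
Proof.
move=> c /ereal_sup_gt[_ [[a s] [/= a0 ps] <-]] cs.
apply: filterS (wsum_lsc cs) => p /= cp; apply: (lt_le_trans cp).
exact: wsum_le_wlen.
Qed.

End lsc.

(** The case of a constant sequence of weights in [wlen_lsc], along [\oo]. *)
Lemma wlen_open (w : E -> \bar R) (c : R) : (forall x, 0 <= w x) ->
  (forall r : R, open [set x | r%:E < w x]) ->
  open [set g : curve R d | c%:E < wlen w (curve_fun g)].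
Proof.
move=> w0 ow; rewrite openE => g cg.
have wl x : liminf_ge (filter_prod (nbhs x) \oo) (fun p => w p.1) (w x).
  move=> r rw; exists ([set y | r%:E < w y], setT); last by move=> [y n] [].
  by split; [apply: open_nbhs_nbhs; split => //; exact: ow|exact: filterT].
have [[S B] [/= nS [N _ FB]] SB] := wlen_lsc _ w0 (fun=> w0) wl cg.
apply: filterS nS => h Sh; apply: (SB (h, N)); split => //=.
by apply: FB => /=.
Qed.

End weighted_length.

(** * Almost everywhere differentiability of Lipschitz functions and curves *)

Section lipschitz_monotone.
Context {R : realType}.
Local Notation mu := (@lebesgue_measure R).
Local Open Scope ereal_scope.

Lemma lip_cumulative (F : R -> R) : nondecreasing F ->
  (forall x y, x <= y -> F y - F x <= y - x)%R ->
  exists G : cumulative R R, (G : R -> R) = F.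
Proof.
move=> ndF lipF.
have lipa x y : (`|F x - F y| <= `|x - y|)%R.
  wlog xy : x y / (x <= y)%R => [H|].
    by have [/H//|/ltW/H] := leP x y; rewrite distrC [leRHS]distrC.
  rewrite distrC [leRHS]distrC !ger0_norm ?subr_ge0//; last exact: ndF.
  exact: lipF.
have rcF : right_continuous F.
  apply: right_continuousW => x A /nbhs_ballP[e e0 eA].
  apply/nbhs_ballP; exists e => // y xy; apply: eA.
  exact: le_lt_trans (lipa x y) xy.
by exists (HB.pack_for (cumulative R R) F (isCumulative.Build _ _ _ F ndF rcF)).
Qed.

Lemma stieltjes_itv (F : cumulative R R) (a b : R) : (a <= b)%R ->
  lebesgue_stieltjes_measure F `]a, b]%classic = (F b - F a)%:E.
Proof.
move=> ab; rewrite /lebesgue_stieltjes_measure /measure_extension.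
by rewrite measurable_mu_extE/= ?wlength_itv_bnd//; exact: is_ocitv.
Qed.

(** The function [x - F x] is nondecreasing too, and the Stieltjes measures of the two functions add
    up to Lebesgue measure. *)
Lemma lip_stieltjes_le (F : cumulative R R) :
  (forall x y, x <= y -> F y - F x <= y - x)%R ->
  forall A, measurable A -> lebesgue_stieltjes_measure F A <= mu A.
Proof.
move=> lipF.
have [H HE] : exists H : cumulative R R, (H : R -> R) = (fun x => x - F x)%R.
  apply: lip_cumulative => x y xy.
    by have := lipF _ _ xy; lra.
  by have := cumulative_is_nondecreasing F _ _ xy; lra.
move=> A mA.
suff -> : mu A = lebesgue_stieltjes_measure F A + lebesgue_stieltjes_measure H A.
  by rewrite leeDl.
rewrite -measure_addE; apply: (lebesgue_measure_unique (mu :=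
  measure_add (lebesgue_stieltjes_measure F) (lebesgue_stieltjes_measure H))) => //.
move=> _ [[x y] _ <-]; have [xy|yx] := leP x y; last first.
  by rewrite set_itv_ge ?measure0// bnd_simp -leNgt ltW.
apply: etrans (esym (measure_addE _ _ _)).
have eF := stieltjes_itv F xy; have eH := stieltjes_itv H xy.
apply: (@etrans _ _ ((F y - F x)%:E + (H y - H x)%:E)); last first.
  by congr (_ + _); exact/esym.
by rewrite /lebesgue_measure stieltjes_itv//= HE -EFinD; congr EFin; ring.
Qed.

(** Radon-Nikodym, with absolute continuity from [lip_stieltjes_le]; the restriction to []a, b]]
    makes the Stieltjes measure finite. *)
Lemma lip_monotone_density (F : cumulative R R) (a b : R) :
  (forall x y, x <= y -> F y - F x <= y - x)%R -> (a <= b)%R ->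
  exists h : R -> R, [/\ measurable_fun setT h, mu.-integrable setT (EFin \o h) &
    forall x, (a <= x <= b)%R -> \int[mu]_(t in `]a, x]) (h t)%:E = (F x - F a)%:E].
Proof.
move=> lipF ab.
have mab : measurable (`]a, b]%classic : set (measurableTypeR R)).
  exact: measurable_itv.
have finab : lebesgue_stieltjes_measure F `]a, b]%classic < +oo.
  by rewrite stieltjes_itv// ltry.
pose nu : {finite_measure set (measurableTypeR R) -> \bar R} :=
  mfrestr mab finab.
have numu : nu `<< mu.
  apply/null_content_dominatesP => A mA A0; apply/eqP.
  rewrite eq_le measure_ge0 andbT -A0.
  apply: le_trans (lip_stieltjes_le lipF mA).
  by apply: le_measure; rewrite ?inE//; exact: measurableI.
pose g := Radon_Nikodym_SigmaFinite.f nu mu.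
have gfin t : g t \is a fin_num by exact: Radon_Nikodym_SigmaFinite.f_fin_num.
have gE : EFin \o (fine \o g) = g by apply/funext => t /=; rewrite fineK.
have ig : mu.-integrable setT g by exact: Radon_Nikodym_SigmaFinite.f_integrable.
exists (fine \o g); split.
- by apply/measurable_EFinP; rewrite gE; exact: measurable_int ig.
- by rewrite gE.
- move=> x /andP[ax xb].
  rewrite -stieltjes_itv//.
  have -> : lebesgue_stieltjes_measure F `]a, x]%classic = nu `]a, x]%classic.
    rewrite /nu/= /mfrestr /mrestr; congr (lebesgue_stieltjes_measure F _).
    apply/esym/setIidPl => t /=; rewrite !in_itv/= => /andP[-> tx]/=.
    exact: le_trans xb.
  rewrite (Radon_Nikodym_SigmaFinite.f_integral numu); last exact: measurable_itv.
  by apply: eq_integral => t _; rewrite /= fineK.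
Qed.

(* [(x + f x) / 2] is nondecreasing with increments at most those of [x]: it is
   the distribution function of a measure dominated by Lebesgue's. *)
Lemma lip1_ae_derivable (f : R -> R) (a b : R) : (a <= b)%R ->
  (forall x y, `|f x - f y| <= `|x - y|)%R ->
  exists g : R -> R, [/\ measurable_fun setT g, mu.-integrable `]a, b] (EFin \o g),
    \int[mu]_(t in `]a, b]) (g t)%:E = (f b - f a)%:E &
    exists2 N, measurable N /\ mu N = 0 &
      forall x, ~ N x -> (a < x < b)%R -> is_derive x 1%R f (g x)].
Proof.
move=> ab lipf.
have lipf' x y : (x <= y)%R -> (- (y - x) <= f y - f x <= y - x)%R.
  move=> xy; have := lipf y x; rewrite ler_norml => /andP[].
  by rewrite ger0_norm ?subr_ge0// => -> ->.
have [F FE] : exists F : cumulative R R, (F : R -> R) = (fun x => (x + f x) / 2)%R.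
  apply: lip_cumulative => x y /lipf'; lra.
have lipF x y : (x <= y)%R -> (F y - F x <= y - x)%R.
  by rewrite FE => /lipf'; lra.
have [h [mh ih hE]] := lip_monotone_density lipF ab.
have ihab : mu.-integrable `]a, b] (EFin \o h).
  by apply: integrableS ih => //; exact: measurable_itv.
have i1 : mu.-integrable `]a, b] (EFin \o cst 1%R).
  apply/integrableP; split; first exact/measurable_EFinP/measurable_cst.
  rewrite (eq_integral (cst 1)); last by move=> x _ /=; rewrite normr1.
  by rewrite integral_cst//= mul1e lebesgue_measure_itv/=; case: ifP => // _; rewrite ltry.
exists (fun x => 2 * h x - 1)%R; split.
- by apply: measurable_funB => //; exact: measurable_funM.
- have -> : EFin \o (fun x => 2 * h x - 1)%R = (fun x => 2%:E * (EFin \o h) x) \- (EFin \o cst 1%R).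
    by apply/funext => x /=.
  by apply: integrableB => //; exact: integrableZl.
- transitivity (\int[mu]_(t in `]a, b]) ((2%:E * (EFin \o h) t) - (EFin \o cst 1%R) t)).
    by apply: eq_integral => x _.
  rewrite integralB//=; last exact: integrableZl.
  rewrite integralZl// hE ?ab ?lexx// integral_cst//= mul1e.
  rewrite lebesgue_measure_itv/=; move: ab; rewrite le_eqVlt => /predU1P[->|ab].
    by rewrite ltxx FE !subrr mule0 sube0.
  rewrite lte_fin ab -EFinM -!EFinB FE; congr EFin; lra.
- have ihy y : mu.-integrable `]-oo, y] (EFin \o h).
    by apply: integrableS ih => //; exact: measurable_itv.
  have lh : locally_integrable setT h.
    by apply: open_integrable_locally => //; exact: openT.
  pose G x := (\int[mu]_(t in `]-oo, x]) h t)%R.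
  have [N [mN N0 NE]] := FTC1Ny ihy lh.
  exists N => // x Nx /andP[ax xb].
  have [dG GE] : derivable G x 1%R /\ derive1 G x = h x.
    by apply: contrapT => nG; apply: Nx; apply: NE.
  (* On [[a, b]], [f] is [2 G - id] up to a constant, so the differentiation theorem for the
     primitive [G] of [h] passes to [f] with derivative [2 h - 1]. *)
  have Ff y : (a <= y <= b)%R -> (2 * G y - y - 2 * G a + 2 * F a)%R = f y.
    move=> /andP[ay yb].
    have := @Rintegral_itvB _ h -oo%O (BRight y) a (ihy y).
    rewrite bnd_simp => /(_ isT ay); rewrite -/(G y) -/(G a) => GB.
    have := hE y; rewrite ay yb => /(_ isT) /(congr1 fine)/=.
    rewrite -/(Rintegral _ _ _) -GB FE => GF.
    lra.
  have dGx : is_derive x 1%R G (h x).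
    by rewrite -GE derive1E; apply: DeriveDef.
  have dH : is_derive x 1%R ((2 \*: (G : R -> R^o) - id +
      cst (2 * F a - 2 * G a))%R : R -> R) (2 * h x - 1)%R.
    by apply: is_derive_eq; rewrite addr0.
  apply: near_eq_is_derive dH.
  have : \forall y \near x, (a < y < b)%R.
    by apply: near_in_itvoo; rewrite in_itv/= ax.
  apply: filterS => y /andP[/ltW ay /ltW yb]; rewrite -Ff ?ay//.
  rewrite /= !fctE /=; rewrite /GRing.scale /=; ring.
Qed.

End lipschitz_monotone.

Section curve_derivative.
Context {R : realType} {d : nat}.
Local Notation mu := (@lebesgue_measure R).
Local Notation E := 'rV[R]_d.
Implicit Types g : curve R d.

Lemma curve_ae_derivable g : exists2 N, measurable N /\ mu N = 0%E &
  forall t, ~ N t -> 0 < t -> derivable (g : R -> E) t 1.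
Proof.
pose B := [set t : R | 0 < t /\ ~ derivable (g : R -> E) t 1].
suff [N [mN N0 BN]] : mu.-negligible B.
  by exists N => // t Nt t0; apply: contrapT => nd; apply/Nt/BN.
pose A (i : 'I_d) (n : nat) :=
  [set t : R | 0 < t < n%:R /\ ~ derivable (fun s => g s ord0 i : R^o) t 1].
have negA i n : mu.-negligible (A i n).
  have lipi (s t : R) : `|g s ord0 i - g t ord0 i| <= `|s - t|.
    apply: le_trans (curve_lip1 g s t).
    by have := enorm_coord (g s - g t) i; rewrite !mxE.
  have [g0 [_ _ _ [N [mN N0] NE]]] := lip1_ae_derivable (ler0n R n) lipi.
  exists N; split => // t [tn nd]; apply: contrapT => Nt; apply: nd.
  by have [] := NE t Nt tn.
have negU n : mu.-negligible (\big[setU/set0]_(i < d) A i n).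
  elim/big_ind: _ => //; [exact: negligible_set0|move=> x y; apply: (@negligibleU _ _ _ mu)].
apply: (negligibleS _ (negligible_bigcup negU)) => t [t0 nd].
have [i ndi] : exists i, ~ derivable (fun s => g s ord0 i : R^o) t 1.
  apply: contrapT => /forallNP H; apply: nd; apply/derivable_mxP => k i.
  by rewrite (ord1 k); exact: contrapT (H i).
exists (Num.bound t) => //; rewrite -bigcup_seq; exists i.
  by rewrite /= mem_index_enum.
by split => //; rewrite t0 archi_boundP// ltW.
Qed.

Lemma derive1_straddle g (t : R) (e : R) : derivable (g : R -> E) t 1 -> 0 < e ->
  exists2 r : R, 0 < r & forall s, `|s - t| < r ->
    enorm (g s - g t - (s - t) *: derive1 (g : R -> E) t) <= e * `|s - t|.
Proof.
move=> dg e0; have /cvg_ex[l gl] := dg.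
have lE : derive1 (g : R -> E) t = l.
  by rewrite derive1E; apply/cvg_lim.
have nl : nbhs l [set v | enorm (l - v) < e].
  by apply/nbhs_enormP; exists e.
have /nbhs_ballP[r /= r0 rA] := gl _ nl.
exists r => // s st; have [->|st0] := eqVneq s t.
  by rewrite !subrr scale0r subrr enorm0 normr0 mulr0.
have h0 : s - t != 0 by rewrite subr_eq0.
have br : ball (0 : R) r (s - t) by rewrite /ball/= sub0r normrN.
have /= := rA _ br h0; rewrite [(s - t)%:A]mulr1 subrK lE => H.
have -> : g s - g t - (s - t) *: l = (s - t) *: - (l - (s - t)^-1 *: (g s - g t)).
  by rewrite opprB scalerBr scalerA divff// scale1r.
by rewrite enormZ enormN mulrC ler_wpM2r//; apply/ltW.
Qed.

(** Quotients over intervals that contain [t] without starting there: the cells of a fixed grid are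
    of this kind. The first-order expansion at [t] is applied at both ends. *)
Lemma speed_ge_increment g (t : R) (q : R) : derivable (g : R -> E) t 1 ->
  q < speed g t ->
  exists2 r : R, 0 < r & forall u v, u <= t -> t <= v -> u < v -> t - u < r -> v - t < r ->
    q < enorm (g v - g u) / (v - u).
Proof.
move=> dg qs.
have e0 : 0 < (speed g t - q) / 2 by rewrite divr_gt0// subr_gt0.
have [r r0 H] := derive1_straddle dg e0.
exists r => // u v ut tv uv utr vtr.
set D := derive1 (g : R -> E) t in H.
have Hu := H u; rewrite ler0_norm ?subr_le0// opprB in Hu; have {}Hu := Hu utr.
have Hv := H v; rewrite ger0_norm ?subr_ge0// in Hv; have {}Hv := Hv vtr.
have DE : (v - u) *: D = (g v - g u) - (g v - g t - (v - t) *: D) + (g u - g t - (u - t) *: D).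
  by apply/rowP => i; rewrite !mxE; ring.
have : (v - u) * speed g t <= enorm (g v - g u) + (speed g t - q) / 2 * (v - u).
  have -> : (v - u) * speed g t = enorm ((v - u) *: D).
    by rewrite enormZ ger0_norm// subr_ge0 ltW.
  rewrite DE; apply: le_trans (enormD _ _) _.
  have := enormD (g v - g u) (- (g v - g t - (v - t) *: D)); rewrite enormN.
  lra.
rewrite ltr_pdivlMr ?subr_gt0//.
have : 0 < v - u by rewrite subr_gt0.
nra.
Qed.

(** Meant for the projection of [g] on a unit vector: a derivative above the speed would give, for a
    small positive step, an increment of [f] larger than that of [g]. *)
Lemma derive_le_speed g (t c : R) (f : R -> R) : derivable (g : R -> E) t 1 ->
  is_derive t 1 f c ->
  (forall s, `|f s - f t| <= enorm (g s - g t)) -> c <= speed g t.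
Proof.
move=> dg [df fc] fg; rewrite leNgt; apply/negP => sc.
pose e := (c - speed g t) / 2.
have e0 : 0 < e by rewrite divr_gt0// subr_gt0.
have [r r0 H] := derive1_straddle dg e0.
have /cvg_ex[l fl] := df.
have lc : l = c by rewrite -fc; apply/esym/cvg_lim.
have nl : nbhs l [set v : R | `|l - v| < e] by exact: nbhsx_ballx.
have /nbhs_ballP[r' /= r'0 r'A] := fl _ nl.
pose h := Num.min r r' / 2.
have h0 : 0 < h by rewrite divr_gt0// lt_min r0.
have hr : h < r by rewrite /h; case: (leP r r') => ?; lra.
have hr' : h < r' by rewrite /h; case: (leP r r') => ?; lra.
have br : ball (0 : R) r' h by rewrite /ball/= sub0r normrN gtr0_norm.
have /= := r'A _ br (lt0r_neq0 h0); rewrite [h%:A]mulr1 lc => H1.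
have := H (h + t); rewrite addrK gtr0_norm// => /(_ hr) H2.
have H3 : enorm (g (h + t) - g t) <= h * speed g t + e * h.
  rewrite -[X in enorm X](subrK (h *: derive1 (g : R -> E) t)).
  apply: le_trans (enormD _ _) _; rewrite [X in _ + X]enormZ gtr0_norm//.
  by rewrite addrC lerD2l.
have H4 : f (h + t) - f t <= h * speed g t + e * h.
  exact: le_trans (ler_norm _) (le_trans (fg _) H3).
have H5 : h^-1 *: (f (h + t) - f t) <= speed g t + e.
  by rewrite /GRing.scale/= ler_pdivrMl// mulrDr [h * e]mulrC.
move: H1; rewrite ltr_norml => /andP[_]; rewrite /e in H5 *.
move: H5; set q := _ *: _; lra.
Qed.

End curve_derivative.

Section measurable_speed.
Context {R : realType} {d : nat}.
Local Notation mu := (@lebesgue_measure R).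
Local Notation E := 'rV[R]_d.
Implicit Types g : curve R d.
Local Open Scope ereal_scope.

(* A measurable function which agrees with [speed g] almost everywhere; the
   measurability of [speed g] itself is not clear, because of the default values
   of [derive1]. *)
Definition mspeed g (t : R) : \bar R :=
  limn_einf (fun n => (n.+1%:R * enorm (g (t + n.+1%:R^-1) - g t))%:E).

Lemma limn_einf_ge (u : nat -> \bar R) (v : \bar R) :
  liminf_ge \oo u v -> v <= limn_einf u.
Proof.
move=> uv; have key (c : R) : c%:E < v -> c%:E <= limn_einf u.
  move=> /uv cu; rewrite limn_einf_lim; apply: lime_ge; first exact: is_cvg_einfs.
  have [N _ NP] := cu.
  exists N => // n /= Nn; apply: le_ereal_inf_tmp => _ [m /= nm <-].
  by apply/ltW/NP; exact: leq_trans nm.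
case: v uv key => [v| |] _ key.
- apply/lee_subgt0Pr => e e0; rewrite -EFinB; apply: key.
  by rewrite lte_fin ltrBlDr ltrDl.
- suff -> : limn_einf u = +oo by [].
  by apply/eqyP => A A0; apply: key; rewrite ltry.
- exact: leNye.
Qed.

Lemma mspeed_ge0 g t : 0 <= mspeed g t.
Proof.
apply: limn_einf_ge => c c0; apply: filterE => n /=; apply: (lt_le_trans c0).
by rewrite lee_fin mulr_ge0// enorm_ge0.
Qed.

Lemma measurable_mspeed g : measurable_fun setT (mspeed g).
Proof.
pose u (n : nat) (t : R) : \bar R :=
  (n.+1%:R * enorm (g (t + n.+1%:R^-1) - g t))%:E.
have mu_ n : measurable_fun setT (u n).
  apply/measurable_EFinP; apply: measurable_funM; first exact: measurable_cst.
  apply: continuous_measurable_fun => t A /nbhs_ballP[e /= e0 eA].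
  have e20 : (0 < e / 2)%R by rewrite divr_gt0.
  apply/nbhs_ballP; exists (e / 2)%R => // s ts; apply: eA.
  apply: le_lt_trans (enorm_dist _ _) _.
  set h : R := (n.+1%:R^-1)%R.
  have -> : (g (t + h) - g t - (g (s + h) - g s) = (g (t + h) - g (s + h)) - (g t - g s))%R.
    by apply/rowP => i; rewrite !mxE; ring.
  apply: le_lt_trans (enormD _ _) _; rewrite enormN.
  have := curve_lip1 g t s; have := curve_lip1 g (t + h) (s + h).
  rewrite (_ : t + h - (s + h) = t - s)%R; last by ring.
  have : (`|t - s| < e / 2)%R := ts.
  by lra.
have -> : mspeed g = fun t => limn (fun n => einfs (u ^~ t) n).
  by apply/funext => t; rewrite /mspeed limn_einf_lim.
apply: (@emeasurable_fun_cvg _ _ _ _ (fun n t => einfs (u ^~ t) n)).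
  by move=> n; exact: measurable_fun_einfs.
by move=> t _; exact: is_cvg_einfs.
Qed.

Lemma mspeedE g t : derivable (g : R -> E) t 1 -> mspeed g t = (speed g t)%:E.
Proof.
move=> dg; rewrite /mspeed; apply: (cvg_limn_einf_sup _).1.
apply: cvg_EFin; first exact: nearW.
apply/cvgrPdist_le => e e0.
have [r r0 H] := derive1_straddle dg e0.
have [N _ NP] := near_infty_natSinv_lt (PosNum r0).
exists N => // n Nn /=.
set h : R := (n.+1%:R^-1)%R.
have h0 : (0 < h)%R by rewrite invr_gt0 ltr0n.
have hr : (h < r)%R by exact: NP.
have := H (t + h)%R; rewrite addrAC subrr add0r gtr0_norm// => /(_ hr) H1.
have hE : (n.+1%:R = h^-1)%R by rewrite invrK.
have H2 := enorm_dist (g (t + h)%R - g t) (h *: derive1 (g : R -> E) t).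
rewrite enormZ (gtr0_norm h0) in H2.
rewrite distrC hE -[X in (_ * _ - X)%R](mulKf (lt0r_neq0 h0)) -mulrBr normrM.
rewrite gtr0_norm ?invr_gt0// ler_pdivrMl// [(h * e)%R]mulrC.
exact: le_trans H2 H1.
Qed.

(** No measurability of [w] is assumed, so the two integrands are made equal by deleting a null set.
    Time 0 is deleted as well, because differentiability is known at positive times only. *)
Lemma integral_speedE g (w : E -> \bar R) : (forall x, 0 <= w x) ->
  \int[mu]_(t in `[0%R, +oo[) (w (g t) * (speed g t)%:E) =
  \int[mu]_(t in `[0%R, +oo[) (w (g t) * mspeed g t).
Proof.
move=> w0; have [N [mN N0] NE] := curve_ae_derivable g.
have mN' : measurable (N `|` [set 0%R]) by apply: measurableU.
have N'0 : mu (N `|` [set 0%R]) = 0.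
  apply/eqP; rewrite -measure_le0.
  have M1 : mu (N `|` [set 0%R]) <= mu N + mu [set 0%R].
    exact: (measureU2 _ mN (measurable_set1 0%R)).
  have M2 : mu [set 0%R] = 0 by exact: lebesgue_measure_set1.
  by move: M1; rewrite M2 adde0 => /le_trans; apply; rewrite N0.
have s0 t : 0 <= (speed g t)%:E by rewrite lee_fin enorm_ge0.
rewrite (ge0_negligible_integral_nonmeasurable _ mN' N'0)//; last 1 first.
  by move=> t _; rewrite mule_ge0.
rewrite [RHS](ge0_negligible_integral_nonmeasurable _ mN' N'0)//; last 1 first.
  by move=> t _; rewrite mule_ge0 ?mspeed_ge0.
apply: eq_integral => t; rewrite inE /= in_itv/= andbT => -[t0 nt].
rewrite mspeedE//; apply: NE.
  by move=> Nt; apply: nt; left.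
by rewrite lt_neqAle t0 andbT; apply/eqP => t0'; apply: nt; right.
Qed.

End measurable_speed.

Section increments.
Context {R : realType} {d : nat}.
Local Notation mu := (@lebesgue_measure R).
Local Notation E := 'rV[R]_d.
Implicit Types g : curve R d.
Local Open Scope ereal_scope.

Lemma edot_norm (u v : E) : (`|edot u v| <= enorm u * enorm v)%R.
Proof.
rewrite ler_norml; apply/andP; split; last exact: edot_le.
have := edot_le (- u) v; rewrite enormN.
have -> : edot (- u) v = (- edot u v)%R.
  by rewrite /edot -sumrN; apply: eq_bigr => i _; rewrite mxE mulNr.
lra.
Qed.

Lemma edotBr (u v w : E) : edot u (v - w) = (edot u v - edot u w)%R.
Proof.
rewrite /edot -sumrB; apply: eq_bigr => i _; rewrite !mxE; ring.
Qed.

(** Project [g] on the unit vector [e] along [g b - g a]: the increment of the scalar function [phi]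
    is the whole norm, and its derivative is at most the speed of [g]. *)
Lemma increment_le g (a b : R) : (0 <= a)%R -> (a <= b)%R ->
  (enorm (g b - g a))%:E <= \int[mu]_(t in `]a, b]) mspeed g t.
Proof.
move=> a0 ab; set D := (g b - g a)%R.
have [D0|D0] := eqVneq (enorm D) 0%R.
  by rewrite D0; apply: integral_ge0 => t _; exact: mspeed_ge0.
have Dp : (0 < enorm D)%R by rewrite lt_neqAle eq_sym D0 enorm_ge0.
pose e := ((enorm D)^-1 *: D)%R.
have e1 : enorm e = 1%R by rewrite enormZ gtr0_norm ?invr_gt0// mulVf.
pose phi (t : R) := edot e (g t).
have phi_le s t : (`|phi s - phi t| <= enorm (g s - g t))%R.
  rewrite /phi -edotBr; apply: le_trans (edot_norm _ _) _.
  by rewrite e1 mul1r.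
have phi_lip s t : (`|phi s - phi t| <= `|s - t|)%R.
  exact: le_trans (phi_le s t) (curve_lip1 g s t).
have phiD : (phi b - phi a = enorm D)%R.
  rewrite /phi -edotBr -/D /e.
  have -> : edot ((enorm D)^-1 *: D) D = ((enorm D)^-1 * edot D D)%R.
    by rewrite /edot mulr_sumr; apply: eq_bigr => i _; rewrite mxE mulrA.
  by rewrite edot_self expr2 mulKf.
have [h [mh ih hE [N [mN N0] NE]]] := lip1_ae_derivable ab phi_lip.
have [N' [mN' N'0] NE'] := curve_ae_derivable g.
rewrite -phiD -hE integralE.
(* The density [h] may be negative, while the comparison with [mspeed] is one between nonnegative
   integrands. *)
apply: (@le_trans _ _ (\int[mu]_(t in `]a, b]) ((fun t => (h t)%:E)^\+ t))).
  by apply: geeDl; rewrite oppe_le0; apply: integral_ge0 => t _; exact: funeneg_ge0.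
pose M := (N `|` N' `|` [set b])%classic.
have mM : measurable M by apply: measurableU => //; exact: measurableU.
have M0 : mu M = 0.
  apply/eqP; rewrite -measure_le0.
  have M1 : mu M <= mu (N `|` N') + mu [set b].
    by apply: measureU2 => //; exact: measurableU.
  have M2 : mu (N `|` N') <= mu N + mu N' by exact: measureU2.
  have M3 : mu [set b] = 0 by exact: lebesgue_measure_set1.
  by move: M1; rewrite M3 adde0 => /le_trans; apply; apply: le_trans M2 _; rewrite N0 N'0 adde0.
have mab : measurable (`]a, b]%classic : set (measurableTypeR R)) by exact: measurable_itv.
rewrite (ge0_negligible_integral_nonmeasurable mab mM M0); last first.
  by move=> t _; exact: funepos_ge0.
rewrite (ge0_negligible_integral_nonmeasurable mab mM M0); last first.
  by move=> t _; exact: mspeed_ge0.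
apply: ge0_le_integral_nonmeasurable => t; first by move=> _; exact: funepos_ge0.
move=> [/= tab Mt]; rewrite in_itv/= in tab; have /andP[at_ tb] := tab.
have Nt : ~ N t by move=> Nt; apply: Mt; left; left.
have N't : ~ N' t by move=> N't; apply: Mt; left; right.
have tb' : (t < b)%R.
  by rewrite lt_neqAle tb andbT; apply/eqP => tb'; apply: Mt; right.
have t0 : (0 < t)%R by exact: le_lt_trans at_.
have dg := NE' t N't t0.
rewrite mspeedE// funeposE ge_max lee_fin.
rewrite (derive_le_speed dg (NE t Nt _) (phi_le^~ t)) ?at_//=.
by rewrite lee_fin enorm_ge0.
Qed.

Section open_weight.
Variables (g : curve R d) (w : E -> \bar R).
Hypothesis w0 : forall x, 0 <= w x.
Hypothesis w_open : forall c : R, open [set x | c%:E < w x].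

Lemma weight_measurable : measurable_fun setT (fun t => w (g t)).
Proof.
apply: measurable_gt_sets => c.
have oO : open ((g : R -> E) @^-1` [set x | c%:E < w x]).
  by move/continuousP: (@curve_continuous _ _ g); apply; exact: w_open.
exact: open_measurable oO.
Qed.

Lemma wm_measurable (D : set R) : measurable D ->
  measurable_fun D (fun t => w (g t) * mspeed g t).
Proof.
move=> mD; apply: emeasurable_funM; apply: measurable_funTS.
  exact: weight_measurable.
exact: measurable_mspeed.
Qed.

Lemma wm_ge0 t : 0 <= w (g t) * mspeed g t.
Proof. by rewrite mule_ge0 ?mspeed_ge0. Qed.

Lemma wsum_le_integral (a : R) (s : seq R) : (0 <= a)%R -> path <=%R a s ->
  wsum w g a s <= \int[mu]_(t in `]a, last a s]) (w (g t) * mspeed g t).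
Proof.
elim: s a => [|b s IH] a a0 /=.
  by move=> _; apply: integral_ge0 => t _; exact: wm_ge0.
move=> /andP[ab bs].
have b0 : (0 <= b)%R by exact: le_trans ab.
have bl : (b <= last b s)%R.
  elim: s b bs {IH ab b0} => //= c s IH b /andP[bc cs].
  exact: le_trans bc (IH _ cs).
have split_itv : `]a, last b s]%classic = `]a, b]%classic `|` `]b, last b s]%classic.
  by rewrite -itv_bndbnd_setU// bnd_simp.
rewrite split_itv ge0_integral_setU//=; last 3 first.
- by apply: wm_measurable; exact: measurableU.
- by move=> t _; exact: wm_ge0.
- apply/disj_setPS => t [/=]; rewrite !in_itv/= => /andP[_ tb] /andP[bt _].
  by have := lt_le_trans bt tb; rewrite ltxx.
apply: leeD; last exact: IH.
apply: (@le_trans _ _ (inf_along w g a b * \int[mu]_(t in `]a, b]) mspeed g t)).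
  by apply: lee_wpmul2l; [exact: inf_along_ge0|exact: increment_le].
rewrite -ge0_integralZl//; last 3 first.
- by apply: measurable_funTS; exact: measurable_mspeed.
- by move=> t _; exact: mspeed_ge0.
- exact: inf_along_ge0.
apply: ge0_le_integral_nonmeasurable => t.
  by move=> _; rewrite mule_ge0 ?mspeed_ge0 ?inf_along_ge0.
rewrite /= in_itv/= => /andP[at_ tb]; apply: lee_wpmul2r; first exact: mspeed_ge0.
by apply: ereal_inf_lbound; exists t => //=; rewrite in_itv/= tb ltW.
Qed.

Lemma wlen_le_integral :
  wlen w g <= \int[mu]_(t in `[0%R, +oo[) (w (g t) * mspeed g t).
Proof.
apply: ge_ereal_sup => _ [[a s] [/= a0 ps] <-].
apply: le_trans (wsum_le_integral a0 ps) _.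
apply: ge0_subset_integral => //=.
- by apply: wm_measurable; exact: measurable_itv.
- by move=> t _; exact: wm_ge0.
- move=> t /=; rewrite !in_itv/= andbT => /andP[/ltW at_ _].
  exact: le_trans at_.
Qed.

End open_weight.
End increments.

Section wlen_integral.
Context {R : realType} {d : nat}.
Local Notation mu := (@lebesgue_measure R).
Local Notation E := 'rV[R]_d.
Variables (g : curve R d) (w : E -> \bar R).
Hypothesis w0 : forall x, (0 <= w x)%E.
Hypothesis w_open : forall c : R, open [set x | (c%:E < w x)%E].
Local Open Scope ereal_scope.

Let step (n : nat) : R := (n.+1%:R^-1)%R.

Let step_gt0 n : (0 < step n)%R. Proof. by rewrite invr_gt0 ltr0n. Qed.

Let node (n k : nat) : R := (k%:R * step n)%R.

Let cell (n k : nat) : set R := `[node n k, node n k.+1[%classic.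

Let slope (n k : nat) : R := (enorm (g (node n k.+1) - g (node n k)) / step n)%R.

Let coef (n k : nat) : \bar R :=
  inf_along w g (node n k) (node n k.+1) * (slope n k)%:E.

(** A step function on [(n + 1)^2] cells of length [1 / (n + 1)]: the mesh tends to 0 while the
    covered interval [[0, n + 1[] exhausts the half-line. Its integral is the [wsum] of [g] along
    the grid, hence at most [wlen w g]. *)
Let approx (n : nat) (t : R) : \bar R :=
  \sum_(k < n.+1 * n.+1) coef n k * (\1_(cell n k) t)%:E.

Let slope_ge0 n k : (0 <= slope n k)%R.
Proof. by rewrite divr_ge0 ?enorm_ge0// ltW. Qed.

Let coef_ge0 n k : 0 <= coef n k.
Proof. by rewrite mule_ge0 ?inf_along_ge0// lee_fin. Qed.

Let node_lt n k : (node n k < node n k.+1)%R.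
Proof. by rewrite ltr_pM2r// ltr_nat. Qed.

Let node_step n k : (node n k.+1 - node n k = step n)%R.
Proof. by rewrite /node -mulrBl -natrB// subSnn mul1r. Qed.

Let mcell n k : measurable (cell n k : set (measurableTypeR R)).
Proof. exact: measurable_itv. Qed.

Let mterm (D : set (measurableTypeR R)) n k : measurable D ->
  measurable_fun D (fun t => coef n k * (\1_(cell n k) t)%:E).
Proof.
move=> mD; apply: emeasurable_funM; first exact: measurable_cst.
by apply/measurable_EFinP; exact: measurable_indic.
Qed.

Let term_ge0 n k t : 0 <= coef n k * (\1_(cell n k) t)%:E.
Proof. by rewrite mule_ge0// lee_fin. Qed.

Let mu_cell n k : mu (cell n k) = (step n)%:E.
Proof.
by rewrite /cell lebesgue_measure_itv/= lte_fin node_lt -EFinB node_step.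
Qed.

Let approx_integral n :
  \int[mu]_(t in `[0%R, +oo[) approx n t =
  \sum_(k < n.+1 * n.+1) coef n k * (step n)%:E.
Proof.
have mD : measurable (`[0%R, +oo[%classic : set (measurableTypeR R)).
  exact: measurable_itv.
rewrite ge0_integral_sum//; last by move=> k; exact: mterm.
apply: eq_bigr => k _.
rewrite ge0_integralZl//; last by apply/measurable_EFinP; exact: measurable_indic.
rewrite integral_indic//; congr (_ * _).
have -> : cell n k `&` `[0%R, +oo[%classic = cell n k.
  apply/setIidPl => t; rewrite /cell /= !in_itv/= andbT => /andP[nt _].
  by apply: le_trans nt; rewrite mulr_ge0// ltW.
exact: mu_cell.
Qed.

Let wsum_nodes n i m : wsum w g (node n i) [seq node n k | k <- iota i.+1 m] =
  \sum_(i <= k < i + m) coef n k * (step n)%:E.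
Proof.
elim: m i => [|m IH] i /=; first by rewrite addn0 big_geq.
rewrite IH -addSnnS [RHS]big_ltn; last by rewrite ltnS leq_addr.
congr (_ + _); rewrite /coef -muleA -EFinM /slope divfK//.
by rewrite gt_eqF.
Qed.

Let path_nodes n i m : path <=%R (node n i) [seq node n k | k <- iota i.+1 m].
Proof. by elim: m i => //= m IH i; rewrite IH andbT ltW. Qed.

Let approx_le_wlen n : \int[mu]_(t in `[0%R, +oo[) approx n t <= wlen w g.
Proof.
rewrite approx_integral -(big_mkord xpredT (fun k => coef n k * (step n)%:E)).
rewrite -[(n.+1 * n.+1)%N]add0n -wsum_nodes; apply: wsum_le_wlen => //.
by rewrite /node mul0r.
Qed.

Let approx_liminf t : (0 < t)%R -> derivable (g : R -> E) t 1 ->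
  liminf_ge \oo (approx ^~ t) (w (g t) * (speed g t)%:E).
Proof.
move=> t0 dg c cv; have [c0|c0] := ltP c 0%R.
  apply: filterE => n /=; apply: (@lt_le_trans _ _ 0); first by rewrite lte_fin.
  by apply: sume_ge0 => k _; exact: term_ge0.
have [p [q [p0 q0 pw qs cpq]]] := lte_mulP (w0 _) (enorm_ge0 _) c0 cv.
have [r1 r10 H1] : exists2 r1 : R, (0 < r1)%R &
    forall s, (`|t - s| < r1)%R -> p%:E < w (g s).
  have oO : open ((g : R -> E) @^-1` [set x | p%:E < w x]).
    by move/continuousP: (@curve_continuous _ _ g); apply; exact: w_open.
  have /nbhs_ballP[r1 /= r10 H1] := open_nbhs_nbhs (conj oO (pw : _ t)).
  by exists r1 => // s ts; exact: H1.
have [r2 r20 H2] := speed_ge_increment dg qs.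
have [N1 _ NP1] := near_infty_natSinv_lt (PosNum r10).
have [N2 _ NP2] := near_infty_natSinv_lt (PosNum r20).
(* The mesh is then below both radii, and [n] is large enough for the cell containing [t] to be
   among those of [approx n]. *)
exists (maxn (maxn N1 N2) (Num.bound t)) => // n.
rewrite /= !geq_max -andbA => /and3P[/NP1 /= h1 /NP2 /= h2 tn].
rewrite -/(step n) in h1 h2.
have [k [ik ki]] : exists k : nat, (node n k <= t)%R /\ (t < node n k.+1)%R.
  exists (Num.truncn (t / step n)); rewrite /node -ler_pdivlMr// -ltr_pdivrMr//.
  by apply/andP/truncn_itv; rewrite divr_ge0// ltW.
have kn : (k < n.+1 * n.+1)%N.
  rewrite -(ltr_nat R) natrM.
  have : (node n k < n.+1%:R)%R.
    apply: le_lt_trans ik _; apply: lt_le_trans (archi_boundP (ltW t0)) _.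
    by rewrite ler_nat ltnW// ltnS.
  by rewrite /node /step ltr_pdivrMr.
apply: (@lt_le_trans _ _ (coef n k)); last first.
  rewrite /approx (bigD1 (Ordinal kn))//=.
  rewrite indicE mem_set ?mule1; last by rewrite /cell /= in_itv/= ik ki.
  by rewrite leeDl// sume_ge0// => j _; exact: term_ge0.
have hk := node_step n k.
apply: (@le_lt_trans _ _ (p%:E * q%:E)); first by rewrite -EFinM lee_fin.
apply: (@lt_le_trans _ _ (p%:E * (slope n k)%:E)).
  rewrite -!EFinM lte_fin ltr_pM2l// /slope -hk.
  apply: H2 => //; first exact: ltW.
  - by move: h2 ki; rewrite -hk; lra.
  - by move: h2 ik; rewrite -hk; lra.
apply: lee_wpmul2r; first by rewrite lee_fin.
apply: le_ereal_inf_tmp => _ [s + <-]; rewrite /= in_itv/= => /andP[ks sk].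
apply/ltW/H1; rewrite ltr_norml; move: h1; rewrite -hk; lra.
Qed.

(** Fatou for the step functions [approx], whose lower limit dominates the integrand almost
    everywhere by [approx_liminf]. *)
Lemma integral_le_wlen :
  \int[mu]_(t in `[0%R, +oo[) (w (g t) * (speed g t)%:E) <= wlen w g.
Proof.
have [N [mN N0] NE] := curve_ae_derivable g.
have mM : measurable (N `|` [set 0%R]) by apply: measurableU.
have M0 : mu (N `|` [set 0%R]) = 0.
  apply/eqP; rewrite -measure_le0.
  have M1 : mu (N `|` [set 0%R]) <= mu N + mu [set 0%R].
    exact: (measureU2 _ mN (measurable_set1 0%R)).
  have M2 : mu [set 0%R] = 0 by exact: lebesgue_measure_set1.
  by move: M1; rewrite M2 adde0 => /le_trans; apply; rewrite N0.
have mD : measurable (`[0%R, +oo[%classic : set (measurableTypeR R)).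
  exact: measurable_itv.
rewrite (ge0_negligible_integral_nonmeasurable mD mM M0); last first.
  by move=> t _; rewrite mule_ge0// lee_fin enorm_ge0.
apply: (@le_trans _ _ (\int[mu]_(t in `[0%R, +oo[) limn_einf (approx ^~ t))).
  rewrite (@ge0_negligible_integral_nonmeasurable _ _ _ mu _ _
    (fun t => limn_einf (approx ^~ t)) mD mM M0); last first.
    move=> t _; apply: limn_einf_ge => c c0; apply: filterE => n /=.
    by apply: (lt_le_trans c0); apply: sume_ge0 => k _; exact: term_ge0.
  apply: ge0_le_integral_nonmeasurable => t.
    by move=> _; rewrite mule_ge0// lee_fin enorm_ge0.
  rewrite /= in_itv/= andbT => -[t0 Mt].
  apply/limn_einf_ge/approx_liminf.
    by rewrite lt_neqAle t0 andbT; apply/eqP => t0'; apply: Mt; right.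
  apply: NE; first by move=> Nt; apply: Mt; left.
  by rewrite lt_neqAle t0 andbT; apply/eqP => t0'; apply: Mt; right.
apply: le_trans (fatou _ _ _ _) _ => //.
- by move=> n; apply: emeasurable_sum => k; exact: mterm.
- by move=> n t _; apply: sume_ge0 => k _; exact: term_ge0.
rewrite limn_einf_lim; apply: lime_le; first exact: is_cvg_einfs.
apply: nearW => n; apply: le_trans (approx_le_wlen n).
by apply: ereal_inf_lbound; exists n => /=.
Qed.

Lemma wlenE :
  \int[mu]_(t in `[0%R, +oo[) (w (g t) * (speed g t)%:E) = wlen w g.
Proof.
apply/eqP; rewrite eq_le integral_le_wlen/= integral_speedE//.
exact: wlen_le_integral.
Qed.

End wlen_integral.

(** * Arc length parametrization *)

Section arc_length.
Context {R : realType} {d : nat}.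
Local Notation E := 'rV[R]_d.
Implicit Types (g : curve R d) (a b : R) (s : seq R).

Fixpoint vsum (f : R -> E) a s : R :=
  if s is b :: s' then enorm (f b - f a) + vsum f b s' else 0.

Definition vsums g a : set R :=
  [set vsum g 0 s | s in [set s | path <=%R 0 s /\ last 0 s <= a]].

(** The variation of [g] on [[0, a]]. Inscribed polygons are preferred to the integral of the speed
    because each polygonal sum is continuous in [g], which gives measurability through
    [arclen_open]. *)
Definition arclen g a : R := sup (vsums g a).

Lemma vsum_cat (f : R -> E) a s1 s2 :
  vsum f a (s1 ++ s2) = vsum f a s1 + vsum f (last a s1) s2.
Proof. by elim: s1 a => /= [|b s1 IH] a; rewrite ?add0r// IH addrA. Qed.

Lemma path_le_last a s : path <=%R a s -> a <= last a s.
Proof.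
by elim: s a => //= b s IH a /andP[ab /IH]; exact: le_trans.
Qed.

Lemma vsum_le g a s : path <=%R a s -> vsum g a s <= last a s - a.
Proof.
elim: s a => /= [|b s IH] a; first by rewrite subrr.
move=> /andP[ab /IH]; have := curve_lip1 g b a; rewrite ger0_norm ?subr_ge0//.
lra.
Qed.

(** Cut the polygon at time [a]: what comes after [a] is at most the elapsed time, as [g] is
    1-Lipschitz. Hence [arclen g] is 1-Lipschitz. *)
Lemma vsum_split g a x s : x <= a -> path <=%R x s -> a <= last x s ->
  exists s1, [/\ path <=%R x s1, last x s1 <= a &
    vsum g x s <= vsum g x s1 + (last x s - a)].
Proof.
elim: s x => /= [|y s IH] x xa.
  by move=> _ ax; exists [::]; split => //=; lra.
move=> /andP[xy ys] al; have [ya|/ltW ay] := leP y a.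
  have [s1 [ps1 ls1 vs1]] := IH y ya ys al.
  by exists (y :: s1); split => //=; [rewrite xy|lra].
exists [:: a]; split => //=; first by rewrite xa.
have h1 := vsum_le g ys.
have := curve_lip1 g y a; rewrite ger0_norm ?subr_ge0// => h2.
have := enorm_triangle (g a) (g y) (g x); lra.
Qed.

Lemma vsums_has_sup g a : 0 <= a -> has_sup (vsums g a).
Proof.
move=> a0; split; first by exists 0, [::].
exists a => _ [s [ps ls] <-]; apply: le_trans (vsum_le g ps) _.
by rewrite subr0.
Qed.

Lemma vsum_le_arclen g a s : 0 <= a -> path <=%R 0 s -> last 0 s <= a ->
  vsum g 0 s <= arclen g a.
Proof.
move=> a0 ps ls; apply: sup_upper_bound; first exact: vsums_has_sup.
by exists s.
Qed.

Lemma arclen_ge0 g a : 0 <= a -> 0 <= arclen g a.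
Proof. by move=> a0; apply: (@vsum_le_arclen g a [::]). Qed.

Lemma arclen_ub g a c : 0 <= a ->
  (forall s, path <=%R 0 s -> last 0 s <= a -> vsum g 0 s <= c) -> arclen g a <= c.
Proof.
move=> a0 H; apply: sup_le_ub; first by have [] := vsums_has_sup g a0.
by move=> _ [s [ps ls] <-]; exact: H.
Qed.

Lemma arclen_increment g a b : 0 <= a -> a <= b ->
  enorm (g b - g a) <= arclen g b - arclen g a.
Proof.
move=> a0 ab; rewrite lerBrDr -lerBrDl; apply: arclen_ub => // s ps ls.
rewrite lerBrDl.
have := @vsum_le_arclen g b (s ++ [:: a; b]) (le_trans a0 ab) _ _.
rewrite cat_path last_cat ps /= ls ab lexx vsum_cat/= addr0 => /(_ isT isT).
have := enorm_ge0 (g a - g (last 0 s)); lra.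
Qed.

Lemma arclen_le_increment g a b : 0 <= a -> a <= b ->
  arclen g b - arclen g a <= b - a.
Proof.
move=> a0 ab; rewrite lerBlDl; apply: arclen_ub => [|s ps ls].
  exact: le_trans ab.
have [la|al] := leP (last 0 s) a.
  by have := vsum_le_arclen g a0 ps la; lra.
have [s1 [ps1 ls1 vs1]] := vsum_split g a0 ps (ltW al).
have := vsum_le_arclen g a0 ps1 ls1; lra.
Qed.

Lemma arclen_mono g a b : 0 <= a -> a <= b -> arclen g a <= arclen g b.
Proof.
by move=> a0 ab; have := arclen_increment g a0 ab; have := enorm_ge0 (g b - g a); lra.
Qed.

Lemma arclen0 g : arclen g 0 = 0.
Proof.
apply/le_anti; rewrite arclen_ge0// andbT; apply: arclen_ub => // s ps ls.
by have := vsum_le g ps; lra.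
Qed.

Lemma arclen_dist g a b : 0 <= a -> 0 <= b ->
  enorm (g a - g b) <= `|arclen g a - arclen g b|.
Proof.
move=> a0 b0; have [ab|/ltW ba] := leP a b.
  rewrite enormB distrC ger0_norm ?arclen_increment//.
  by rewrite subr_ge0 arclen_mono.
by rewrite ger0_norm ?arclen_increment// subr_ge0 arclen_mono.
Qed.

Lemma arclen_lip g a b : 0 <= a -> 0 <= b ->
  `|arclen g a - arclen g b| <= `|a - b|.
Proof.
move=> a0 b0; have [ab|/ltW ba] := leP a b.
  rewrite distrC [leRHS]distrC !ger0_norm ?subr_ge0 ?arclen_mono//.
  exact: arclen_le_increment.
by rewrite !ger0_norm ?subr_ge0 ?arclen_mono// arclen_le_increment.
Qed.

Lemma vsum_continuous a s : continuous (fun g : curve R d => vsum (curve_fun g) a s).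
Proof.
elim: s a => [|b s IH] a g /=; first by apply: cst_continuous.
pose D (h : curve R d) := enorm (h b - h a).
have cD : D h @[h --> g] --> D g.
  apply: (@cvg_comp _ _ _ (fun h : curve R d => h b - h a)%R (@enorm R d) _
    (nbhs (curve_fun g b - curve_fun g a)%R)); last exact: enorm_continuous.
  exact: (cvgB (@curve_eval_continuous R d b g) (@curve_eval_continuous R d a g)).
exact: (cvgD cD (IH b g)).
Qed.

Lemma arclen_open a (c : R) : 0 <= a -> open [set g : curve R d | c < arclen g a].
Proof.
move=> a0.
rewrite (_ : mkset _ = \bigcup_(s in [set s | path <=%R 0 s /\ last 0 s <= a])
   [set g : curve R d | c < vsum (curve_fun g) 0 s]).
  apply: bigcup_open => s _.
  by move/continuousP: (@vsum_continuous 0 s) => /(_ [set x | c < x]); apply; exact: open_gt.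
apply/seteqP; split => [g /= cg|g [s [ps ls] /= cs]].
  have [_ [s [ps ls] <-] cs] := sup_gt (vsums_has_sup g a0).1 cg.
  by exists s.
exact: lt_le_trans (vsum_le_arclen g a0 ps ls).
Qed.

Local Open Scope ereal_scope.

Lemma wsum1 g a s : path <=%R a s -> wsum (cst 1) g a s = (vsum g a s)%:E.
Proof.
elim: s a => //= b s IH a /andP[ab /IH ->].
rewrite (_ : inf_along _ _ _ _ = 1) ?mul1e ?EFinD//.
rewrite /inf_along (_ : [set _ | t in _] = [set 1]) ?ereal_inf1//.
apply/seteqP; split => [_ [t _ <-]//|_ ->].
by exists a => //=; rewrite in_itv/= lexx.
Qed.

Lemma arclen_le_wlen g a : (0 <= a)%R -> (arclen g a)%:E <= wlen (cst 1) g.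
Proof.
move=> a0; have [w|] := leP (wlen (cst 1) g) (arclen g a)%:E; last exact: ltW.
have wf : wlen (cst 1) g \is a fin_num.
  by rewrite ge0_fin_numE; [exact: le_lt_trans w (ltry _)|exact: wlen_ge0].
rewrite -(fineK wf) lee_fin; apply: arclen_ub => // s ps ls.
by rewrite -lee_fin fineK// -wsum1//; exact: wsum_le_wlen.
Qed.

Lemma wlen1_gt g (c : R) : c%:E < wlen (cst 1) g ->
  exists2 a : R, (0 <= a)%R & (c < arclen g a)%R.
Proof.
move=> /ereal_sup_gt[_ [[a s] [/= a0 ps] <-]]; rewrite wsum1// lte_fin => cs.
have l0 : (0 <= last a s)%R by exact: le_trans (path_le_last ps).
exists (last a s) => //; apply: lt_le_trans cs _.
have := @vsum_le_arclen g (last a s) (a :: s) l0.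
rewrite /= a0 ps lexx => /(_ isT isT); have := enorm_ge0 (g a - g 0%R); lra.
Qed.

End arc_length.

(** * Curves tested at rational times *)

Section curve_cluster.
Context {R : realType} {d : nat}.
Local Notation E := 'rV[R]_d.

(** These are the nonnegative rationals: countably many evaluations that determine a curve. *)
Definition gridpt (p : nat * nat) : R := p.1%:R / p.2.+1%:R.

Lemma gridpt_ge0 p : 0 <= gridpt p. Proof. by rewrite divr_ge0. Qed.

Lemma gridpt_near (t : R) (n : nat) : 0 <= t ->
  gridpt (Num.truncn (t * n.+1%:R), n) <= t < gridpt (Num.truncn (t * n.+1%:R), n) + n.+1%:R^-1.
Proof.
move=> t0; have n0 : 0 < n.+1%:R :> R by rewrite ltr0n.
have /truncn_itv /andP[lo hi] : 0 <= t * n.+1%:R by rewrite mulr_ge0.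
rewrite /gridpt /= ler_pdivrMr// lo/= -[X in _ < _ + X]mul1r -mulrDl natr1.
by rewrite ltr_pdivlMr.
Qed.

Lemma harmonic_lt (e : R) : 0 < e -> exists n : nat, n.+1%:R^-1 < e.
Proof.
move=> e0; have [N _ NP] := near_infty_natSinv_lt (PosNum e0).
by exists N; exact: (NP N (leqnn N)).
Qed.

Lemma div_natS_lt (M e : R) : 0 < e -> exists n : nat, M / n.+1%:R < e.
Proof.
move=> e0; exists (Num.bound (M / e)).
rewrite ltr_pdivrMr ?ltr0n// mulrC -ltr_pdivrMr//.
have [M0|M0] := leP 0 (M / e).
  by apply: (lt_trans (archi_boundP M0)); rewrite ltr_nat.
exact: (lt_le_trans M0).
Qed.

Lemma curve_eq_grid (g h : curve R d) :
  (forall p, g (gridpt p) = h (gridpt p)) -> g = h.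
Proof.
move=> gh; apply: curve_eqP => t t0; apply/eqP; rewrite -subr_eq0.
apply/eqP/enorm_eq0/le_anti; rewrite enorm_ge0 andbT; apply/ler_addgt0Pr => e e0.
have e20 : 0 < e / 2 by rewrite divr_gt0.
have [n ne] := harmonic_lt e20.
have /andP[lo hi] := gridpt_near n t0.
move: lo hi ne; set p := (_, n); set q := n.+1%:R^-1; move=> lo hi ne.
have := enorm_triangle (g (gridpt p)) (g t) (h t).
have := curve_lip1 g t (gridpt p); have := curve_lip1 h (gridpt p) t.
rewrite -gh [X in _ <= X -> _]distrC !ger0_norm ?subr_ge0//.
lra.
Qed.

Lemma enorm_cluster (F : set_system (curve R d)) {FF : ProperFilter F}
    (g : curve R d) (t : R) (v : E) (e : R) : cluster F g ->
  F [set h | enorm (curve_fun h t - v) <= e] -> enorm (g t - v) <= e.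
Proof.
move=> clg Fe; apply/ler_addgt0Pr => r r0.
have nr : nbhs g [set h : curve R d | enorm (g t - curve_fun h t) < r].
  apply: (@curve_eval_continuous R d t g [set x | enorm (g t - x) < r]).
  by apply/nbhs_enormP; exists r.
have [h [/= he hr]] := clg _ _ Fe nr.
by have := enorm_triangle (curve_fun h t) (g t) v; lra.
Qed.

(** Compactness of [Gamma K] gives some cluster point, and pointwise convergence identifies it with
    [h]; no uniform estimate is required. *)
Lemma curve_cluster (K : set E) (h_ : nat -> curve R d) (h : curve R d) :
  compact K -> (forall n, Gamma K (h_ n)) ->
  (forall t e : R, 0 <= t -> 0 < e ->
     \forall n \near \oo, enorm (h_ n t - h t) <= e) ->
  cluster (h_ @ \oo) h.
Proof.
move=> cK hK hh.
have cG := Gamma_compact cK.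
have [|h' [_ clh']] := cG (h_ @ \oo) _.
  by apply: (@filterE _ \oo) => n /=; exact: hK.
suff -> : h = h' by [].
apply: curve_eqP => t t0; apply/eqP; rewrite eq_sym -subr_eq0.
apply/eqP/enorm_eq0/le_anti; rewrite enorm_ge0 andbT; apply/ler_addgt0Pr => e e0; rewrite add0r.
by apply: (enorm_cluster clh'); exact: hh.
Qed.

Lemma compact_net (H : set (curve R d)) (n : nat) : compact H ->
  exists l : seq (curve R d), (forall h, h \in l -> H h) /\
    forall g, H g -> exists2 h, h \in l &
      forall i j, (i < n)%N -> (j < n)%N ->
        enorm (curve_fun g (gridpt (i, j)) - curve_fun h (gridpt (i, j))) < n.+1%:R^-1.
Proof.
move=> cH.
pose near_ (g h : curve R d) := forall i j, (i < n)%N -> (j < n)%N ->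
  enorm (curve_fun g (gridpt (i, j)) - curve_fun h (gridpt (i, j))) < n.+1%:R^-1.
apply: (@compact_induction _ (fun S : set (curve R d) =>
  exists l : seq (curve R d), (forall h, h \in l -> H h) /\
    forall g, S g -> exists2 h, h \in l & near_ g h) _ cH).
- by exists [::].
- move=> A B [l1 [lH1 A1]] [l2 [lH2 B2]]; exists (l1 ++ l2); split.
    by move=> h; rewrite mem_cat => /orP[/lH1|/lH2].
  move=> g [/A1|/B2] [h hl gh]; exists h => //; rewrite mem_cat hl ?orbT//.
- move=> A B AB [l [lH Bl]]; exists l; split => // g /AB; exact: Bl.
- move=> h Hh; exists [set g | near_ g h]; last first.
    exists [:: h]; split=> [h'|g gh]; first by rewrite inE => /eqP ->.
    by exists h => //; rewrite inE.
  have : nbhs h (fun g => forall ij : 'I_n * 'I_n,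
     enorm (curve_fun g (gridpt (val ij.1, val ij.2)) -
            curve_fun h (gridpt (val ij.1, val ij.2))) < n.+1%:R^-1).
    apply: (@filter_forall _ _ (fun ij g => enorm (curve_fun g
      (gridpt (val ij.1, val ij.2)) - curve_fun h (gridpt (val ij.1, val ij.2))) < n.+1%:R^-1)
      (nbhs h)) => -[i j] /=.
    apply: (@curve_eval_continuous R d (gridpt (val i, val j)) h
      [set x | enorm (x - curve_fun h (gridpt (val i, val j))) < n.+1%:R^-1]).
    apply/nbhs_enormP; exists n.+1%:R^-1 => [|v]; first by rewrite invr_gt0 ltr0n.
    by rewrite /= enormB.
  by apply: filterS => g gH i j ilt jlt; exact: (gH (Ordinal ilt, Ordinal jlt)).
Qed.

(** Evaluations determine Borel sets of curves. On [D], the curve [rho x] is in [F] if and only if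
    for each [n] it is [1 / (n + 1)]-close, at the first [n * n] grid times, to an element of a
    finite net of the part of [F] in [Gamma K]. For the converse, the net elements chosen for all
    [n] cluster at a curve of [F] that agrees with [rho x] on the grid. *)
Lemma curve_measurable_preimage dT (T : measurableType dT) (D : set T)
    (rho : T -> curve R d) (K : set E) (F : set (curve R d)) :
  measurable D -> compact K -> (forall x, D x -> Gamma K (rho x)) ->
  (forall (t : R) (O : set E), 0 <= t -> open O ->
     measurable (D `&` [set x | O (rho x t)])) ->
  closed F -> measurable (D `&` rho @^-1` F).
Proof.
move=> mD cK rhoK mrho cF.
have cH : compact (F `&` Gamma K).
  apply: (subclosed_compact _ (Gamma_compact cK) (@subIsetr _ _ _)).
  apply: closedI => //; apply: Gamma_closed.
  exact: compact_closed (@rV_hausdorff R d) cK.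
have /choice[l lP] := fun n => compact_net n cH.
pose B n (h : curve R d) := D `&` \bigcap_(p in `I_n `*` `I_n)
  (D `&` [set x | enorm (rho x (gridpt p) - curve_fun h (gridpt p)) < n.+1%:R^-1]).
suff -> : D `&` rho @^-1` F = D `&` \bigcap_n (\big[setU/set0]_(h <- l n) B n h).
  apply: measurableI => //; apply: bigcapT_measurable => n.
  apply: bigsetU_measurable => h _; apply: measurableI => //.
  apply: fin_bigcap_measurable => [|p _]; first exact: finite_setX.
  apply: (mrho _ [set x | enorm (x - curve_fun h (gridpt p)) < n.+1%:R^-1]); first exact: gridpt_ge0.
  rewrite openE => v /= vlt; apply/nbhs_enormP.
  exists (n.+1%:R^-1 - enorm (v - curve_fun h (gridpt p))); first by rewrite subr_gt0.
  move=> u uv /=; apply: le_lt_trans (enorm_triangle v _ _) _.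
  by rewrite -ltrBrDr enormB.
apply/seteqP; split => [x [Dx Fx]|x [Dx Bx]]; split => //.
  move=> n _; have [_ /(_ (rho x) (conj Fx (rhoK x Dx)))[h hl nh]] := lP n.
  rewrite -bigcup_seq; exists h => //; split => // -[i j] [/= ilt jlt].
  by split => //; exact: nh.
have /choice[h_ hP] : forall n, exists h : curve R d, (F `&` Gamma K) h /\
    forall i j, (i < n)%N -> (j < n)%N ->
      enorm (rho x (gridpt (i, j)) - curve_fun h (gridpt (i, j))) < n.+1%:R^-1.
  move=> n; have := Bx n Logic.I; rewrite -bigcup_seq => -[h hl [_ Hh]].
  exists h; split; first exact: (lP n).1.
  by move=> i j ilt jlt; have [] := Hh (i, j) (conj ilt jlt).
have [|h [[Fh _] clh]] := cH (h_ @ \oo) _.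
  by apply: (@filterE _ \oo) => n /=; have [] := hP n.
change (F (rho x)); suff -> : rho x = h by [].
apply: curve_eq_grid => -[i j]; apply/eqP; rewrite eq_sym -subr_eq0.
apply/eqP/enorm_eq0/le_anti; rewrite enorm_ge0 andbT; apply/ler_addgt0Pr => e e0; rewrite add0r.
apply: (enorm_cluster clh).
have [N Ne] := harmonic_lt e0.
exists (maxn N (maxn i j).+1) => // n /=; rewrite geq_max => /andP[Nn ijn].
rewrite enormB; have [_ H] := hP n.
have /H{}H : (i < n)%N by apply: leq_ltn_trans ijn; exact: leq_maxl.
have /H{}H : (j < n)%N by apply: leq_ltn_trans ijn; exact: leq_maxr.
apply/ltW/(lt_trans H)/(le_lt_trans _ Ne).
by rewrite lef_pV2 ?posrE ?ltr0n// ler_nat.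
Qed.

End curve_cluster.

Section reparametrization.
Context {R : realType} {d : nat}.
Local Notation E := 'rV[R]_d.
Variables (K : set E) (cK : compact K).
Implicit Types (g : curve R d).

Definition rectifiable : set (curve R d) :=
  [set g | Gamma K g /\ (wlen (cst 1%E) (curve_fun g) < +oo)%E].

Definition total_len g : R := fine (wlen (cst 1%E) g).

(* [p] is the point of [g] at arc length [u]. The inequalities are closed
   conditions, so that they still characterize the endpoint [lim g], which [g]
   need not attain. *)
Definition at_arclen g (u : R) (p : E) :=
  K p /\ forall a, 0 <= a -> enorm (g a - p) <= `|arclen g a - u|.

(* Arc length parametrization; by convention a curve which is not rectifiable is
   left unchanged. *)
Definition reparam g : curve R d :=
  xget g [set h : curve R d | rectifiable g /\
    forall s, 0 <= s -> at_arclen g (Num.min s (total_len g)) (curve_fun h s)].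

Lemma wlen1_fin g : rectifiable g -> wlen (cst 1%E) g = (total_len g)%:E.
Proof.
by move=> [_ gl]; rewrite /total_len fineK// ge0_fin_numE// wlen_ge0.
Qed.

Lemma arclen_le_total g a : rectifiable g -> 0 <= a -> arclen g a <= total_len g.
Proof. by move=> rg a0; rewrite -lee_fin -wlen1_fin// arclen_le_wlen. Qed.

Lemma total_len_ge0 g : 0 <= total_len g.
Proof. by rewrite fine_ge0// wlen_ge0. Qed.

Lemma arclen_gt g u : rectifiable g -> u < total_len g ->
  exists2 a, 0 <= a & u < arclen g a.
Proof. by move=> rg ut; apply: wlen1_gt; rewrite wlen1_fin// lte_fin. Qed.

Lemma arclen_dense g u e : rectifiable g -> 0 <= u <= total_len g -> 0 < e ->
  exists p, `|arclen g (gridpt p) - u| < e.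
Proof.
move=> rg /andP[u0 ut] e0; have [n ne] := harmonic_lt e0.
have [a a0 ua] : exists2 a, 0 <= a & u - e < arclen g a.
  by apply: arclen_gt => //; apply: lt_le_trans ut; rewrite ltrBlDr ltrDl.
have step k : gridpt (k.+1, n) = gridpt (k, n) + n.+1%:R^-1 :> R.
  by rewrite /gridpt /= -natr1 mulrDl mul1r.
have exk : exists k, u - e < arclen g (gridpt (k, n)).
  have /andP[_ hi] := gridpt_near n a0.
  exists (Num.truncn (a * n.+1%:R)).+1; rewrite step.
  by apply: (lt_le_trans ua); apply: arclen_mono => //; exact: ltW.
(* At the first grid time whose arc length exceeds [u - e], one step of size less than [e] has been
   made from a value at most [u - e]. *)
case: (ex_minnP exk) => k uk kmin; exists (k, n).
rewrite ltr_norml; apply/andP; split; first by lra.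
case: k => [|k] in uk kmin *.
  by rewrite /gridpt /= mul0r arclen0; lra.
have : arclen g (gridpt (k, n)) <= u - e.
  by rewrite leNgt; apply/negP => /kmin; rewrite ltnn.
have k0 := @gridpt_ge0 R (k, n).
have := @arclen_le_increment _ _ g (gridpt (k, n)) (gridpt (k.+1, n)) k0.
rewrite step lerDl invr_ge0 ler0n addrAC subrr add0r => /(_ isT).
move: ne; set q := n.+1%:R^-1; lra.
Qed.

(** A cluster point, in the compact [K], of values of [g] at times whose arc lengths tend to [u].
    This covers [u = total_len g] even if that length is not attained in finite time. *)
Lemma at_arclen_exists g u : rectifiable g -> 0 <= u <= total_len g ->
  exists p, at_arclen g u p.
Proof.
move=> rg u0t.
have /choice[p_ pP] : forall n : nat, exists p,
    `|arclen g (gridpt p) - u| < n.+1%:R^-1.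
  by move=> n; apply: arclen_dense => //; rewrite invr_gt0 ltr0n.
have cK' := cK; have [|p [Kp clp]] := cK' ((fun n => g (gridpt (p_ n))) @ \oo) _.
  by apply: (@filterE _ \oo) => n /=; apply: (proj1 rg); exact: gridpt_ge0.
exists p; split => // a a0; apply/ler_addgt0Pr => e e0.
have e20 : 0 < e / 2 by rewrite divr_gt0.
have np : nbhs p [set x | enorm (p - x) < e / 2] by apply/nbhs_enormP; exists (e / 2).
have [N _ NP] := near_infty_natSinv_lt (PosNum e20).
have FN : ((fun n => g (gridpt (p_ n))) @ \oo)
    [set x | enorm (g a - x) <= `|arclen g a - u| + e / 2].
  exists N => // n Nn /=.
  apply: le_trans (arclen_dist g a0 (gridpt_ge0 _)) _.
  apply: le_trans (ler_distD u _ _) _; rewrite lerD2l distrC.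
  exact/ltW/(lt_trans (pP n))/(NP n Nn).
have [x [/= x1 x2]] := clp _ _ FN np.
have := enorm_triangle x (g a) p; rewrite (enormB x p); lra.
Qed.

(** Both points are compared with [g] at a grid time of arc length close to [u]. The bound gives
    uniqueness ([u = u']) as well as the Lipschitz property of the parametrization. *)
Lemma at_arclen_dist g u u' p p' : rectifiable g ->
  0 <= u <= total_len g -> at_arclen g u p -> at_arclen g u' p' ->
  enorm (p - p') <= `|u - u'|.
Proof.
move=> rg u0t [_ gp] [_ gp']; apply/ler_addgt0Pr => e e0.
have e20 : 0 < e / 2 by rewrite divr_gt0.
have [q qe] := arclen_dense rg u0t e20.
have q0 := @gridpt_ge0 R q.
have h1 := gp _ q0; have h2 := gp' _ q0.
have h3 := enorm_triangle (g (gridpt q)) p p'; rewrite (enormB p (g (gridpt q))) in h3.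
have := ler_distD u (arclen g (gridpt q)) u'; lra.
Qed.

Lemma min_total g s : 0 <= s -> 0 <= Num.min s (total_len g) <= total_len g.
Proof. by move=> s0; rewrite le_min s0 total_len_ge0 ge_min lexx orbT. Qed.

Lemma reparamP g s : rectifiable g -> 0 <= s ->
  at_arclen g (Num.min s (total_len g)) (reparam g s).
Proof.
move=> rg s0; rewrite /reparam; case: xgetP => [h _ [_ H]|nH]; first exact: H.
exfalso.
have /choice[f fP] : forall s : R, exists p, 0 <= s ->
    at_arclen g (Num.min s (total_len g)) p.
  move=> t; have [t0|t0] := leP 0 t; last by exists 0.
  by have [p] := at_arclen_exists rg (min_total g t0); exists p.
have [t t' t0 t'0|h hf] := @curve_of_lip R d f.
  apply: le_trans (at_arclen_dist rg (min_total g t0) (fP _ t0) (fP _ t'0)) _.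
  have h1 := ler_norm (t - t'); have := ler_norm (t' - t); rewrite distrC => h2.
  rewrite ler_norml; case: (leP t (total_len g)) => ?; case: (leP t' (total_len g)) => ?; lra.
apply: (nH h); split => // t t0; rewrite hf//; exact: fP.
Qed.

Lemma reparam_id g : ~ rectifiable g -> reparam g = g.
Proof. by move=> ng; rewrite /reparam; case: xgetP => // h _ [/ng]. Qed.

Lemma reparam_unique g s p : rectifiable g -> 0 <= s ->
  at_arclen g (Num.min s (total_len g)) p -> reparam g s = p.
Proof.
move=> rg s0 gp; apply/eqP; rewrite -subr_eq0; apply/eqP/enorm_eq0/le_anti.
rewrite enorm_ge0 andbT.
have := at_arclen_dist rg (min_total g s0) (reparamP rg s0) gp.
by rewrite subrr normr0.
Qed.

Lemma reparam_arclen g a : rectifiable g -> 0 <= a ->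
  reparam g (arclen g a) = g a.
Proof.
move=> rg a0; apply: reparam_unique => //; first exact: arclen_ge0.
rewrite min_l ?arclen_le_total//; split; first exact: (proj1 rg).
by move=> b b0; exact: arclen_dist.
Qed.

Lemma reparam_Gamma g : rectifiable g -> Gamma K (reparam g).
Proof. by move=> rg s s0; exact: (proj1 (reparamP rg s0)). Qed.

Lemma reparam_start g : rectifiable g -> reparam g 0 = g 0.
Proof. by move=> rg; rewrite -[in LHS](arclen0 g) reparam_arclen. Qed.

Lemma reparam_stop g s : rectifiable g -> total_len g <= s ->
  reparam g s = reparam g (total_len g).
Proof.
move=> rg ls; have t0 := total_len_ge0 g.
apply: reparam_unique => //; first exact: le_trans ls.
by rewrite min_r//; have := reparamP rg t0; rewrite min_l.
Qed.

Lemma reparam_cvg g : rectifiable g ->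
  g t @[t --> +oo] --> reparam g (total_len g).
Proof.
move=> rg A /nbhs_enormP[e e0 eA].
have [a a0 ea] : exists2 a, 0 <= a & total_len g - e < arclen g a.
  by apply: arclen_gt => //; rewrite ltrBlDr ltrDl.
have t0 := total_len_ge0 g.
have [_ H] := reparamP rg t0; rewrite min_l// in H.
exists a; split; first exact: num_real.
move=> t at_; apply: eA; rewrite enormB.
have tt0 : 0 <= t by exact: le_trans (ltW at_).
apply: le_lt_trans (H _ tt0) _.
rewrite distrC ger0_norm ?subr_ge0 ?arclen_le_total//.
by have := arclen_mono g a0 (ltW at_); lra.
Qed.

Lemma pioo_reparam g : rectifiable g -> pioo (reparam g) = pioo g.
Proof.
move=> rg; rewrite /pioo (cvg_lim _ (reparam_cvg rg)); last exact: rV_hausdorff.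
apply: cvg_lim; first exact: rV_hausdorff.
move=> A nA; exists (total_len g); split; first exact: num_real.
move=> t tt; apply: (nbhs_singleton (A := A)).
by rewrite reparam_stop// ltW.
Qed.

End reparametrization.

Section reparam_wlen.
Context {R : realType} {d : nat}.
Local Notation E := 'rV[R]_d.
Variables (K : set E) (cK : compact K).
Variables (w : E -> \bar R) (w0 : forall x, (0 <= w x)%E).
Hypothesis w_open : forall c : R, open [set x | (c%:E < w x)%E].
Variable g : curve R d.
Hypothesis rg : rectifiable K g.

Lemma arclen_IVT (a b v : R) : 0 <= a -> a <= b -> arclen g a <= v <= arclen g b ->
  exists c, [/\ a <= c, c <= b & arclen g c = v].
Proof.
move=> a0 ab /andP[av vb].
pose f (t : R) := arclen g (Num.max t 0).
have f_id t : 0 <= t -> f t = arclen g t by move=> t0; rewrite /f max_l.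
have cf : continuous f.
  move=> t A /nbhs_ballP[e /= e0 eA]; apply/nbhs_ballP; exists e => // s ts.
  apply: eA; apply: le_lt_trans ts.
  apply: le_trans (arclen_lip _ _ _) _; try by rewrite le_max lexx orbT.
  have h1 := ler_norm (t - s); have := ler_norm (s - t); rewrite distrC => h2.
  by rewrite ler_norml; case: (leP t 0) => ?; case: (leP s 0) => ?; lra.
have [|c] := @IVT R f a b v ab (continuous_subspaceT cf).
  rewrite !f_id//; last exact: le_trans ab.
  by rewrite ge_min av le_max vb orbT.
rewrite in_itv/= => /andP[ac cb] fc; exists c; split => //.
by rewrite -f_id//; exact: le_trans ac.
Qed.

(** The partition of the arc length axis is pulled back to times of [g] by the intermediate value
    theorem. Increments are unchanged, and [h] on [[s, s']] runs through all of [g] on [[a, a']], so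
    its infimum of [w] is no larger. Truncation at [arclen g k] keeps every arc length attained. *)
Lemma reparam_wsum_le (k : R) (h : curve R d) (a s : R) (l : seq R) :
  0 <= k -> 0 <= s -> 0 <= a -> a <= k ->
  (forall t, 0 <= t -> h t = reparam K g (Num.min t (arclen g k))) ->
  arclen g a = Num.min s (arclen g k) -> path <=%R s l ->
  exists2 l', path <=%R a l' & (wsum w h s l <= wsum w g a l')%E.
Proof.
move=> k0; elim: l s a => [|s' l IH] s a s0 a0 ak hE sa /=; first by exists [::].
move=> /andP[ss' sl].
have s'0 : 0 <= s' by exact: le_trans ss'.
have [|a' [aa' a'k s'a']] := @arclen_IVT a k (Num.min s' (arclen g k)) a0 ak.
  rewrite sa; apply/andP; split; last by rewrite ge_min lexx orbT.
  by rewrite le_min !ge_min ss' lexx !orbT.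
have a'0 : 0 <= a' by exact: le_trans aa'.
have [l' pl' le'] := IH s' a' s'0 a'0 a'k hE s'a' sl.
exists (a' :: l'); first by rewrite /= aa'.
rewrite /=; apply: leeD => //.
have hg t u : 0 <= t -> 0 <= u -> arclen g u = Num.min t (arclen g k) -> h t = g u.
  by move=> t0 u0 E1; rewrite hE// -E1 (reparam_arclen cK).
rewrite (hg s a)// (hg s' a')//; apply: lee_wpmul2r.
  by rewrite lee_fin enorm_ge0.
apply: le_ereal_inf_tmp => _ [t + <-]; rewrite /= in_itv/= => /andP[at_ ta'].
have t0 : 0 <= t by exact: le_trans at_.
have lt1 := arclen_mono g a0 at_; have lt2 := arclen_mono g t0 ta'.
have lt3 := arclen_mono g t0 (le_trans ta' a'k).
apply: ereal_inf_lbound.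
(* If [arclen g t <= s], then [g] has no length between [a] and [t], so [g t] is already the value
   of [h] at [s]. *)
have [ts|st] := leP (arclen g t) s.
  exists s; first by rewrite /= in_itv/= lexx.
  congr w; apply: hg => //; apply/le_anti; rewrite -sa lt1 andbT.
  by rewrite sa le_min ts lt3.
exists (arclen g t).
  rewrite /= in_itv/= (ltW st)/=; apply: (le_trans lt2); rewrite s'a'.
  by rewrite ge_min lexx.
congr w; apply: hg => //; first exact: arclen_ge0.
by rewrite min_l.
Qed.

(* The curves [reparam K g] stopped at arc length [arclen g k] only use the part
   of [g] up to time [k], and converge to [reparam K g] as [k] tends to [+oo]. *)
Lemma reparam_wlen_le : (wlen w (reparam K g) <= wlen w g)%E.
Proof.
rewrite leNgt; apply/negP => lt_.
have [c cg ch] : exists2 c : R, (wlen w g <= c%:E)%E & (c%:E < wlen w (reparam K g))%E.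
  have gf : wlen w g \is a fin_num.
    rewrite ge0_fin_numE ?wlen_ge0//; exact: lt_le_trans lt_ (leey _).
  by exists (fine (wlen w g)); rewrite fineK.
have /choice[h_ hE] : forall k : nat, exists h : curve R d,
    forall t, 0 <= t -> h t = reparam K g (Num.min t (arclen g k%:R)).
  move=> k; apply: curve_of_lip => s t s0 t0.
  apply: le_trans (curve_lip1 _ _ _) _.
  have h1 := ler_norm (s - t); have := ler_norm (t - s); rewrite distrC => h2.
  by rewrite ler_norml; case: (leP s (arclen g k%:R)) => ?; case: (leP t (arclen g k%:R)) => ?; lra.
have min0 t k : 0 <= t -> 0 <= Num.min t (arclen g k%:R).
  by move=> t0; rewrite le_min t0 arclen_ge0.
have clh : cluster (h_ @ \oo) (reparam K g).
  apply: (curve_cluster cK) => [k t t0|t e t0 e0].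
    by rewrite hE//; apply: (reparam_Gamma cK) => //; exact: min0.
  have [a a0 ea] : exists2 a, 0 <= a & total_len g - e < arclen g a.
    by apply: (arclen_gt rg); rewrite ltrBlDr ltrDl.
  exists (Num.bound a) => // k /= ak; rewrite hE//.
  have ak' : a <= k%:R.
    by apply: ltW; apply: (lt_le_trans (archi_boundP a0)); rewrite ler_nat.
  have h1 := arclen_mono g a0 ak'.
  have h2 := arclen_le_total rg (ler0n R k).
  have [tk|kt] := leP t (arclen g k%:R).
    by rewrite subrr enorm0 ltW.
  have -> : reparam K g t = reparam K g (Num.min t (total_len g)).
    have [//|tt] := leP t (total_len g).
    by rewrite (reparam_stop cK rg (ltW tt)).
  apply: le_trans (curve_lip1 _ _ _) _.
  by rewrite ler_norml; case: (leP t (total_len g)) => ?; lra.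
have nh : nbhs (reparam K g) [set h : curve R d | (c%:E < wlen w (curve_fun h))%E].
  by apply: open_nbhs_nbhs; split => //; exact: wlen_open.
have Fr : (h_ @ \oo) (range h_) by apply: (@filterE _ \oo) => k /=; exists k.
have [_ [[k _ <-] /= ck]] := clh _ _ Fr nh.
have [_ [[s l] [/= s0 sl] <-] cs] := ereal_sup_gt ck.
have k0 := ler0n R k.
have [|a [a0 ak aE]] := @arclen_IVT 0 k%:R (Num.min s (arclen g k%:R)) (lexx 0) k0.
  by rewrite arclen0 min0//= ge_min lexx orbT.
have [l' pl' le'] := reparam_wsum_le k0 s0 a0 ak (hE k) aE sl.
have := lt_le_trans cs (le_trans le' (le_trans (wsum_le_wlen w g a0 pl') cg)).
by rewrite ltxx.
Qed.

End reparam_wlen.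

Section reparam_measurable.
Context {R : realType} {d : nat}.
Local Notation E := 'rV[R]_d.
Variables (K : set E) (cK : compact K).

Lemma arclen_measurable (a : R) : 0 <= a ->
  measurable_fun setT (fun g : curve R d => arclen g a).
Proof.
move=> a0; apply/measurable_EFinP; apply: measurable_gt_sets => c.
by apply: open_borel; exact: arclen_open.
Qed.

Lemma open_gt_cst (c : R) : open [set x : E | (c%:E < cst 1 x)%E].
Proof.
have [c1|c1] := ltP c%:E 1%E.
  by rewrite (_ : mkset _ = setT); [exact: openT|apply/seteqP; split].
rewrite (_ : mkset _ = set0); first exact: open0.
by apply/seteqP; split => // x /= /lt_le_trans/(_ c1); rewrite ltxx.
Qed.

Lemma wlen_measurable (w : E -> \bar R) : (forall x, 0 <= w x)%E ->
  (forall c : R, open [set x | (c%:E < w x)%E]) ->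
  measurable_fun setT (fun g : curve R d => wlen w g).
Proof.
move=> w0 ow; apply: measurable_gt_sets => c.
by apply: open_borel; exact: wlen_open.
Qed.

Lemma wlen1_measurable : measurable_fun setT (fun g : curve R d => wlen (cst 1%E) g).
Proof. by apply: wlen_measurable => // c; exact: open_gt_cst. Qed.

Lemma total_len_measurable : measurable_fun setT (@total_len R d).
Proof. exact: measurableT_comp wlen1_measurable. Qed.

Lemma Gamma_measurable : measurable (Gamma K : set (curve R d)).
Proof.
apply: closed_borel; apply: Gamma_closed.
exact: compact_closed (@rV_hausdorff R d) cK.
Qed.

Lemma rectifiable_measurable : measurable (rectifiable K).
Proof.
apply: measurableI; first exact: Gamma_measurable.
rewrite -[X in measurable X]setTI.
by apply: emeasurable_fun_infty_o => //; exact: wlen1_measurable.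
Qed.

(** The point of arc length [min t (total_len g)] is within [1 / (n + 1)] of [g] at any grid time
    whose arc length is that close. Hence it lies in [O] if and only if, for some [n], such a grid
    time has its value well inside [O]: a countable condition on measurable functions of [g]. *)
Lemma reparam_eval_measurable (t : R) (O : set E) : 0 <= t -> open O ->
  measurable (rectifiable K `&` [set g | O (reparam K g t)]).
Proof.
move=> t0 oO.
(* The interior of [C n] is used in [B] so that the condition on [g] is open. *)
pose C n : set E := [set x | forall y, enorm (x - y) < n.+1%:R^-1 -> O y].
pose B (q : nat * nat) (n : nat) : set (curve R d) :=
  [set g | `|arclen g (gridpt q) - Num.min t (total_len g)| < n.+1%:R^-1] `&`
  [set g | (C n)^° (curve_fun g (gridpt q))].
have -> : rectifiable K `&` [set g | O (reparam K g t)] =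
    rectifiable K `&` \bigcup_n \bigcup_i \bigcup_j B (i, j) n.
  apply/seteqP; split => g [rg Hg]; split => //.
    have /nbhs_enormP[e e0 eO] : nbhs (reparam K g t) O.
      exact: open_nbhs_nbhs.
    have e20 : 0 < e / 2 by rewrite divr_gt0.
    have [n ne] := harmonic_lt e20.
    have n0 : 0 < n.+1%:R^-1 :> R by rewrite invr_gt0 ltr0n.
    have [[i j] ijE] := arclen_dense rg (min_total g t0) n0.
    exists n => //; exists i => //; exists j => //; split => //=.
    have [_ H] := reparamP cK rg t0.
    have {}H := H _ (gridpt_ge0 (i, j)).
    apply/nbhs_enormP; exists (e / 2 - enorm (g (gridpt (i, j)) - reparam K g t)).
      by rewrite subr_gt0; apply: le_lt_trans H (lt_trans ijE ne).
    move=> x xg y xy; apply: eO.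
    have := enorm_triangle x (reparam K g t) y.
    have := enorm_triangle (g (gridpt (i, j))) (reparam K g t) x.
    rewrite (enormB (reparam K g t) (g (gridpt (i, j)))).
    move: ne xy; set q := n.+1%:R^-1; lra.
  have [n _ [i _ [j _ [/= lt_ /interior_subset CO]]]] := Hg.
  apply: CO; apply: le_lt_trans lt_.
  by have [_ H] := reparamP cK rg t0; exact: H (gridpt_ge0 (i, j)).
apply: measurableI; first exact: rectifiable_measurable.
apply: bigcupT_measurable => n; apply: bigcupT_measurable => i.
apply: bigcupT_measurable => j; apply: measurableI; last first.
  by apply: open_borel; apply: curve_eval_open; exact: open_interior.
pose f (g : curve R d) := arclen g (gridpt (i, j)) - Num.min t (total_len g).
have mf : measurable_fun setT f.
  apply: measurable_funB; first by apply: arclen_measurable; exact: gridpt_ge0.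
  by apply: measurable_minr; [exact: measurable_cst|exact: total_len_measurable].
have := mf measurableT _ (measurable_ball (0 : R) (n.+1%:R^-1)).
rewrite setTI; congr (measurable _); apply/seteqP.
by split => g /=; rewrite /ball/= sub0r normrN.
Qed.

Lemma reparam_measurable : measurable_fun setT (reparam K).
Proof.
have key (F : set (curve R d)) : closed F -> measurable (reparam K @^-1` F).
  move=> cF.
  have -> : reparam K @^-1` F =
      (rectifiable K `&` reparam K @^-1` F) `|` (F `&` ~` rectifiable K).
    apply/seteqP; split => g /=.
      have [rg|ng] := pselect (rectifiable K g); first by left.
      by rewrite reparam_id//; right.
    by move=> [[]//|[Fg ng]]; rewrite reparam_id.
  apply: measurableU; last first.
    apply: measurableI; first exact: closed_borel.
    by apply: measurableC; exact: rectifiable_measurable.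
  apply: (curve_measurable_preimage rectifiable_measurable cK) => //.
    by move=> g rg; exact: reparam_Gamma.
  by move=> t O t0 oO; exact: reparam_eval_measurable.
apply: (@measurability _ _ _ _ _ _ (@open (curve R d))) => //.
move=> _ [G oG <-]; rewrite setTI -[X in measurable X]setCK.
apply: measurableC; rewrite preimage_setC; apply: key; exact: open_closedC.
Qed.

End reparam_measurable.

(** * Multiplicity *)

Section mpow_facts.
Context {R : realType}.
Variable alpha : R.
Hypothesis alpha01 : 0 <= alpha <= 1.
Local Open Scope ereal_scope.

Lemma mpow1E (m : \bar R) : alpha = 1%R -> mpow alpha m = 1.
Proof. by move=> ->; rewrite /mpow ltxx andbF subrr poweRe0. Qed.

Lemma mpow0E : (alpha < 1)%R -> mpow alpha 0 = +oo.
Proof. by move=> a1; rewrite /mpow eqxx a1. Qed.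

Lemma mpowE (m : R) : (0 < m)%R ->
  mpow alpha m%:E = ((m `^ (1 - alpha))^-1)%:E.
Proof.
by move=> m0; rewrite /mpow eqe gt_eqF//= -opprB powRN.
Qed.

Lemma mpow_ge0 (m : \bar R) : 0 <= m -> 0 <= mpow alpha m.
Proof. by move=> m0; rewrite /mpow; case: ifP => // _; exact: poweR_ge0. Qed.

Lemma mpow_anti (m1 m2 : \bar R) : 0 <= m1 -> m1 <= m2 -> m2 <= 1 ->
  mpow alpha m2 <= mpow alpha m1.
Proof.
move: alpha01 => /andP[a0]; rewrite le_eqVlt => /predU1P[a1|a1].
  by move=> _ _ _; rewrite !mpow1E.
move: m1 m2 => [m1| |] [m2| |] //; rewrite ?lee_fin//.
rewrite le_eqVlt => /predU1P[<- _ _|m10 m12 _]; first by rewrite mpow0E// leey.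
have m20 : (0 < m2)%R by exact: lt_le_trans m12.
rewrite !mpowE// lee_fin lef_pV2 ?posrE ?powR_gt0//.
by apply: ge0_ler_powR => //; rewrite ?nnegrE ?subr_ge0; exact: ltW.
Qed.

Lemma mpow_ge1 (m : \bar R) : 0 <= m -> m <= 1 -> 1 <= mpow alpha m.
Proof.
move=> m0 m1; apply: le_trans (mpow_anti m0 m1 (lexx _)).
by rewrite mpowE// powR1 invr1.
Qed.

Lemma mpow_lsc (m0 : \bar R) (c : R) : 0 <= m0 -> m0 <= 1 -> c%:E < mpow alpha m0 ->
  exists2 s : R, m0 < s%:E & forall m, 0 <= m -> m < s%:E -> c%:E < mpow alpha m.
Proof.
move: m0 => [m0| |] //; rewrite ?lee_fin// => m00 m01 cm.
move: alpha01 => /andP[a0]; rewrite le_eqVlt => /predU1P[a1|a1].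
  exists (m0 + 1)%R; first by rewrite lte_fin ltrDl.
  by move=> m _ _; move: cm; rewrite !mpow1E.
have b0 : (0 < 1 - alpha)%R by rewrite subr_gt0.
have mpow_gt0 (m : R) : (0 <= m)%R -> 0 < mpow alpha m%:E.
  rewrite le_eqVlt => /predU1P[<-|m_gt0]; first by rewrite mpow0E.
  by rewrite mpowE// lte_fin invr_gt0 powR_gt0.
have [c0|c0] := leP c 0%R.
  exists (m0 + 1)%R; first by rewrite lte_fin ltrDl.
  move=> [m| |] //; rewrite ?lee_fin// => mge _.
  by apply: le_lt_trans (mpow_gt0 m mge); rewrite lee_fin.
(* The solution of [s^(alpha - 1) = c]; the power is decreasing, so it exceeds [c] exactly below
   [s]. *)
pose s := (c `^ (- (1 - alpha)^-1))%R.
have s0 : (0 < s)%R by rewrite powR_gt0.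
have sE : (s `^ (1 - alpha) = c^-1)%R.
  by rewrite /s -powRrM mulNr mulVf ?gt_eqF// powRN powRr1// ltW.
exists s.
  rewrite lte_fin ltNge; apply/negP => sm.
  have m0p : (0 < m0)%R by exact: lt_le_trans sm.
  move: cm; rewrite mpowE// lte_fin ltNge => /negP; apply.
  rewrite -(invrK c) -sE lef_pV2 ?posrE ?powR_gt0//.
  by apply: ge0_ler_powR => //; rewrite ?nnegrE; exact: ltW.
move=> [m| |] //; rewrite ?lee_fin ?lte_fin//.
rewrite le_eqVlt => /predU1P[<- _|m_gt0 ms]; first by rewrite mpow0E// ltry.
rewrite mpowE// lte_fin -[ltLHS]invrK -sE ltf_pV2 ?posrE ?powR_gt0//.
by apply: gt0_ltr_powR; rewrite ?nnegrE ?ltW.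
Qed.

End mpow_facts.

Section multiplicity_usc.
Context {R : realType} {d : nat}.
Local Notation E := 'rV[R]_d.
Variables (K : set E) (cK : compact K).
Local Open Scope ereal_scope.
Implicit Types (eta : probability (curve R d) R).

Definition stopped_at (k : R) : set (curve R d) :=
  [set g | forall t, (k <= t)%R -> curve_fun g t = curve_fun g k].

(** The bounded time window and the large inequality make this set closed, whereas the set of curves
    through [x] is only a countable union of such sets. *)
Definition hits (x : E) (r k : R) : set (curve R d) :=
  [set g | Gamma K g /\ exists2 t, (0 <= t <= k)%R & (enorm (curve_fun g t - x) <= r)%R].

Lemma stopped_at_closed k : closed (stopped_at k).
Proof.
rewrite (_ : stopped_at k = \bigcap_(t in [set t : R | (k <= t)%R])
   ((fun g : curve R d => enorm (curve_fun g t - curve_fun g k)) @^-1` [set x | (x <= 0)%R])).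
  apply: closed_bigI => t _.
  apply: ((continuous_closedP _).1 _ _ (@closed_le R 0%R)) => g.
  apply: (@cvg_comp _ _ _ (fun h : curve R d => curve_fun h t - curve_fun h k)%R (@enorm R d) _
    (nbhs (curve_fun g t - curve_fun g k)%R)); last exact: enorm_continuous.
  exact: (cvgB (@curve_eval_continuous R d t g) (@curve_eval_continuous R d k g)).
apply/seteqP; split => g H t kt; first by rewrite /= H// subrr enorm0.
apply/eqP; rewrite -subr_eq0; apply/eqP/enorm_eq0/le_anti.
by rewrite enorm_ge0 andbT; exact: (H t kt).
Qed.

Lemma segment_in_open (k : R) (G : set E) : open G ->
  open [set g : curve R d | forall t, (0 <= t <= k)%R -> G (curve_fun g t)].
Proof.
move=> oG; rewrite openE => g gG.
have cov (t : R) : `[0%R, k]%classic t ->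
    \forall t' \near t & h \near nbhs g, G (curve_fun h t').
  rewrite /= in_itv/= => tk.
  by apply: near_eval; apply: open_nbhs_nbhs; split => //; exact: gG.
have FF : Filter (nbhs g) by exact: nbhs_filter.
have := (compact_near_coveringP _).1 (@segment_compact R 0%R k) _ (nbhs g)
  (fun (h : curve R d) t => G (curve_fun h t)) FF cov.
by apply: filterS => h hG t tk; apply: hG; rewrite /= in_itv.
Qed.

Lemma hits_closed x r k : closed (hits x r k).
Proof.
apply: closedI.
  apply: Gamma_closed; exact: compact_closed (@rV_hausdorff R d) cK.
rewrite -[X in closed X]setCK; apply: open_closedC.
rewrite (_ : ~` _ = [set g : curve R d | forall t, (0 <= t <= k)%R ->
   (r < enorm (curve_fun g t - x))%R]).
  apply: (@segment_in_open k [set v | (r < enorm (v - x))%R]).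
  rewrite openE => v /= rv; apply/nbhs_enormP; exists (enorm (v - x) - r)%R.
    by rewrite subr_gt0.
  move=> u uv /=; have := enorm_triangle u v x; lra.
apply/seteqP; split => g /= H.
  by move=> t tk; rewrite ltNge; apply/negP => le; apply: H; exists t.
by move=> [t /H]; rewrite ltNge => /negP.
Qed.

(** A curve avoiding [x] on the compact window [[0, k]] stays at a positive distance from it
    there. *)
Lemma hits_bigcap x k : \bigcap_n hits x n.+1%:R^-1%R k = hits x 0%R k.
Proof.
apply/seteqP; split => [g H|g [Kg [t tk tx]] n _]; last first.
  by split => //; exists t => //; apply: le_trans tx _; rewrite invr_ge0.
have [Kg _] := H 0%N Logic.I; split => //.
apply: contrapT => nt.
have cov (t : R) : `[0%R, k]%classic t -> \forall t' \near t & n \near \oo,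
    (n.+1%:R^-1 < enorm (curve_fun g t' - x))%R.
  rewrite /= in_itv/= => tk.
  pose e := enorm (g t - x).
  have e0 : (0 < e)%R.
    by rewrite ltNge; apply/negP => e0; apply: nt; exists t.
  have e20 : (0 < e / 2)%R by rewrite divr_gt0.
  have [N _ NP] := near_infty_natSinv_lt (PosNum e20).
  exists (ball t (e / 2)%R, [set n | (N <= n)%N]).
    by split => /=; [exact: nbhsx_ballx|exists N].
  move=> [t' n] [/= tt' /NP/= ne].
  have h1 := le_lt_trans (curve_lip1 g t t') tt'.
  have h2 := enorm_triangle (g t') (g t) x; rewrite -/e in h2.
  move: ne h1 h2; move: n.+1%:R^-1%R => a; lra.
have [N _ NP] := (compact_near_coveringP _).1 (@segment_compact R 0%R k) _ \oo _ _ cov.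
have [_ [t tk le]] := H N Logic.I.
have := NP N (leqnn N) t; rewrite /= in_itv/= => /(_ tk).
by rewrite ltNge le.
Qed.

Lemma hits_measurable x r k : measurable (hits x r k).
Proof. by apply: closed_borel; exact: hits_closed. Qed.

Lemma visitsE x :
  [set g : curve R d | Gamma K g /\ exists2 t : R, (0 <= t)%R & g t = x] =
  \bigcup_n hits x 0%R n%:R.
Proof.
apply/seteqP; split => [g [Kg [t t0 gt]]|g [n _ [Kg [t /andP[t0 _] le]]]].
  exists (Num.bound t) => //; split => //; exists t.
    by rewrite t0 ltW// archi_boundP.
  by rewrite gt subrr enorm0.
split => //; exists t => //; apply/eqP; rewrite -subr_eq0.
by apply/eqP/enorm_eq0/le_anti; rewrite enorm_ge0 andbT.
Qed.

Lemma visits_measurable x :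
  measurable [set g : curve R d | Gamma K g /\ exists2 t : R, (0 <= t)%R & g t = x].
Proof. by rewrite visitsE; apply: bigcupT_measurable => n; exact: hits_measurable. Qed.

Lemma multiplicity_le1 eta x : multiplicity K eta x <= 1.
Proof. by apply: probability_le1; exact: visits_measurable. Qed.

(* A curve stopped at time [k] and visiting a point near [x0] belongs to the
   closed set [hits x0 r k], which decreases to [hits x0 0 k] as [r] tends to 0. *)
Lemma multiplicity_usc (U : set_system nat) (FU : Filter U)
  (eta_ : nat -> probability (curve R d) R) eta (M : R) :
  (forall F (c : R), closed F -> eta F < c%:E -> U [set n | eta_ n F < c%:E]) ->
  (forall n (k : nat), eta_ n (~` stopped_at k.+1%:R) <= (M / k.+1%:R)%:E) ->
  forall (x0 : E) (c : R), multiplicity K eta x0 < c%:E ->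
  \forall x \near x0 & n \near U, multiplicity K (eta_ n) x < c%:E.
Proof.
move=> etaF tight x0 c mc.
have m_fin : multiplicity K eta x0 \is a fin_num.
  by apply: fin_num_measure; exact: visits_measurable.
pose m := fine (multiplicity K eta x0).
have mE : multiplicity K eta x0 = m%:E by rewrite fineK.
have mc' : (m < c)%R by rewrite -lte_fin -mE.
(* Half of the gap between [m] and [c] is left for the curves that still move after time [k + 1]. *)
pose c1 := ((m + c) / 2)%R.
have mc1 : (m < c1)%R by rewrite /c1; lra.
have [k kM] : exists k : nat, (M / k.+1%:R < c - c1)%R.
  by apply: div_natS_lt; rewrite /c1; lra.
have etaH : eta (hits x0 0%R k.+1%:R) < c1%:E.
  apply: (@le_lt_trans _ _ (multiplicity K eta x0)); last by rewrite mE lte_fin.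
  rewrite /multiplicity; apply: le_measure; rewrite ?inE.
  - exact: hits_measurable.
  - exact: visits_measurable.
  - by rewrite visitsE => g Hg; exists k.+1.
have [j etaj] : exists j, eta (hits x0 j.+1%:R^-1%R k.+1%:R) < c1%:E.
  have mH n := hits_measurable x0 n.+1%:R^-1%R k.+1%:R.
  have mu_cvg : eta \o (fun n => hits x0 n.+1%:R^-1%R k.+1%:R) @ \oo -->
      eta (\bigcap_n hits x0 n.+1%:R^-1%R k.+1%:R).
    apply: nonincreasing_cvg_mu => //.
    - by rewrite (le_lt_trans (probability_le1 _ (mH 0%N)))// ltry.
    - exact: bigcapT_measurable.
    - move=> p q pq; apply/subsetPset => g [Kg [t tk le]]; split => //.
      by exists t => //; apply: le_trans le _; rewrite lef_pV2 ?posrE ?ltr0n// ler_nat.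
  rewrite hits_bigcap in mu_cvg.
  have [N _ NP] := mu_cvg _ (open_nbhs_nbhs (conj (@open_ereal_lt_ereal R c1%:E) etaH)).
  by exists N; exact: (NP N (leqnn N)).
have Uj := etaF _ _ (@hits_closed x0 j.+1%:R^-1%R k.+1%:R) etaj.
exists ([set x | (enorm (x0 - x) < j.+1%:R^-1)%R],
   [set n | eta_ n (hits x0 j.+1%:R^-1%R k.+1%:R) < c1%:E]).
  by split => //=; apply/nbhs_enormP; exists j.+1%:R^-1%R.
move=> [x n] /= [x0x nH].
apply: (@le_lt_trans _ _ (eta_ n (hits x0 j.+1%:R^-1%R k.+1%:R `|` ~` stopped_at k.+1%:R))).
  rewrite /multiplicity; apply: le_measure; rewrite ?inE.
  - exact: visits_measurable.
  - apply: measurableU; first exact: hits_measurable.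
    by apply: measurableC; apply: closed_borel; exact: stopped_at_closed.
  - move=> g [Kg [t t0 gt]]; have [sg|] := pselect (stopped_at k.+1%:R g); last by right.
    left; split => //; exists (Num.min t k.+1%:R).
      by rewrite le_min t0 ler0n ge_min lexx orbT.
    have -> : curve_fun g (Num.min t k.+1%:R) = x.
      by have [tk|/ltW kt] := leP t k.+1%:R; rewrite // -(sg t kt).
    by rewrite enormB ltW.
apply: le_lt_trans (measureU2 _ _ _) _.
- exact: hits_measurable.
- by apply: measurableC; apply: closed_borel; exact: stopped_at_closed.
apply: (@lt_le_trans _ _ (c1%:E + (c - c1)%:E)); last by rewrite -EFinD subrKC.
apply: lteD => //; apply: (le_lt_trans (tight n k)); by rewrite lte_fin.
Qed.

End multiplicity_usc.

Section weight.
Context {R : realType} {d : nat}.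
Local Notation E := 'rV[R]_d.
Variables (K : set E) (cK : compact K) (alpha : R).
Hypothesis alpha01 : 0 <= alpha <= 1.
Local Open Scope ereal_scope.
Implicit Types (eta : probability (curve R d) R).

Definition weight eta (x : E) : \bar R := mpow alpha (multiplicity K eta x).

Lemma multiplicity_ge0 eta x : 0 <= multiplicity K eta x.
Proof. exact: measure_ge0. Qed.

Lemma weight_ge0 eta x : 0 <= weight eta x.
Proof. exact/mpow_ge0/multiplicity_ge0. Qed.

Lemma weight_ge1 eta x : 1 <= weight eta x.
Proof.
apply: mpow_ge1 => //; exact: multiplicity_le1.
Qed.

Lemma weight_lsc (U : set_system nat) (FU : Filter U)
  (eta_ : nat -> probability (curve R d) R) eta (M : R) :
  (forall F (c : R), closed F -> eta F < c%:E -> U [set n | eta_ n F < c%:E]) ->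
  (forall n (k : nat), eta_ n (~` stopped_at k.+1%:R) <= (M / k.+1%:R)%:E) ->
  forall x, liminf_ge (filter_prod (nbhs x) U)
    (fun p => weight (eta_ p.2) p.1) (weight eta x).
Proof.
move=> etaF tight x c cw.
have [s ms sP] := mpow_lsc alpha01 (multiplicity_ge0 eta x)
  (multiplicity_le1 cK eta x) cw.
have FP : Filter (filter_prod (nbhs x) U) by exact: filter_prod_filter.
apply: (@filterS _ _ FP) (multiplicity_usc cK FU etaF tight ms) => -[y n] /= yn.
by apply: sP => //; exact: multiplicity_ge0.
Qed.

(** [weight_lsc] for the constant sequence [eta]: the tail bound of one plan makes its own weight
    lower semicontinuous. *)
Lemma weight_open eta (M : R) :
  (forall k : nat, eta (~` stopped_at k.+1%:R) <= (M / k.+1%:R)%:E) ->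
  forall c : R, open [set x | c%:E < weight eta x].
Proof.
move=> tight c; rewrite openE => x cw.
have [[A B] [/= nA [N _ NB]] AB] := @weight_lsc \oo eventually_filter (fun=> eta) eta M
  (fun F c _ H => @filterE _ \oo eventually_filter _ (fun=> H)) (fun=> tight) x c cw.
apply: filterS nA => y Ay; exact: (AB (y, N) (conj Ay (NB N (leqnn N)))).
Qed.

End weight.

(** * Marginals and normalised plans *)

Section marginals_measurable.
Context {R : realType} {d : nat}.
Local Notation E := 'rV[R]_d.

Lemma measurable_of_closed dT (T : measurableType dT) (X : ptopologicalType)
    (f : T -> borelType X) :
  (forall F : set X, closed F -> measurable (f @^-1` F)) -> measurable_fun setT f.
Proof.
move=> mf; apply: (@measurability _ _ T (borelType X) setT f (@open X)); first by [].
move=> _ [G oG <-].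
rewrite setTI -[X in measurable X]setCK; apply: measurableC.
by rewrite preimage_setC; apply: mf; exact: open_closedC.
Qed.

Lemma pi0_measurable : measurable_fun setT (@pi0 R d).
Proof.
apply: measurable_of_closed => F cF; apply: closed_borel.
exact: (@curve_eval_closed R d 0 F cF).
Qed.

Definition converges_into (F : set E) : set (curve R d) :=
  [set g | exists2 l, F l & curve_fun g t @[t --> +oo] --> l].

(** The Cauchy criterion at integer times, together with closeness to the closed set [F]: only
    countable operations on closed and open sets of curves. *)
Lemma converges_intoE F : closed F -> converges_into F =
  \bigcap_m \bigcup_N
    ([set g | forall t, N%:R <= t ->
         enorm (curve_fun g t - curve_fun g N%:R) <= m.+1%:R^-1] `&`
     [set g | exists2 y, F y & enorm (curve_fun g N%:R - y) < m.+1%:R^-1]).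
Proof.
move=> cF; apply/seteqP; split => [g [l Fl gl] m _|g Hg].
  have m0 : 0 < m.+1%:R^-1 / 2 :> R by rewrite divr_gt0.
  have [A [_ AP]] : \forall t \near +oo, enorm (l - curve_fun g t) < m.+1%:R^-1 / 2.
    by apply: (gl [set x | enorm (l - x) < m.+1%:R^-1 / 2]); apply/nbhs_enormP; exists (m.+1%:R^-1 / 2).
  have [N NA] : exists N : nat, A < N%:R.
    exists (Num.bound A); case: (leP 0 A) => [/archi_boundP//|A0].
    exact: lt_le_trans A0 _.
  exists N => //; split => [t Nt|].
    have h1 := AP t (lt_le_trans NA Nt); have h2 := AP _ NA.
    have := enorm_triangle l (g t) (g N%:R); rewrite enormB in h1.
    move: h1 h2; move: m.+1%:R^-1 => a /=; lra.
  exists l => //; rewrite enormB; have := AP _ NA; move: m0; move: m.+1%:R^-1 => a /=; lra.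
have gc : cvg (curve_fun g t @[t --> +oo]).
  apply/cauchy_cvgP/cauchy_exP => e e0; have [m me] := harmonic_lt e0.
  have [N _ [gN _]] := Hg m Logic.I; exists (curve_fun g N%:R).
  exists N%:R; split; first exact: num_real.
  move=> t /ltW/gN gt; rewrite -ball_normE/=.
  by apply: le_lt_trans (norm_le_enorm _) _; rewrite enormB; exact: le_lt_trans gt me.
have /cvg_ex[l gl] := gc; exists l => //.
apply: cF => A /nbhs_enormP[e e0 eA].
have e30 : 0 < e / 3 by rewrite divr_gt0.
have [m me] := harmonic_lt e30.
have [N _ [gN [y Fy Ny]]] := Hg m Logic.I; exists y; split => //; apply: eA.
have [B [_ BP]] : \forall t \near +oo, enorm (l - curve_fun g t) < e / 3.
  by apply: (gl [set x | enorm (l - x) < e / 3]); apply/nbhs_enormP; exists (e / 3).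
pose t := Num.max N%:R (B + 1).
have h1 : enorm (l - curve_fun g t) < e / 3.
  by apply: BP; rewrite lt_max ltrDl ltr01 orbT.
have h2 : enorm (curve_fun g t - curve_fun g N%:R) <= m.+1%:R^-1.
  by apply: gN; rewrite le_max lexx.
have h3 := enorm_triangle (g t) l y.
have h4 := enorm_triangle (g N%:R) (g t) y.
move: me Ny h1 h2 h3 h4; move: m.+1%:R^-1 => a; lra.
Qed.

Lemma converges_into_measurable F : closed F -> measurable (converges_into F).
Proof.
move=> cF; rewrite converges_intoE//; apply: bigcapT_measurable => m.
apply: bigcupT_measurable => N; apply: measurableI.
  apply: closed_borel.
  rewrite (_ : mkset _ = \bigcap_(t in [set t | N%:R <= t])
    ((fun g : curve R d => enorm (curve_fun g t - curve_fun g N%:R)) @^-1`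
      [set x | x <= m.+1%:R^-1])); last by apply/seteqP; split.
  apply: closed_bigI => t _.
  apply: ((continuous_closedP _).1 _ _ (@closed_le R _)) => g.
  apply: (@cvg_comp _ _ _ (fun h : curve R d => curve_fun h t - curve_fun h N%:R) (@enorm R d) _
    (nbhs (curve_fun g t - curve_fun g N%:R))); last exact: enorm_continuous.
  exact: (cvgB (@curve_eval_continuous R d t g) (@curve_eval_continuous R d N%:R g)).
apply: open_borel.
apply: (@curve_eval_open R d N%:R [set x | exists2 y, F y & enorm (x - y) < m.+1%:R^-1]).
rewrite openE => x [y Fy xy]; apply/nbhs_enormP.
exists (m.+1%:R^-1 - enorm (x - y)); first by rewrite subr_gt0.
move=> z xz; exists y => //; have := enorm_triangle x z y; rewrite (enormB z x).
move: xz xy; move: m.+1%:R^-1 => a; lra.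
Qed.

(** On divergent curves [lim] takes the default value [point]; these curves belong to the preimage
    of [F] all together or not at all. *)
Lemma pioo_measurable : measurable_fun setT (@pioo R d).
Proof.
apply: measurable_of_closed => F cF.
have piooE (g : curve R d) l : curve_fun g t @[t --> +oo] --> l -> pioo g = l.
  by move=> gl; apply: cvg_lim gl; exact: rV_hausdorff.
have piooN (g : curve R d) : ~ converges_into setT g -> pioo g = point.
  by move=> ng; apply: dvgP => /cvg_ex[l gl]; apply: ng; exists l.
have -> : @pioo R d @^-1` F =
    converges_into F `|` (~` converges_into setT `&` [set g | F (point : E)]).
  apply/seteqP; split => g /=.
    have [[l _ gl]|/[dup] ng /piooN->] := pselect (converges_into setT g); last by right.
    by rewrite (piooE g l gl) => Fl; left; exists l.
  by move=> [[l Fl /piooE->]//|[/piooN-> //]].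
apply: measurableU; first exact: converges_into_measurable.
apply: measurableI; last first.
  have [Fp|nFp] := pselect (F (point : E)).
    by rewrite (_ : mkset _ = setT)//; apply/seteqP; split.
  by rewrite (_ : mkset _ = set0)//; apply/seteqP; split.
apply: measurableC; exact: (converges_into_measurable closedT).
Qed.

End marginals_measurable.

Section probability_facts.
Context {R : realType}.
Local Open Scope ereal_scope.

Lemma probability_full_setC d (T : measurableType d) (P : probability T R) (A : set T) :
  measurable A -> P A = 1 -> P (~` A) = 0.
Proof. by move=> mA PA; rewrite probability_setC// PA subee. Qed.

Lemma probability_full_eq d (T : measurableType d) (P : probability T R)
    (A B C : set T) : measurable A -> measurable B -> measurable C -> P A = 1 ->
  B `&` A = C `&` A -> P B = P C.
Proof.
move=> mA mB mC PA BC.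
have key (D : set T) : measurable D -> P D = P (D `&` A).
  move=> mD; apply: (etrans (measureDI P mD mA)).
  rewrite -[RHS]add0e; congr (_ + _).
  apply: (subset_measure0 _ _ (@subIsetr _ D (~` A))) => //.
  - exact: measurableD.
  - exact: measurableC.
  - exact: probability_full_setC.
by rewrite key// BC -key.
Qed.

Lemma probability_full_integral d (T : measurableType d) (P : probability T R)
    (A : set T) (f : T -> \bar R) : measurable A -> P A = 1 -> (forall x, 0 <= f x) ->
  \int[P]_x f x = \int[P]_(x in A) f x.
Proof.
move=> mA PA f0.
rewrite (ge0_negligible_integral_nonmeasurable measurableT (measurableC mA))//.
  by rewrite setTD setCK.
exact: probability_full_setC.
Qed.

Lemma pushforward_probability d1 d2 (X : measurableType d1) (Y : measurableType d2)
    (P : probability X R) (phi : X -> Y) : measurable_fun setT phi ->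
  exists Q : probability Y R, (forall A, Q A = P (phi @^-1` A)) /\
    forall f : Y -> \bar R, measurable_fun setT f -> (forall y, 0 <= f y) ->
      \int[Q]_y f y = \int[P]_x f (phi x).
Proof.
move=> mphi.
pose phi' : {RV P >-> Y} := HB.pack phi (isMeasurableFun.Build _ _ _ _ phi mphi).
exists (distribution P phi'); split => // f mf f0.
by rewrite (@ge0_integral_pushforward _ _ _ _ _ phi mphi P setT f) ?preimage_setT.
Qed.

End probability_facts.

Section normalisation.
Context {R : realType} {d : nat}.
Local Notation E := 'rV[R]_d.
Variables (K : set E) (cK : compact K) (alpha : R).
Hypothesis alpha01 : (0 <= alpha <= 1)%R.
Local Open Scope ereal_scope.
Implicit Types (eta : probability (curve R d) R).

Lemma curve_lengthE (g : curve R d) : curve_length g = wlen (cst 1) g.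
Proof.
rewrite -wlenE//; last exact: open_gt_cst.
by apply: eq_integral => t _; rewrite mul1e.
Qed.

Lemma length_markov eta (B : set (curve R d)) (c : R) : (0 <= c)%R ->
  measurable B -> B `<=` Gamma K -> (forall g, B g -> c%:E <= wlen (cst 1) (curve_fun g)) ->
  c%:E * eta B <= \int[eta]_(g in Gamma K) curve_length g.
Proof.
move=> c0 mB BK Bc; rewrite -integral_cst//.
apply: (@le_trans _ _ (\int[eta]_(g in B) curve_length g)).
  apply: ge0_le_integral_nonmeasurable => g Bg; rewrite ?lee_fin//.
  by rewrite curve_lengthE; exact: Bc.
apply: ge0_subset_integral => //; first exact: Gamma_measurable.
  apply: measurable_funS (@subsetT _ _) _ => //.
  by rewrite (funext curve_lengthE); exact: wlen1_measurable.
by move=> g _; rewrite curve_lengthE wlen_ge0.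
Qed.

Lemma IP_rectifiable eta : IP K eta -> eta (rectifiable K) = 1.
Proof.
move=> [eK fin]; have mG := Gamma_measurable cK; have mr := rectifiable_measurable cK.
have mN : measurable (Gamma K `\` rectifiable K) by exact: measurableD.
suff N0 : eta (Gamma K `\` rectifiable K) = 0.
  apply: esym; rewrite -eK; apply: (etrans (measureDI eta mG mr)).
  rewrite -[RHS]add0e; congr (_ + eta _); first exact: N0.
  by apply/seteqP; split => [g []|g rg]//; split => //; exact: (proj1 rg).
apply/eqP; rewrite eq_le measure_ge0 andbT leNgt; apply/negP => N0.
have eN : eta (Gamma K `\` rectifiable K) \is a fin_num by exact: fin_num_measure.
have I0 : 0 <= \int[eta]_(g in Gamma K) curve_length g.
  by apply: integral_ge0 => g _; rewrite curve_lengthE wlen_ge0.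
have If : \int[eta]_(g in Gamma K) curve_length g \is a fin_num by rewrite ge0_fin_numE.
pose e := fine (eta (Gamma K `\` rectifiable K)).
pose I := fine (\int[eta]_(g in Gamma K) curve_length g).
have e0 : (0 < e)%R by rewrite -lte_fin fineK.
have I0' : (0 <= I)%R by rewrite fine_ge0.
(* Lengths are infinite on this set, so Markov's inequality holds with any constant; [(I + 1) / e]
   turns it into [I + 1 <= I]. *)
have := @length_markov eta (Gamma K `\` rectifiable K) ((I + 1) / e)%R _ mN (@subDsetl _ _ _) _.
rewrite -(fineK If) -/I -(fineK eN) -/e -EFinM mulfVK ?gt_eqF// lee_fin.
rewrite gerDl ler10 => absurd; suff: false by []; apply: absurd.
  by apply: divr_ge0; [rewrite addr_ge0|exact: ltW].
move=> g [Kg ng]; suff -> : wlen (cst 1) (curve_fun g) = +oo by rewrite leey.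
by apply/eqP; rewrite eq_le leey leNgt /=; apply/negP => lt; apply: ng.
Qed.

(** The point [g t] is visited by the reparametrized curve at time [arclen g t]. *)
Lemma multiplicity_reparam_le eta (Q : probability (curve R d) R) :
  eta (rectifiable K) = 1 -> (forall A, Q A = eta (reparam K @^-1` A)) ->
  forall x, multiplicity K eta x <= multiplicity K Q x.
Proof.
move=> eA QE x; rewrite /multiplicity QE.
have mV := visits_measurable cK x; have mr := rectifiable_measurable cK.
rewrite (probability_full_eq mr mV (measurableI _ _ mV mr) eA); last first.
  by rewrite -[RHS]setIA (setIid (rectifiable K)).
apply: le_measure; rewrite ?inE; first exact: measurableI.
  by rewrite -[X in measurable X]setTI; exact: reparam_measurable.
move=> g [[Kg [t t0 gt]] rg]; split; first exact: reparam_Gamma.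
by exists (arclen g t); [exact: arclen_ge0|rewrite reparam_arclen].
Qed.

Lemma length_le_cost eta :
  \int[eta]_(g in Gamma K) curve_length g <= irrigation_cost K alpha eta.
Proof.
apply: ge0_le_integral_nonmeasurable => g _; first by rewrite curve_lengthE wlen_ge0.
apply: ge0_le_integral_nonmeasurable => t _; first by rewrite lee_fin enorm_ge0.
rewrite -[leLHS]mul1e; apply: lee_wpmul2r; first by rewrite lee_fin enorm_ge0.
exact: weight_ge1.
Qed.

(** The intermediate quantity is the weight of [Q] along the original curves. It is lower
    semicontinuous thanks to the tail bound of [Q], so [reparam_wlen_le] and [wlenE] apply to it,
    and it is at most the weight of [eta], about which no regularity is known. *)
Lemma normalisation (mu nu : probability (borelType E) R) eta (M : R) :
  IP_between K mu nu eta -> irrigation_cost K alpha eta <= M%:E ->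
  exists Q : probability (curve R d) R,
  [/\ Q (Gamma K) = 1,
     forall B : set (borelType E), measurable B -> Q (@pi0 R d @^-1` B) = mu B,
     forall B : set (borelType E), measurable B -> Q (@pioo R d @^-1` B) = nu B,
     forall k : nat, Q (~` stopped_at k.+1%:R) <= (M / k.+1%:R)%:E &
     \int[Q]_g wlen (weight K alpha Q) (curve_fun g) <= irrigation_cost K alpha eta].
Proof.
move=> [Ieta [eta0 etaoo]] etaM; have eA := IP_rectifiable Ieta.
have mr := rectifiable_measurable cK.
have [Q [QE Qint]] := pushforward_probability eta (reparam_measurable cK).
have mrho (B : set (curve R d)) : measurable B -> measurable (reparam K @^-1` B).
  by move=> mB; rewrite -[X in measurable X]setTI; exact: reparam_measurable.
have Qtight (k : nat) : Q (~` stopped_at k.+1%:R) <= (M / k.+1%:R)%:E.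
  have ms : measurable (~` stopped_at (k.+1%:R : R) : set (curve R d)).
    by apply: measurableC; apply: closed_borel; exact: stopped_at_closed.
  rewrite QE (probability_full_eq mr (mrho _ ms) (measurableI _ _ (mrho _ ms) mr) eA); last first.
    by rewrite -[RHS]setIA (setIid (rectifiable K)).
  rewrite EFinM lee_pdivlMr ?ltr0n// muleC.
  apply: le_trans etaM; apply: le_trans (length_le_cost eta).
  apply: length_markov => //.
  - by apply: measurableI => //; exact: mrho.
  - by move=> g [_ []].
  (* A curve of length less than [k + 1] is stopped by time [k + 1] once parametrized by arc
     length. *)
  move=> g [/= ng rg]; rewrite (wlen1_fin rg) lee_fin leNgt; apply/negP => /ltW lt.
  apply: ng => t kt; rewrite (reparam_stop cK rg (le_trans lt kt)).
  by rewrite -(reparam_stop cK rg lt).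
exists Q; split => //.
- rewrite QE; apply/eqP; rewrite eq_le probability_le1/=; last first.
    by apply: mrho; exact: Gamma_measurable.
  rewrite -eA; apply: le_measure; rewrite ?inE//.
    by apply: mrho; exact: Gamma_measurable.
  by move=> g rg; exact: reparam_Gamma.
- move=> B mB; rewrite -eta0// QE.
  have mpB : measurable (@pi0 R d @^-1` B).
    by rewrite -[X in measurable X]setTI; exact: pi0_measurable.
  apply: (probability_full_eq mr (mrho _ mpB) mpB eA).
  apply/seteqP; split => g [Bg rg]; split => //; move: Bg; rewrite /= /pi0.
    by rewrite reparam_start.
  by rewrite reparam_start.
- move=> B mB; rewrite -etaoo// QE.
  have mpB : measurable (@pioo R d @^-1` B).
    by rewrite -[X in measurable X]setTI; exact: pioo_measurable.
  apply: (probability_full_eq mr (mrho _ mpB) mpB eA).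
  by apply/seteqP; split => g [Bg rg]; split => //; move: Bg; rewrite /= pioo_reparam.
have wQ0 := weight_ge0 K alpha Q.
have wQo := weight_open cK alpha01 Qtight.
rewrite Qint; [|exact: wlen_measurable|by move=> g; exact: wlen_ge0].
rewrite (probability_full_integral mr eA); last by move=> g; exact: wlen_ge0.
rewrite /irrigation_cost (@ge0_negligible_integral_nonmeasurable _ _ _ eta (Gamma K)
  (~` rectifiable K)).
- rewrite (_ : Gamma K `\` _ = rectifiable K); last first.
    by apply/seteqP; split => [g [_ /contrapT]//|g rg]; split; [exact: (proj1 rg)|].
  apply: ge0_le_integral_nonmeasurable => g rg; first exact: wlen_ge0.
  apply: (le_trans (reparam_wlen_le cK wQ0 wQo rg)).
  rewrite -wlenE//; apply: ge0_le_integral_nonmeasurable => t _.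
    by rewrite mule_ge0// lee_fin enorm_ge0.
  apply: lee_wpmul2r; first by rewrite lee_fin enorm_ge0.
  apply: mpow_anti => //; first exact: multiplicity_reparam_le.
  exact: multiplicity_le1.
- exact: Gamma_measurable.
- exact: measurableC.
- exact: probability_full_setC.
- move=> g _; apply: integral_ge0 => t _; rewrite mule_ge0 ?lee_fin ?enorm_ge0//.
  exact: weight_ge0.
Qed.

End normalisation.

(** * Existence of a minimizer *)

Section limit_marginals.
Context {R : realType} {d : nat}.
Local Notation E := 'rV[R]_d.
Local Open Scope ereal_scope.

(** Complements reverse the inequality on open sets, while an open set is an increasing union of
    closed ones, which preserves it. The measures thus agree on open sets, a generating class stable
    under intersection. *)
Lemma probability_closed_le (P Q : probability (borelType E) R) :
  (forall F : set E, closed F -> P F <= Q F) ->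
  forall B : set (borelType E), measurable B -> P B = Q B.
Proof.
move=> PQ.
have PQo (G : set E) : open G -> P G = Q G.
  move=> oG; apply/eqP; rewrite eq_le; apply/andP; split; last first.
    have mG := open_borel oG; have mC := measurableC mG.
    have := PQ _ (open_closedC oG); rewrite !probability_setC//.
    rewrite -[P G]fineK ?fin_num_measure// -[Q G]fineK ?fin_num_measure//.
    by rewrite -!EFinB !lee_fin lerD2l lerN2.
  pose F n := [set x : E | forall y, (enorm (x - y) < n.+1%:R^-1)%R -> G y].
  have cF n : closed (F n).
    rewrite -[F n]setCK; apply: open_closedC; rewrite openE => x /= /existsNP[y].
    move=> /not_implyP[xy Gy]; apply/nbhs_enormP.
    exists (n.+1%:R^-1 - enorm (x - y))%R; first by rewrite subr_gt0.
    move=> z xz Fz; apply/Gy/Fz; have := enorm_triangle x z y; rewrite (enormB z x).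
    by move: xz xy; move: n.+1%:R^-1%R => a; lra.
  have FG n : F n `<=` G by move=> x; apply; rewrite subrr enorm0.
  have GE : G = \bigcup_n F n.
    apply/seteqP; split => [x Gx|x [n _ /FG]//].
    have /nbhs_enormP[e e0 eG] := open_nbhs_nbhs (conj oG Gx).
    have [n ne] := harmonic_lt e0; exists n => // y xy; apply: eG; exact: lt_trans ne.
  have mF n : measurable (F n : set (borelType E)) by exact: closed_borel.
  have PF : P \o F @ \oo --> P (\bigcup_n F n).
    apply: nondecreasing_cvg_mu => //; first exact: bigcupT_measurable.
    move=> m n mn; apply/subsetPset => x Fx y xy; apply: Fx.
    by apply: lt_le_trans xy _; rewrite lef_pV2 ?posrE ?ltr0n// ler_nat.
  rewrite [in leLHS]GE -(cvg_lim _ PF)//; apply: lime_le; first by apply/cvg_ex; exists (P (\bigcup_n F n)).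
  apply: nearW => n /=; apply: (le_trans (PQ _ (cF n))).
  by apply: le_measure; rewrite ?inE//; exact: open_borel.
move=> B mB; apply: (@measure_unique _ R (borelType E) (@open E) (fun=> setT) _ _ _ _ P Q) => //.
- exact: openI.
- by move=> _; exact: openT.
- by rewrite bigcup_const.
- by move=> _; apply: (le_lt_trans (probability_le1 P measurableT)); rewrite ltry.
Qed.

Variables (U : set_system nat) (UU : UltraFilter U).
Variables (eta_ : nat -> probability (curve R d) R) (eta : probability (curve R d) R).
Hypothesis eta_closed : forall F (c : R), closed F -> eta F < c%:E ->
  U [set n | eta_ n F < c%:E].

Lemma ultralimit_closed_ge (F : set (curve R d)) (c : R) : closed F ->
  (forall n, c%:E <= eta_ n F) -> c%:E <= eta F.
Proof.
move=> cF cn; rewrite leNgt; apply/negP => /(eta_closed cF) UF.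
have PU : ProperFilter U by exact: ultra_proper.
by have [n /=] := filter_ex UF; rewrite ltNge cn.
Qed.

Lemma ultralimit_pi0 (mu : probability (borelType E) R) :
  (forall n (B : set (borelType E)), measurable B -> eta_ n (@pi0 R d @^-1` B) = mu B) ->
  forall B : set (borelType E), measurable B -> eta (@pi0 R d @^-1` B) = mu B.
Proof.
move=> etamu; have [Q [QE _]] := pushforward_probability eta (@pi0_measurable R d).
move=> B mB; rewrite -QE; apply/esym/probability_closed_le => // F cF.
have mF := closed_borel cF; rewrite QE -[mu F]fineK ?fin_num_measure//.
apply: ultralimit_closed_ge; first exact: (@curve_eval_closed R d 0 F cF).
by move=> n; rewrite etamu// fineK ?fin_num_measure.
Qed.

Variable M : R.
Hypothesis tight : forall n (k : nat),
  eta_ n (~` stopped_at k.+1%:R) <= (M / k.+1%:R)%:E.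

Lemma stopped_at_measurable (k : R) : measurable (stopped_at k : set (curve R d)).
Proof. by apply: closed_borel; exact: stopped_at_closed. Qed.

Lemma ultralimit_tight (k : nat) : eta (~` stopped_at k.+1%:R) <= (M / k.+1%:R)%:E.
Proof.
have ms := @stopped_at_measurable k.+1%:R.
rewrite probability_setC// leeBlDr ?fin_num_measure// -leeBlDl//.
rewrite -EFinB; apply: ultralimit_closed_ge; first exact: stopped_at_closed.
move=> n; rewrite EFinB leeBlDl// -leeBlDr ?fin_num_measure// -probability_setC//.
Qed.

Lemma pioo_stopped (k : R) (g : curve R d) : stopped_at k g -> pioo g = curve_fun g k.
Proof.
move=> sg; apply: cvg_lim; first exact: rV_hausdorff.
move=> A nA; exists k; split; first exact: num_real.
by move=> t /ltW/sg; rewrite /= => ->; exact: nbhs_singleton.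
Qed.

(** The map [pioo] is not continuous, but on [stopped_at k.+1%:R] it is the evaluation at [k + 1],
    so the limit in [F] becomes the closed condition [D k]. The curves left out have mass at most
    [M / (k + 1)], which tends to 0. *)
Lemma ultralimit_pioo (nu : probability (borelType E) R) :
  (forall n (B : set (borelType E)), measurable B -> eta_ n (@pioo R d @^-1` B) = nu B) ->
  forall B : set (borelType E), measurable B -> eta (@pioo R d @^-1` B) = nu B.
Proof.
move=> etanu; have [Q [QE _]] := pushforward_probability eta (@pioo_measurable R d).
have mpioo (B : set (borelType E)) : measurable B -> measurable (@pioo R d @^-1` B).
  by move=> mB; rewrite -[X in measurable X]setTI; exact: pioo_measurable.
move=> B mB; rewrite -QE; apply/esym/probability_closed_le => // F cF.
have mF := closed_borel cF; rewrite QE -[nu F]fineK ?fin_num_measure//.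
set v := fine (nu F).
pose D (k : nat) : set (curve R d) :=
  stopped_at k.+1%:R `&` [set g | F (curve_fun g k.+1%:R)].
have cD k : closed (D k).
  by apply: closedI; [exact: stopped_at_closed|exact: curve_eval_closed].
have mD k : measurable (D k) by exact: closed_borel.
have vD (k : nat) : (v - M / k.+1%:R)%:E <= eta (@pioo R d @^-1` F).
  apply: (@le_trans _ _ (eta (D k))); last first.
    apply: le_measure; rewrite ?inE//; first exact: mpioo.
    by move=> g [sg Fg]; rewrite /= (pioo_stopped sg).
  apply: ultralimit_closed_ge => // n.
  rewrite EFinB leeBlDr//; apply: (@le_trans _ _ (eta_ n (D k `|` ~` stopped_at k.+1%:R))).
    rewrite fineK ?fin_num_measure// -(etanu n)//.
    apply: le_measure; rewrite ?inE; first exact: mpioo.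
      by apply: measurableU => //; apply: measurableC; exact: stopped_at_measurable.
    move=> g Fg; have [sg|] := pselect (stopped_at k.+1%:R g); last by right.
    by left; split => //; move: Fg; rewrite /= (pioo_stopped sg).
  apply: le_trans (measureU2 _ _ _) _ => //.
    by apply: measurableC; exact: stopped_at_measurable.
  exact: leeD (lexx _) (tight n k).
apply/lee_addgt0Pr => e e0.
have [k kM] := div_natS_lt M e0.
rewrite -leeBlDr//; apply: le_trans (vD k); rewrite -EFinB lee_fin.
by rewrite lerD2l lerN2 ltW.
Qed.

End limit_marginals.

Lemma irrigation_costE (R : realType) (d : nat) (K : set 'rV[R]_d) (alpha M : R)
    (eta : probability (curve R d) R) :
  compact K -> (0 <= alpha <= 1)%R -> eta (Gamma K) = 1%E ->
  (forall k : nat, (eta (~` stopped_at k.+1%:R) <= (M / k.+1%:R)%:E)%E) ->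
  irrigation_cost K alpha eta =
  (\int[eta]_g wlen (weight K alpha eta) (curve_fun g))%E.
Proof.
move=> cK alpha01 eK tight.
rewrite (probability_full_integral (Gamma_measurable cK) eK); last first.
  by move=> g; exact: wlen_ge0.
apply: eq_integral => g _; rewrite -wlenE//.
  by move=> x; exact: weight_ge0.
by move=> c; exact: weight_open tight c.
Qed.

Theorem theorem1p9 (R : realType) (d : nat) (K : set 'rV[R]_d) (alpha : R)
    (mu nu : probability (borelType 'rV[R]_d) R) :
  compact K -> 0 <= alpha <= 1 ->
  mu K = 1%E -> nu K = 1%E ->
  IP_between K mu nu !=set0 ->
  exists2 eta, IP_between K mu nu eta &
    forall eta', IP_between K mu nu eta' ->
      (irrigation_cost K alpha eta <= irrigation_cost K alpha eta')%E.
Proof.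
move=> cK alpha01 _ _ [eta0 eta0P].
pose costs := [set irrigation_cost K alpha eta | eta in IP_between K mu nu].
have cost_ge0 eta : (0 <= irrigation_cost K alpha eta)%E.
  apply: integral_ge0 => g _; apply: integral_ge0 => t _.
  by rewrite mule_ge0 ?lee_fin ?enorm_ge0//; exact: weight_ge0.
have inf_le eta : IP_between K mu nu eta ->
    (ereal_inf costs <= irrigation_cost K alpha eta)%E.
  by move=> etaP; apply: ereal_inf_lbound; exists eta.
have inf_ge0 : (0 <= ereal_inf costs)%E.
  by apply: le_ereal_inf_tmp => _ [eta _ <-]; exact: cost_ge0.
(* If the infimum is infinite, every admissible plan is a minimizer, in particular [eta0]. *)
have [inf_fin|inf_oo] := boolP (ereal_inf costs \is a fin_num); last first.
  exists eta0 => // eta /inf_le; apply: le_trans.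
  by move: inf_oo; rewrite ge0_fin_numE// -leNgt leye_eq => /eqP ->; exact: leey.
pose c := fine (ereal_inf costs).
have cE : ereal_inf costs = c%:E by rewrite fineK.
(* A common bound for the costs of the minimizing sequence, which stay below [c + 1 / (n + 1)]; it
   yields one tail bound for all indices. *)
pose M := (c + 1)%R.
have /choice[eta_ eta_P] : forall n : nat, exists eta : probability (curve R d) R,
  [/\ eta (Gamma K) = 1%E,
     forall B : set (borelType 'rV[R]_d), measurable B -> eta (@pi0 R d @^-1` B) = mu B,
     forall B : set (borelType 'rV[R]_d), measurable B -> eta (@pioo R d @^-1` B) = nu B,
     forall k : nat, (eta (~` stopped_at k.+1%:R) <= (M / k.+1%:R)%:E)%E &
     (\int[eta]_g wlen (weight K alpha eta) (curve_fun g) <= (c + n.+1%:R^-1)%:E)%E].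
  move=> n; have n0 : 0 < n.+1%:R^-1 :> R by rewrite invr_gt0 ltr0n.
  have [_ [eta etaP <-] /ltW] := lb_ereal_inf_adherent n0 inf_fin.
  rewrite cE -EFinD => etan.
  have etaM : (irrigation_cost K alpha eta <= M%:E)%E.
    apply: le_trans etan _; rewrite lee_fin lerD2l invf_le1 ?ltr0n//.
    by rewrite ler1n.
  have [Q [Q1 Q2 Q3 Q4 Q5]] := normalisation cK alpha01 etaP etaM.
  by exists Q; split => //; exact: le_trans etan.
have [U [UU FU]] := @ultraFilterLemma nat \oo _.
have PU : ProperFilter U by exact: ultra_proper.
have FF : Filter U by exact: filter_filter.
have eta_K n : eta_ n (Gamma K) = 1%E by have [] := eta_P n.
have eta_pi0 n B : measurable B -> eta_ n (@pi0 R d @^-1` B) = mu B.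
  by have [_ + _ _ _] := eta_P n; exact.
have eta_pioo n B : measurable B -> eta_ n (@pioo R d @^-1` B) = nu B.
  by have [_ _ + _ _] := eta_P n; exact.
have eta_tight n (k : nat) : (eta_ n (~` stopped_at k.+1%:R) <= (M / k.+1%:R)%:E)%E.
  by have [_ _ _ + _] := eta_P n; exact.
have [eta [etaK eta_closed eta_open]] := ultralimit_probability
  (@curve_hausdorff R d) (@curve_regular R d) UU (Gamma_compact cK) eta_K.
have tight := ultralimit_tight UU eta_closed eta_tight.
have eta_le : (irrigation_cost K alpha eta <= c%:E)%E.
  rewrite (irrigation_costE cK alpha01 etaK tight).
  apply/lee_addgt0Pr => e e0; rewrite -EFinD.
  apply: (@ultralimit_integral_le R (curve R d) U UU eta_ eta eta_open
    (fun g => wlen (weight K alpha eta) (curve_fun g))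
    (fun n g => wlen (weight K alpha (eta_ n)) (curve_fun g))).
  - by move=> g; exact: wlen_ge0.
  - by move=> n g; exact: wlen_ge0.
  - move=> r; apply: wlen_open => [x|s]; first exact: weight_ge0.
    exact: weight_open tight s.
  - move=> n r; apply: open_borel; apply: wlen_open => [x|s]; first exact: weight_ge0.
    exact: weight_open (eta_tight n) s.
  - move=> g r gr.
    apply: (@wlen_lsc R d U FF (weight K alpha eta) (fun n => weight K alpha (eta_ n)) _ _ _ g r gr).
    + by move=> x; exact: weight_ge0.
    + by move=> n x; exact: weight_ge0.
    + exact: weight_lsc eta_closed eta_tight.
  - apply: FU; have [N Ne] := harmonic_lt e0; exists N => // n /= Nn.
    have [_ _ _ _ +] := eta_P n; move/le_trans; apply.
    rewrite lee_fin lerD2l; apply: le_trans (ltW Ne).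
    by rewrite lef_pV2 ?posrE ?ltr0n// ler_nat.
exists eta; last by move=> eta' /inf_le; rewrite cE; exact: le_trans.
split; last first.
  split; first exact: (ultralimit_pi0 UU eta_closed eta_pi0).
  exact: (ultralimit_pioo UU eta_closed eta_tight eta_pioo).
(* The weight is at least 1, so a finite cost forces a finite mean length. *)
split=> //; apply: le_lt_trans (length_le_cost cK alpha01 eta) _.
exact: le_lt_trans eta_le (ltry _).
Qed.
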